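(* Let $M$ be a von Neumann algebra with a faithful normal tracial state $\tau$, and suppose that the center of $M$ is diffuse (has no minimal projections). Then $\beta_1^{(2)}(M,\tau)=0$; and, when $M$ is generated as a von Neumann algebra by a finite set (so that $\Delta(M,\tau)$ is defined), $\Delta(M,\tau)=1$.
   Context: Notation: $\otimes$ is the algebraic tensor product, $\bar\otimes$ the von Neumann algebra tensor product, $M^{o}$ the opposite algebra. $L^2$-Betti numbers: regard $M$ as a left $M\otimes M^o$-module by $(m\otimes n^o)\cdot a=man$, and $M\bar\otimes M^o$ as a right $M\otimes M^o$-module by right multiplication and a left $M\bar\otimes M^o$-module by left multiplication. Put $\beta_k^{(2)}(M,\tau)=\dim_{M\bar\otimes M^o}\mathrm{Tor}_k^{M\otimes M^o}(M;M\bar\otimes M^o)$. Here $\dim_N V$, for an algebraic left module $V$ over a finite von Neumann algebra $N$ with trace, is Lück's dimension: the supremum of the Murray–von Neumann dimensions of finitely generated projective submodules of $V$. The quantity $\Delta$: let $J$ be the Tomita conjugation on $L^2(M)=L^2(M,\tau)$, $T^\sigma=JT^*J$ for $T\in B(L^2(M))$, let $FR$ and $HS$ be the finite-rank and Hilbert–Schmidt operators on $L^2(M)$, and $P_1$ the projection onto the trace vector. The map $x\otimes y^o\mapsto xP_1y$ extends to an isometric isomorphism $L^2(M\bar\otimes M^o)\cong HS$, under which the left action of $m\otimes n^o$ becomes $T\mapsto mTn$; via this $HS^n$ is a Hilbert left $M\bar\otimes M^o$-module, and $\dim_{M\bar\otimes M^o}$ of a closed submodule of $HS^n$ is its Murray–von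 Neumann dimension. A finite subset of $M$ is self-adjoint if it is closed under $*$. For finite self-adjoint sets $F=\{X_1,\dots,X_n\}\subset F'=F\cup\{Y_1,\dots,Y_m\}$ in $M$ put $$\Delta(F:F')=n-\dim_{M\bar\otimes M^o}\Big((HS^n\oplus 0)\cap\overline{\{(T_1,\dots,T_n,S_1,\dots,S_m)\in FR^{n+m}:\textstyle\sum_j[T_j,X_j^\sigma]+\sum_j[S_j,Y_j^\sigma]=0\}}^{HS}\Big).$$ Finally $\Delta(M,\tau)=\sup_F\inf_{F'\supset F}\Delta(F:F')$, where $F$ runs over the finite self-adjoint sets that generate $M$ as a von Neumann algebra and $F'$ over the finite self-adjoint subsets of $M$ containing $F$. *)

(* Defs.v *)
From HB Require Import structures.
From mathcomp Require Import all_boot all_order all_algebra.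
From mathcomp Require Import all_classical all_reals all_analysis.
From mathcomp Require Import complex.

Set Implicit Arguments.
Unset Strict Implicit.
Unset Printing Implicit Defensive.

Import Order.TTheory GRing.Theory Num.Theory.
Import numFieldNormedType.Exports.
Local Open Scope ring_scope.
Local Open Scope classical_set_scope.

(* [presented adm] is the left A-module generated by the set G subject to all
   the relations satisfied by every map [g : G -> V] into a left A-module with
   [adm g]: formal A-combinations of elements of G, two of them being
   identified when all admissible maps give them the same value. When [adm]
   is given by equations this is the target of the universal admissible map
   [pgen]; free modules, tensor products and homology modules are obtained in
   this way. *)
Section Presented.
Local Open Scope quotient_scope.
Variables (A : pzRingType) (G : Type).
Variable adm : forall V : lmodType A, (G -> V) -> Prop.

Definition fsum := {classic seq (A * G)}.

Definition feval (V : lmodType A) (g : G -> V) (s : fsum) : V :=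
  \sum_(t <- (s : seq (A * G))) t.1 *: g t.2.

Definition feq (s t : fsum) : bool :=
  `[< forall (V : lmodType A) (g : G -> V), adm g -> feval g s = feval g t >].

Lemma feq_refl : reflexive feq. Proof. by move=> s; apply/asboolP. Qed.
Lemma feq_sym : symmetric feq.
Proof.
by move=> s t; apply/idP/idP => /asboolP h; apply/asboolP => V g ag; rewrite h.
Qed.
Lemma feq_trans : transitive feq.
Proof.
move=> s t u /asboolP h1 /asboolP h2; apply/asboolP => V g ag.
by rewrite h1 ?h2.
Qed.

Canonical feq_equiv := EquivRel feq feq_refl feq_sym feq_trans.

Definition presented := {eq_quot feq_equiv}.
HB.instance Definition _ := Choice.on presented.
HB.instance Definition _ := EqQuotient.on presented.

Definition plift (V : lmodType A) (g : G -> V) (x : presented) : V :=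
  feval g (repr x).

Definition pgen (x : G) : presented := \pi_presented ([:: (1, x)] : fsum).

Lemma plift_pi (V : lmodType A) (g : G -> V) (s : fsum) :
  adm g -> plift g (\pi_presented s) = feval g s.
Proof.
move=> ag; rewrite /plift; case: piP => t /eqmodP /asboolP h.
by rewrite -(h V g ag).
Qed.

Lemma plift_inj (x y : presented) :
  (forall (V : lmodType A) (g : G -> V), adm g -> plift g x = plift g y) ->
  x = y.
Proof.
move=> h; rewrite -[x]reprK -[y]reprK; apply/eqmodP/asboolP => V g ag.
exact: h.
Qed.

Lemma plift_gen (V : lmodType A) (g : G -> V) x :
  adm g -> plift g (pgen x) = g x.
Proof. by move=> ag; rewrite plift_pi// /feval big_seq1 scale1r. Qed.

Definition presented_zero : presented := \pi_presented ([::] : fsum).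
Definition presented_add (x y : presented) : presented :=
  \pi_presented (((repr x : seq _) ++ (repr y : seq _)) : fsum).
Definition presented_scale (a : A) (x : presented) : presented :=
  \pi_presented ([seq (a * t.1, t.2) | t <- (repr x : seq _)] : fsum).
Definition presented_opp (x : presented) : presented := presented_scale (-1) x.

Lemma plift0 (V : lmodType A) (g : G -> V) : adm g -> plift g presented_zero = 0.
Proof. by move=> ag; rewrite plift_pi// /feval big_nil. Qed.
Lemma pliftD (V : lmodType A) (g : G -> V) x y : adm g ->
  plift g (presented_add x y) = plift g x + plift g y.
Proof. by move=> ag; rewrite plift_pi// /feval big_cat. Qed.
Lemma pliftZ (V : lmodType A) (g : G -> V) a x : adm g ->
  plift g (presented_scale a x) = a *: plift g x.
Proof.
move=> ag; rewrite plift_pi// /plift /feval big_map scaler_sumr.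
by apply: eq_bigr => t _; rewrite scalerA.
Qed.

Lemma presented_addA : associative presented_add.
Proof. by move=> x y z; apply: plift_inj => V g ag; rewrite !pliftD// addrA. Qed.
Lemma presented_addC : commutative presented_add.
Proof. by move=> x y; apply: plift_inj => V g ag; rewrite !pliftD// addrC. Qed.
Lemma presented_add0 : left_id presented_zero presented_add.
Proof. by move=> x; apply: plift_inj => V g ag; rewrite pliftD// plift0// add0r. Qed.
Lemma presented_addN : left_inverse presented_zero presented_opp presented_add.
Proof.
move=> x; apply: plift_inj => V g ag.
by rewrite pliftD// pliftZ// plift0// scaleN1r addNr.
Qed.
HB.instance Definition _ := GRing.isZmodule.Build presented
  presented_addA presented_addC presented_add0 presented_addN.

Lemma presented_scaleA a b x :
  presented_scale a (presented_scale b x) = presented_scale (a * b) x.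
Proof. by apply: plift_inj => V g ag; rewrite !pliftZ// scalerA. Qed.
Lemma presented_scale1 : left_id 1 presented_scale.
Proof. by move=> x; apply: plift_inj => V g ag; rewrite pliftZ// scale1r. Qed.
Lemma presented_scaleDr : right_distributive presented_scale +%R.
Proof.
move=> a x y; apply: plift_inj => V g ag.
by rewrite !(pliftZ, pliftD)// scalerDr.
Qed.
Lemma presented_scaleDl x : {morph presented_scale^~ x : a b / a + b}.
Proof.
move=> a b; apply: plift_inj => V g ag.
by rewrite !(pliftZ, pliftD)// scalerDl.
Qed.
HB.instance Definition _ := GRing.Zmodule_isLmodule.Build A presented
  presented_scaleA presented_scale1 presented_scaleDr presented_scaleDl.

Lemma plift_is_linear (V : lmodType A) (g : G -> V) : adm g -> linear (plift g).
Proof. by move=> ag a x y; rewrite (pliftD _ _ ag) (pliftZ _ _ ag). Qed.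

Definition plin (V : lmodType A) (g : G -> V) (ag : adm g) :
    {linear presented -> V} :=
  HB.pack (plift g)
    (GRing.isLinear.Build A presented V *:%R (plift g) (plift_is_linear ag)).

End Presented.
Arguments plift {A G adm V}.
Arguments plin {A G adm V}.
Arguments pgen {A G} adm.

Section PresentedMore.
Local Open Scope quotient_scope.
Variables (A : pzRingType) (G : Type).
Variable adm : forall V : lmodType A, (G -> V) -> Prop.

Lemma linear_pgen_eq (V : lmodType A) (f g : presented adm -> V) :
  linear f -> linear g -> (forall x, f (pgen adm x) = g (pgen adm x)) ->
  f =1 g.
Proof.
move=> lf lg fg x; rewrite -[x]reprK; move: (repr x) => s.
have f0 (h : presented adm -> V) : linear h -> h 0 = 0.
  by move=> lh; have := lh (-1) 0 0; rewrite scaler0 addr0 scaleN1r addNr.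
elim: s => [|[a y] s IH].
  have -> : \pi_(presented adm) ([::] : fsum A G) = 0 by [].
  by rewrite !f0.
have -> : \pi_(presented adm) ((a, y) :: s : fsum A G) =
    a *: pgen adm y + \pi_(presented adm) s.
  apply: plift_inj => W h ah.
  rewrite (pliftD _ _ ah) (pliftZ _ _ ah) plift_gen// !plift_pi//.
  by rewrite /feval big_cons.
by rewrite lf lg fg IH.
Qed.
End PresentedMore.

(* The tensor product B (x)_A P of the B-A-bimodule B (A acting on the right
   through rho) with a left A-module P, as a left B-module: universal for
   A-balanced maps on B * P that are left B-linear in B. *)
Section BaseChange.
Variables (A B : pzRingType) (rho : {rmorphism A -> B}).

Definition balanced (P : lmodType A) (V : lmodType B) (g : B * P -> V) : Prop :=
  [/\ forall b b' p, g (b' * b, p) = b' *: g (b, p),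
      forall b b' p, g (b + b', p) = g (b, p) + g (b', p),
      forall b p p', g (b, p + p') = g (b, p) + g (b, p') &
      forall a b p, g (b * rho a, p) = g (b, a *: p)].

Definition basechange (P : lmodType A) : lmodType B :=
  presented (@balanced P).

Lemma pgen_balanced (P : lmodType A) : balanced (pgen (@balanced P)).
Proof.
split=> *; apply: plift_inj => V g ag; have [h1 h2 h3 h4] := ag.
- by rewrite [plift _ (_ *: _)](pliftZ _ _ ag) !plift_gen.
- by rewrite [plift _ (_ + _)](pliftD _ _ ag) !plift_gen.
- by rewrite [plift _ (_ + _)](pliftD _ _ ag) !plift_gen.
- by rewrite !plift_gen.
Qed.

Lemma balanced_comp (P Q : lmodType A) (f : {linear P -> Q}) :
  balanced (fun t : B * P => pgen (@balanced Q) (t.1, f t.2)).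
Proof.
have [h1 h2 h3 h4] := pgen_balanced Q.
split=> * /=.
- by rewrite h1.
- by rewrite h2.
- by rewrite linearD h3.
- by rewrite linearZ h4.
Qed.

Definition basechange_map (P Q : lmodType A) (f : {linear P -> Q}) :
    {linear basechange P -> basechange Q} := plin _ (balanced_comp f).

End BaseChange.

(* ker d / im d' for composable d' and d with d \o d' = 0. *)
Section Homology.
Variables (A : pzRingType) (U V W : lmodType A).
Variables (d' : {linear U -> V}) (d : {linear V -> W}).

Definition cycles_mod_boundaries (X : lmodType A) (g : {v : V | d v = 0} -> X) :=
  [/\ forall x y z, sval z = sval x + sval y -> g z = g x + g y,
      forall a x y, sval y = a *: sval x -> g y = a *: g x &
      forall x u, sval x = d' u -> g x = 0].

Definition homology : lmodType A := presented cycles_mod_boundaries.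
End Homology.

(* The canonical free resolution of M: the free module on the set M, then the
   free module on the kernel of M <- F_0, then the free module on the kernel of
   F_0 <- F_1, and so on. *)
Section Resolution.
Variable (A : pzRingType).

Definition free_mod (X : Type) : lmodType A :=
  presented (fun (V : lmodType A) (g : X -> V) => True).

Definition free_map (X : Type) (Q : lmodType A) (g : X -> Q) :
    {linear free_mod X -> Q} := plin g I.

Record arrow := Arrow {
  asrc : lmodType A; atgt : lmodType A; amap : {linear asrc -> atgt} }.

Fixpoint free_res (M : lmodType A) (k : nat) : arrow :=
  if k is k'.+1 then
    let f := amap (free_res M k') in
    Arrow (free_map (fun x : {p | f p = 0} => sval x))
  else Arrow (free_map (fun x : M => x)).

Definition res_mod (M : lmodType A) k : lmodType A := asrc (free_res M k).
Definition res_diff (M : lmodType A) k :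
  {linear res_mod M k.+1 -> res_mod M k} := amap (free_res M k.+1).
End Resolution.

(* Tor_k^A(M; B) with its left B-module structure. The differential in degree 0
   is the zero map. *)
Section Tor.
Variables (A B : pzRingType) (rho : {rmorphism A -> B}) (M : lmodType A).

Definition tor_chain k : lmodType B := basechange rho (res_mod M k).
Definition tor_diff k : {linear tor_chain k -> tor_chain k.-1} :=
  if k is k'.+1 then basechange_map rho (res_diff M k') else \0.
Definition Tor k : lmodType B := homology (tor_diff k.+1) (tor_diff k).
End Tor.

Record hilbert (R : realType) := Hilbert {
  hcar :> completeNormedModType R[i];
  hdot : hcar -> hcar -> R[i];
  hdot_linear : forall a x y z,
    hdot (a *: x + y) z = a * hdot x z + hdot y z;
  hdot_conj : forall x y, hdot y x = (hdot x y)^*;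
  hdot_norm : forall x, hdot x x = `|x| ^+ 2 }.

Section Operators.
Variables (R : realType) (H : hilbert R).
Implicit Types (f g : H -> H) (x y : H).

Lemma hdotDl x y z : hdot (x + y) z = hdot x z + hdot y z.
Proof. by have := hdot_linear 1 x y z; rewrite scale1r mul1r. Qed.
Lemma hdot0l z : hdot (0 : H) z = 0.
Proof. by apply: (addrI (hdot 0 z)); rewrite -hdotDl !addr0. Qed.
Lemma hdotZl a x z : hdot (a *: x) z = a * hdot x z.
Proof. by have := hdot_linear a x 0 z; rewrite hdot0l !addr0. Qed.
Lemma hdotDr x y z : hdot x (y + z) = hdot x y + hdot x z.
Proof. by rewrite hdot_conj hdotDl rmorphD/= -!hdot_conj. Qed.
Lemma hdotZr a x z : hdot x (a *: z) = a^* * hdot x z.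
Proof. by rewrite hdot_conj hdotZl rmorphM/= -hdot_conj. Qed.
Lemma hdotBr x y z : hdot x (y - z) = hdot x y - hdot x z.
Proof. by rewrite hdotDr -scaleN1r hdotZr rmorphN1 mulN1r. Qed.
Lemma hdot_eq x y : (forall z, hdot z x = hdot z y) -> x = y.
Proof.
move=> h; apply/eqP; rewrite -subr_eq0 -normr_eq0 -sqrf_eq0 -hdot_norm.
by rewrite hdotBr h subrr.
Qed.

Definition bounded_linear f :=
  linear f /\ exists2 c : R[i], 0 <= c & forall x, `|f x| <= c * `|x|.

Definition adjoint_of f g := forall x y, hdot (f x) y = hdot x (g y).

(* By the Riesz representation theorem every bounded linear map has an adjoint,
   so the second clause does not restrict [operator H] = B(H); it makes the
   adjoint available without proving that theorem. *)
Definition is_operator f :=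
  bounded_linear f /\ exists2 g, bounded_linear g & adjoint_of f g.

Lemma bounded_linear_comb a f g :
  bounded_linear f -> bounded_linear g -> bounded_linear (a *: f + g).
Proof.
move=> [lf [c c0 hc]] [lg [d d0 hd]]; split=> [b x y|].
  rewrite !fctE lf lg !scalerDr !scalerA [a * b]mulrC -!addrA; congr (_ + _).
  by rewrite addrCA.
exists (`|a| * c + d) => [|x]; first by rewrite addr_ge0 ?mulr_ge0.
rewrite !fctE (le_trans (ler_normD _ _))// mulrDl lerD// normrZ -mulrA.
by rewrite ler_wpM2l.
Qed.

Lemma bounded_linear_comp f g :
  bounded_linear f -> bounded_linear g -> bounded_linear (f \o g).
Proof.
move=> [lf [c c0 hc]] [lg [d d0 hd]]; split=> [b x y|] /=; first by rewrite lg lf.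
exists (c * d) => [|x]; first exact: mulr_ge0.
by rewrite (le_trans (hc _))// -mulrA ler_wpM2l.
Qed.

Lemma bounded_linear0 : bounded_linear (0 : H -> H).
Proof.
split=> [a x y|]; first by rewrite -[LHS]/0 -[RHS]/(a *: 0 + 0) scaler0 addr0.
by exists 0 => // x; rewrite -[X in `|X|]/0 normr0 mul0r.
Qed.

Lemma bounded_linear1 : bounded_linear (id : H -> H).
Proof. by split=> //; exists 1 => // x; rewrite mul1r. Qed.

Lemma is_operator_comb a f g :
  is_operator f -> is_operator g -> is_operator (a *: f + g).
Proof.
move=> [bf [f' bf' ff']] [bg [g' bg' gg']]; split.
  exact: bounded_linear_comb.
exists (a^* *: f' + g'); first exact: bounded_linear_comb.
by move=> x y; rewrite !fctE hdotDl hdotZl ff' gg' hdotDr hdotZr conjCK.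
Qed.

Lemma is_operator0 : is_operator (0 : H -> H).
Proof.
split; first exact: bounded_linear0.
exists 0; first exact: bounded_linear0.
by move=> x y; rewrite -[LHS]/(hdot 0 y) -[RHS]/(hdot x 0) hdot0l hdot_conj hdot0l rmorph0.
Qed.

Lemma is_operator1 : is_operator (id : H -> H).
Proof. by split; [exact: bounded_linear1|exists id => //; exact: bounded_linear1]. Qed.

Lemma is_operator_comp f g :
  is_operator f -> is_operator g -> is_operator (f \o g).
Proof.
move=> [bf [f' bf' ff']] [bg [g' bg' gg']]; split.
  exact: bounded_linear_comp.
exists (g' \o f'); first exact: bounded_linear_comp.
by move=> x y /=; rewrite ff' gg'.
Qed.

Definition operatorb : pred (H -> H) := fun f => `[< is_operator f >].

Lemma operatorb_closed : GRing.subsemimod_closed operatorb.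
Proof.
split; first split.
- by apply/asboolP; exact: is_operator0.
- move=> f g /asboolP of_ /asboolP og; apply/asboolP.
  by rewrite -[f]scale1r; exact: is_operator_comb.
- move=> a f /asboolP of_; apply/asboolP; rewrite -[_ *: _]addr0.
  exact: is_operator_comb is_operator0.
Qed.
HB.instance Definition _ :=
  GRing.isSubmodClosed.Build R[i] (H -> H) operatorb operatorb_closed.

Definition operator := {f : H -> H | operatorb f}.
Definition fun_of_operator (T : operator) : H -> H := val T.
Coercion fun_of_operator : operator >-> Funclass.

HB.instance Definition _ := [isSub of operator for @sval _ _].
HB.instance Definition _ := [Choice of operator by <:].
HB.instance Definition _ := [SubChoice_isSubZmodule of operator by <:].
HB.instance Definition _ := [SubZmodule_isSubLmodule of operator by <:].

Implicit Types S T U : operator.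

Lemma operatorP T : is_operator T. Proof. exact/asboolP/(valP T). Qed.

Lemma operator_eq S T : S =1 T -> S = T.
Proof. by move=> h; apply: val_inj; apply/funext. Qed.

Definition Operator f (of_ : is_operator f) : operator :=
  exist _ f (asboolT of_).

Definition op_one := Operator is_operator1.
Definition op_mul S T := Operator (is_operator_comp (operatorP S) (operatorP T)).

Lemma op_mulA : associative op_mul.
Proof. by move=> S T U; exact: operator_eq. Qed.
Lemma op_mul1 : left_id op_one op_mul.
Proof. by move=> S; exact: operator_eq. Qed.
Lemma op_1mul : right_id op_one op_mul.
Proof. by move=> S; exact: operator_eq. Qed.
Lemma op_mulDl : left_distributive op_mul +%R.
Proof. by move=> S T U; exact: operator_eq. Qed.
Lemma operator_linear T : linear T. Proof. by case: (operatorP T) => -[]. Qed.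
Lemma operatorD T x y : T (x + y) = T x + T y.
Proof. by have := operator_linear T 1 x y; rewrite !scale1r. Qed.
Lemma op_mulDr : right_distributive op_mul +%R.
Proof. by move=> S T U; apply: operator_eq => x; exact: (operatorD S). Qed.
HB.instance Definition _ := GRing.Zmodule_isPzRing.Build operator
  op_mulA op_mul1 op_1mul op_mulDl op_mulDr.

Lemma op_scaleAl a S T : (a *: S) * T = a *: (S * T).
Proof. exact: operator_eq. Qed.
Lemma op_scaleAr a S T : S * (a *: T) = a *: (S * T).
Proof.
apply: operator_eq => x; have S0 : S 0 = 0.
  by apply: (addrI (S 0)); rewrite -operatorD !addr0.
by have := operator_linear S a (T x) 0; rewrite S0 !addr0.
Qed.

End Operators.

Section Adjoint.
Variables (R : realType) (H : hilbert R).
Implicit Types (S T U : operator H) (A : set (operator H)).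

Lemma adjoint_exists T : exists U, adjoint_of T U.
Proof.
have [bT [g bg Tg]] := operatorP T.
have og : is_operator g.
  split=> //; exists (T : H -> H) => // x y.
  by rewrite hdot_conj -Tg -hdot_conj.
by exists (Operator og).
Qed.

Definition adjoint T : operator H := xget 0 [set U : operator H | adjoint_of T U].

Lemma adjointP T : adjoint_of T (adjoint T).
Proof. by rewrite /adjoint; case: xgetP => // /(_ _) h; have [U /h] := adjoint_exists T. Qed.

Lemma adjoint_uniq T U : adjoint_of T U -> U = adjoint T.
Proof.
by move=> h; apply: operator_eq => x; apply: hdot_eq => z; rewrite -h -adjointP.
Qed.

Lemma adjointK : involutive adjoint.
Proof.
move=> T; apply/esym/adjoint_uniq => x y.
by rewrite hdot_conj -adjointP -hdot_conj.
Qed.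

Lemma adjointM S T : adjoint (S * T) = adjoint T * adjoint S.
Proof.
by apply/esym/adjoint_uniq => x y; rewrite [RHS]/= -!adjointP.
Qed.

Definition commutant A : set (operator H) :=
  [set x | forall y, A y -> x * y = y * x].

Definition star_closed A :=
  forall x, A x -> A (adjoint x).

Lemma commutant_star A : star_closed A -> star_closed (commutant A).
Proof.
move=> hA x cx y Ay.
by rewrite -[y]adjointK -!adjointM cx//; exact: hA.
Qed.

Lemma commutant3 A : commutant (commutant (commutant A)) = commutant A.
Proof.
apply/seteqP; split=> x hx y hy; last by rewrite hy.
by apply: hx => z hz; rewrite hz.
Qed.

Record vN_algebra := VNAlgebra {
  vN_set :> set (operator H);
  vN_star : star_closed vN_set;
  vN_bicommutant : commutant (commutant vN_set) = vN_set }.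

Lemma vN_gen_star A :
  star_closed (commutant (commutant [set x | A x \/ A (adjoint x)])).
Proof.
by do 2 apply: commutant_star; move=> x [] Ax; [right; rewrite adjointK|left].
Qed.

(* The von Neumann algebra generated by A (double commutant of A and A^* ). *)
Definition vN_gen A : vN_algebra :=
  VNAlgebra (@vN_gen_star A) (commutant3 _).

Lemma sub_vN_gen A : A `<=` vN_gen A.
Proof. by move=> x Ax y cy; rewrite -cy//; left. Qed.

End Adjoint.

Section Elements.
Variables (R : realType) (H : hilbert R) (M : vN_algebra H).

Definition vN_pred : pred (operator H) := fun x => `[< vN_set M x >].

Lemma vN_predP x : reflect (vN_set M x) (vN_pred x). Proof. exact: asboolP. Qed.

Lemma vN_pred_subring : GRing.subring_closed vN_pred.
Proof.
rewrite /GRing.subring_closed; split=> [|x y|x y].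
- apply/vN_predP; rewrite -vN_bicommutant => y _; by rewrite mul1r mulr1.
- move=> /vN_predP Mx /vN_predP My; apply/vN_predP.
  move: Mx My; rewrite -(vN_bicommutant M) => hx hy z hz.
  by rewrite mulrBl mulrBr hx// hy.
- move=> /vN_predP Mx /vN_predP My; apply/vN_predP.
  move: Mx My; rewrite -(vN_bicommutant M) => hx hy z hz.
  by rewrite -mulrA hy// mulrA hx// mulrA.
Qed.
HB.instance Definition _ :=
  GRing.isSubringClosed.Build (operator H) vN_pred vN_pred_subring.

Lemma vN_pred_scale : GRing.scaler_closed vN_pred.
Proof.
move=> a x /vN_predP Mx; apply/vN_predP.
move: Mx; rewrite -(vN_bicommutant M) => hx z hz.
by rewrite op_scaleAl op_scaleAr hx.
Qed.
HB.instance Definition _ :=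
  GRing.isScaleClosed.Build R[i] (operator H) vN_pred vN_pred_scale.

Definition elt := {x : operator H | vN_pred x}.
Definition operator_of_elt (x : elt) : operator H := val x.
Coercion operator_of_elt : elt >-> operator.
HB.instance Definition _ := [isSub of elt for @sval _ _].
HB.instance Definition _ := [Choice of elt by <:].
HB.instance Definition _ := [SubChoice_isSubZmodule of elt by <:].
HB.instance Definition _ := [SubZmodule_isSubLmodule of elt by <:].
HB.instance Definition _ := GRing.SubZmodule_isSubPzRing.Build _ _ elt (subringClosedP _).

Definition Elt x (Mx : vN_set M x) : elt := exist _ x (asboolT Mx).

Lemma eltP (x : elt) : vN_set M x. Proof. exact/vN_predP/(valP x). Qed.

Definition star (x : elt) : elt := Elt (vN_star (eltP x)).

Lemma elt_scaleAl a (x y : elt) : (a *: x) * y = a *: (x * y).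
Proof. by apply: val_inj; rewrite !(rmorphM, linearZ)/= op_scaleAl. Qed.
Lemma elt_scaleAr a (x y : elt) : x * (a *: y) = a *: (x * y).
Proof. by apply: val_inj; rewrite !(rmorphM, linearZ)/= op_scaleAr. Qed.

End Elements.

(* The algebraic tensor product M (x) M^o over the complex numbers; [pure x y]
   stands for x (x) y^o, so that the second factors multiply in reverse order. *)
Section TensorAlgebra.
Variables (R : realType) (H : hilbert R) (M : vN_algebra H).
Implicit Types (x y z w : elt M).

Definition bilinear_on (V : lmodType R[i]) (g : elt M * elt M -> V) : Prop :=
  (forall y, linear (fun x => g (x, y))) /\
  (forall x, linear (fun y => g (x, y))).

Definition enveloping := presented bilinear_on.
HB.instance Definition _ := GRing.Lmodule.on enveloping.

Definition pure x y : enveloping := pgen bilinear_on (x, y).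

Lemma pgen_bilinear : bilinear_on (pgen bilinear_on).
Proof.
split=> z a x y; apply: plift_inj => V g ag; have [h1 h2] := ag;
  rewrite (plift_is_linear ag) !plift_gen//.
- exact: h1.
- exact: h2.
Qed.

Lemma pure_linl y : linear (pure^~ y).
Proof. exact: pgen_bilinear.1. Qed.
Lemma pure_linr x : linear (pure x).
Proof. exact: pgen_bilinear.2. Qed.

Definition tmul_pure (u v : elt M * elt M) : enveloping :=
  pure (u.1 * v.1) (v.2 * u.2).

Lemma tmul_pure_bilinr u : bilinear_on (tmul_pure u).
Proof.
split=> z a x y; rewrite /tmul_pure /=.
- by rewrite mulrDr elt_scaleAr pure_linl.
- by rewrite mulrDl elt_scaleAl pure_linr.
Qed.

Lemma tmul_pure_bilinl v : bilinear_on (tmul_pure^~ v).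
Proof.
split=> z a x y; rewrite /tmul_pure /=.
- by rewrite mulrDl elt_scaleAl pure_linl.
- by rewrite mulrDr elt_scaleAr pure_linr.
Qed.

Lemma feval_linear (G : Type) (V : lmodType R[i]) (f g h : G -> V) a s :
  (forall i, h i = a *: f i + g i) -> feval h s = a *: feval f s + feval g s.
Proof.
move=> hE; rewrite /feval scaler_sumr -big_split; apply: eq_bigr => t _ /=.
by rewrite hE scalerDr !scalerA mulrC.
Qed.

Definition tmul_left (u : elt M * elt M) (t : enveloping) : enveloping :=
  plift (tmul_pure u) t.

Lemma tmul_left_bilin t : bilinear_on (tmul_left^~ t).
Proof.
split=> z a x y; apply: feval_linear => v.
- exact: (tmul_pure_bilinl v).1.
- exact: (tmul_pure_bilinl v).2.
Qed.

Definition tmul (s t : enveloping) : enveloping := plift (tmul_left^~ t) s.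

Lemma tmul_linl t : linear (tmul^~ t).
Proof. exact: plift_is_linear (tmul_left_bilin t). Qed.

Lemma tmul_linr s : linear (tmul s).
Proof.
move=> a t t'; apply: feval_linear => u.
exact: (plift_is_linear (tmul_pure_bilinr u)).
Qed.

Lemma tmul_pureE u v : tmul (pure u.1 u.2) (pure v.1 v.2) = tmul_pure u v.
Proof.
rewrite /tmul /pure -!surjective_pairing (plift_gen _ (tmul_left_bilin _)).
by rewrite /tmul_left (plift_gen _ (tmul_pure_bilinr u)).
Qed.

Lemma enveloping_ext (V : lmodType R[i]) (f g : enveloping -> V) :
  linear f -> linear g -> (forall x y, f (pure x y) = g (pure x y)) -> f =1 g.
Proof. by move=> lf lg fg; apply: (linear_pgen_eq lf lg) => -[x y]; exact: fg. Qed.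

Lemma lin_comp (U V W : lmodType R[i]) (f : V -> W) (g : U -> V) :
  linear f -> linear g -> linear (f \o g).
Proof. by move=> lf lg a x y /=; rewrite lg lf. Qed.
Lemma lin_id (U : lmodType R[i]) : linear (@id U). Proof. by []. Qed.

Lemma tmulA : associative tmul.
Proof.
move=> s t u.
apply: (@enveloping_ext _ (fun s => tmul s (tmul t u)) (fun s => tmul (tmul s t) u)).
- exact: tmul_linl.
- exact: (lin_comp (tmul_linl u) (tmul_linl t)).
move=> x y.
apply: (@enveloping_ext _ (fun t => tmul (pure x y) (tmul t u))
                      (fun t => tmul (tmul (pure x y) t) u)).
- exact: (lin_comp (tmul_linr _) (tmul_linl u)).
- exact: (lin_comp (tmul_linl u) (tmul_linr _)).
move=> x' y'.
apply: (@enveloping_ext _ (fun u => tmul (pure x y) (tmul (pure x' y') u))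
                      (tmul (tmul (pure x y) (pure x' y')))).
- exact: (lin_comp (tmul_linr _) (tmul_linr _)).
- exact: tmul_linr.
move=> x'' y''.
rewrite (tmul_pureE (x', y') (x'', y'')) (tmul_pureE (x, y) (x', y')).
rewrite /tmul_pure /= (tmul_pureE (x, y) (_, _)) (tmul_pureE (_, _) (x'', y'')).
by rewrite /tmul_pure /= !mulrA.
Qed.

Lemma tmul1 : left_id (pure 1 1) tmul.
Proof.
apply: enveloping_ext => [||x y]; [exact: tmul_linr|exact: lin_id|].
by rewrite (tmul_pureE (1, 1) (x, y)) /tmul_pure /= mul1r mulr1.
Qed.
Lemma t1mul : right_id (pure 1 1) tmul.
Proof.
apply: enveloping_ext => [||x y]; [exact: tmul_linl|exact: lin_id|].
by rewrite (tmul_pureE (x, y) (1, 1)) /tmul_pure /= mul1r mulr1.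
Qed.
Lemma tmulDl : left_distributive tmul +%R.
Proof. by move=> s t u; have := tmul_linl u 1 s t; rewrite !scale1r. Qed.
Lemma tmulDr : right_distributive tmul +%R.
Proof. by move=> s t u; have := tmul_linr s 1 t u; rewrite !scale1r. Qed.
HB.instance Definition _ := GRing.Zmodule_isPzRing.Build enveloping
  tmulA tmul1 t1mul tmulDl tmulDr.

Lemma pureM x y x' y' : pure x y * pure x' y' = pure (x * x') (y' * y).
Proof. exact: (tmul_pureE (x, y) (x', y')). Qed.

(* M as a left module over M (x) M^o: (m (x) n^o) . a = m a n. *)
Definition bimod := elt M.
HB.instance Definition _ := GRing.Zmodule.on bimod.

Definition bimod_act (u : elt M * elt M) : elt M -> elt M :=
  fun a => u.1 * a * u.2.

Lemma bimod_act_bilin : bilinear_on bimod_act.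
Proof.
split=> z a x y; apply/funext => b; rewrite /bimod_act fctE /=.
- by rewrite !mulrDl !elt_scaleAl.
- by rewrite !mulrDr !elt_scaleAr.
Qed.

Definition bimod_scale (s : enveloping) (a : bimod) : bimod :=
  plift bimod_act s a.

Lemma bimod_scale_pure x y a : bimod_scale (pure x y) a = x * a * y.
Proof. by rewrite /bimod_scale plift_gen//; exact: bimod_act_bilin. Qed.

Lemma bimod_scale_linl (a : bimod) :
  linear (fun s => bimod_scale s a : elt M).
Proof. by move=> c s t; rewrite /bimod_scale (plift_is_linear bimod_act_bilin). Qed.

Lemma bimod_scale_linr (s : enveloping) : linear (bimod_scale s : elt M -> elt M).
Proof.
move=> c a b; rewrite /bimod_scale.
apply: (@enveloping_ext _ (fun s => bimod_scale s (c *: a + b) : elt M)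
  (fun s => c *: (bimod_scale s a : elt M) + bimod_scale s b)).
- exact: bimod_scale_linl.
- move=> d t u; rewrite !bimod_scale_linl !scalerDr !scalerA [d * c]mulrC.
  by rewrite -!addrA; congr (_ + _); rewrite addrCA.
move=> x y; rewrite !bimod_scale_pure mulrDr mulrDl.
by rewrite elt_scaleAr elt_scaleAl.
Qed.

Lemma bimod_scaleA s t a :
  bimod_scale s (bimod_scale t a) = bimod_scale (s * t) a.
Proof.
apply: (@enveloping_ext _ (fun s => bimod_scale s (bimod_scale t a) : elt M)
  (fun s => bimod_scale (s * t) a)).
- exact: bimod_scale_linl.
- exact: (lin_comp (bimod_scale_linl a) (tmul_linl t)).
move=> x y.
apply: (@enveloping_ext _ (fun t => bimod_scale (pure x y) (bimod_scale t a) : elt M)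
  (fun t => bimod_scale (pure x y * t) a)).
- exact: (lin_comp (bimod_scale_linr _) (bimod_scale_linl a)).
- exact: (lin_comp (bimod_scale_linl a) (tmul_linr _)).
by move=> x' y'; rewrite pureM !bimod_scale_pure !mulrA.
Qed.
Lemma bimod_scale1 : left_id 1 bimod_scale.
Proof. by move=> a; rewrite bimod_scale_pure mul1r mulr1. Qed.
Lemma bimod_scaleDr : right_distributive bimod_scale +%R.
Proof.
by move=> s a b; have := bimod_scale_linr s 1 (a : elt M) b; rewrite !scale1r.
Qed.
Lemma bimod_scaleDl a : {morph bimod_scale^~ a : s t / s + t}.
Proof. by move=> s t; have := bimod_scale_linl a 1 s t; rewrite !scale1r. Qed.
HB.instance Definition _ := GRing.Zmodule_isLmodule.Build enveloping bimod
  bimod_scaleA bimod_scale1 bimod_scaleDr bimod_scaleDl.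

End TensorAlgebra.

Section Trace.
Variables (R : realType) (H : hilbert R) (M : vN_algebra H).
Implicit Types (x y p q : elt M) (tau : elt M -> R[i]).

Definition positive x := forall v : H, 0 <= hdot (x v) v.

Definition self_adjoint x := star x = x.

Definition upper_bound (D : set (elt M)) s :=
  forall x, D x -> positive (s - x).

Definition is_lub (D : set (elt M)) s :=
  [/\ self_adjoint s, upper_bound D s &
      forall t, self_adjoint t -> upper_bound D t -> positive (t - s)].

Definition directed (D : set (elt M)) :=
  D !=set0 /\
  forall x y, D x -> D y -> exists z, [/\ D z, positive (z - x) & positive (z - y)].

(* tau preserves suprema of bounded increasing nets of self-adjoint elements
   (the order of R[i] only compares numbers with the same imaginary part). *)
Definition normal tau :=
  forall (D : set (elt M)) s, D `<=` self_adjoint -> directed D -> is_lub D s ->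
  forall b, (forall x, D x -> tau x <= b) -> tau s <= b.

Record faithful_normal_tracial_state tau : Prop := {
  state_linear : scalar tau;
  state_ge0 : forall x, positive x -> 0 <= tau x;
  state1 : tau 1 = 1;
  state_faithful : forall x, tau (star x * x) = 0 -> x = 0;
  state_tracial : forall x y, tau (x * y) = tau (y * x);
  state_normal : normal tau }.

Definition central x := forall y, x * y = y * x.

Definition projection p := star p = p /\ p * p = p.

Definition minimal_central_projection p :=
  (* q * p = q says that q <= p *)
  [/\ projection p, central p, p <> 0 &
      forall q, projection q -> central q -> q * p = q -> q = 0 \/ q = p].

Definition diffuse_center := ~ exists p, minimal_central_projection p.

Definition generates n (X : 'I_n -> elt M) :=
  forall P : vN_algebra H,
    (forall i, vN_set P (X i)) -> vN_set M `<=` vN_set P.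

(* L^2(M, tau): the Hilbert space completion of M for <x, y> = tau(y^* x), with
   the left action of M and the Tomita conjugation J. The completion is unique
   up to a unique unitary, and [lact] and [tomita] are determined by
   their values on the dense subspace M. *)
Record standard_form tau := StandardForm {
  L2 :> hilbert R;
  hat : elt M -> L2;
  hat_linear : linear hat;
  hat_dot : forall x y, hdot (hat x) (hat y) = tau (star y * x);
  hat_dense : dense (range hat);
  lact : elt M -> operator L2;
  lactE : forall x y, lact x (hat y) = hat (x * y);
  tomita : L2 -> L2;
  tomita_antilinear : forall a u v,
    tomita (a *: u + v) = a^* *: tomita u + tomita v;
  tomita_isometric : forall u, `|tomita u| = `|u|;
  tomitaE : forall x, tomita (hat x) = hat (star x) }.

End Trace.

Section HilbertSchmidt.
Variables (R : realType) (H : hilbert R).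

Definition orthonormal_basis (E : set H) :=
  (forall e f, E e -> E f -> hdot e f = (e == f)%:R) /\
  (forall v, (forall e, E e -> hdot v e = 0) -> v = 0).

Definition hs_norm2 (E : set H) (T : operator H) : \bar R :=
  \esum_(e in E) (complex.Re (`|T e| ^+ 2))%:E.

Definition hilbert_schmidt (T : operator H) :=
  exists2 E, orthonormal_basis E & (hs_norm2 E T < +oo)%E.

Definition finite_rank (T : operator H) :=
  exists n (v : 'I_n -> H), forall x, exists c : 'I_n -> R[i],
    T x = \sum_i c i *: v i.

(* The Hilbert space of Hilbert-Schmidt operators on H. By polarization, the norm
   determines the inner product. [sandwich S T] is k |-> S k T; it exists
   because the Hilbert-Schmidt operators form a two-sided ideal, and
   [sandwichE] determines it. *)
Record hs_space := HSSpace {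
  HS :> hilbert R;
  hs_op : HS -> operator H;
  hs_op_linear : linear hs_op;
  hs_op_range : range hs_op = hilbert_schmidt;
  hs_op_norm : forall E k, orthonormal_basis E ->
    (complex.Re (`|k| ^+ 2))%:E = hs_norm2 E (hs_op k);
  sandwich : operator H -> operator H -> operator HS;
  sandwichE : forall S T k, hs_op (sandwich S T k) = S * hs_op k * T }.

End HilbertSchmidt.

Section HilbertSchmidtTheory.
Variables (R : realType) (H : hilbert R) (K : hs_space H).

Lemma hs_op_eq (k l : K) : hs_op k = hs_op l -> k = l.
Proof.
move=> kl; have h0 : hs_op (0 : K) = 0.
  have := hs_op_linear (-1) (0 : K) 0.
  by rewrite scaler0 addr0 scaleN1r addNr.
have [E oE _] : hilbert_schmidt (0 : operator H).
  by rewrite -(hs_op_range K); exists 0.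
have d0 : hs_op (k - l) = 0.
  have := hs_op_linear (-1) l k; rewrite !scaleN1r kl addNr addrC => <-.
  by [].
have := hs_op_norm (k - l) oE; rewrite d0 -h0 -hs_op_norm// normr0 expr0n /=.
move=> [] re0; apply/eqP; rewrite -subr_eq0 -normr_eq0 -sqrf_eq0.
have : `|k - l| ^+ 2 \is Num.real by rewrite rpredX// normr_real.
by move=> /RRe_real <-; rewrite re0.
Qed.

Lemma sandwich_linl T : linear (fun S => sandwich K S T).
Proof.
move=> a S S'; apply: operator_eq => k; apply: hs_op_eq.
rewrite sandwichE [in RHS]hs_op_linear !sandwichE.
by rewrite !mulrDl !op_scaleAl.
Qed.
Lemma sandwich_linr S : linear (sandwich K S).
Proof.
move=> a T T'; apply: operator_eq => k; apply: hs_op_eq.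
rewrite sandwichE [in RHS]hs_op_linear !sandwichE.
by rewrite !mulrDr !op_scaleAr.
Qed.
Lemma sandwichM S T S' T' :
  sandwich K S T * sandwich K S' T' = sandwich K (S * S') (T' * T).
Proof.
apply: operator_eq => k; apply: hs_op_eq.
by rewrite [LHS]sandwichE !sandwichE !mulrA.
Qed.
Lemma sandwich1 : sandwich K 1 1 = 1.
Proof. by apply: operator_eq => k; apply: hs_op_eq; rewrite sandwichE mul1r mulr1. Qed.
End HilbertSchmidtTheory.

Section Density.
Variables (R : realType) (H : hilbert R).

Lemma operator_dense_eq (A : set H) (T U : operator H) :
  dense A -> (forall a, A a -> T a = U a) -> T = U.
Proof.
move=> dA TU; apply: operator_eq => v; apply/eqP; rewrite -subr_eq0.
apply: contraT; rewrite -normr_gt0 => Dv.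
pose D : operator H := T - U.
have [[lD [c c0 hc]] _] := operatorP D.
have c1 : 0 < c + 1 by rewrite ltr_wpDl.
have r0 : 0 < `|T v - U v| / (c + 1) by rewrite divr_gt0.
have [||a [va Aa]] := dA (ball v (`|T v - U v| / (c + 1))).
- by exists v; exact: ballxx.
- exact: ball_open.
move: va; rewrite -ball_normE /= ltr_pdivlMr// => va.
have e : T v - U v = D (v - a).
  rewrite [v - a]addrC -[- a]scaleN1r (operator_linear D) scaleN1r.
  have -> : D a = 0 by rewrite -[LHS]/(T a - U a) TU// subrr.
  by rewrite oppr0 add0r.
have := hc (v - a); rewrite -e => /(lt_le_trans va).
by rewrite mulrC mulrDl mul1r gtrDl normr_lt0.
Qed.
End Density.

Section StandardFormTheory.
Variables (R : realType) (H : hilbert R) (M : vN_algebra H).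
Variables (tau : elt M -> R[i]) (S : standard_form tau).

Lemma lact_eq (T U : operator S) :
  (forall x, T (hat S x) = U (hat S x)) -> T = U.
Proof.
by move=> h; apply: (operator_dense_eq (@hat_dense _ _ _ _ S)) => _ [x _ <-].
Qed.

Lemma lact_linear : linear (lact S).
Proof.
move=> a x y; apply: lact_eq => z; rewrite lactE mulrDl elt_scaleAl hat_linear.
by rewrite -!lactE.
Qed.
Lemma lactM x y : lact S (x * y) = lact S x * lact S y.
Proof. by apply: lact_eq => z; rewrite lactE -mulrA -!lactE. Qed.
Lemma lact1 : lact S 1 = 1.
Proof. by apply: lact_eq => z; rewrite lactE mul1r. Qed.
End StandardFormTheory.

Section BettiNumbers.
Variables (R : realType) (H : hilbert R) (M : vN_algebra H).
Variables (tau : elt M -> R[i]) (S : standard_form tau) (K : hs_space S).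

(* The left action T |-> x T y of x (x) y^o on the Hilbert-Schmidt operators. *)
Definition left_right (x y : elt M) : operator K :=
  sandwich K (lact S x) (lact S y).

(* The von Neumann tensor product of M and M^o, acting on
   L^2(M) (x) L^2(M^o), which is identified with the Hilbert-Schmidt operators
   by x (x) y^o |-> x P_1 y. *)
Definition vN_enveloping : vN_algebra K :=
  vN_gen [set Z | exists x y, Z = left_right x y].

Lemma left_right_in x y : vN_set vN_enveloping (left_right x y).
Proof. by apply: sub_vN_gen; exists x, y. Qed.

Definition left_right_elt (u : elt M * elt M) : elt vN_enveloping :=
  Elt (left_right_in u.1 u.2).

Lemma left_right_bilin : bilinear_on left_right_elt.
Proof.
split=> z a x y; apply: val_inj => /=; rewrite /left_right lact_linear.
- exact: sandwich_linl.
- exact: sandwich_linr.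
Qed.

Definition enveloping_incl_fun : enveloping M -> elt vN_enveloping := plift left_right_elt.

Lemma enveloping_incl_pure x y :
  enveloping_incl_fun (pure x y) = left_right_elt (x, y).
Proof. by rewrite /enveloping_incl_fun plift_gen//; exact: left_right_bilin. Qed.

Lemma enveloping_incl_linear : linear enveloping_incl_fun.
Proof. exact: plift_is_linear left_right_bilin. Qed.

Lemma enveloping_incl_zmod : zmod_morphism enveloping_incl_fun.
Proof.
move=> s t; have := enveloping_incl_linear (-1) t s.
by rewrite !scaleN1r [X in enveloping_incl_fun X]addrC => ->; rewrite addrC.
Qed.

Lemma enveloping_incl_monoid : monoid_morphism enveloping_incl_fun.
Proof.
split.
  rewrite -[1]/(pure 1 1) enveloping_incl_pure; apply: val_inj => /=.
  by rewrite /left_right lact1 sandwich1.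
move=> s t.
have linM1 (r : elt vN_enveloping) : linear (fun z : elt vN_enveloping => z * r).
  by move=> a x y; rewrite mulrDl elt_scaleAl.
have linM2 (r : elt vN_enveloping) : linear (fun z : elt vN_enveloping => r * z).
  by move=> a x y; rewrite mulrDr elt_scaleAr.
apply: (@enveloping_ext _ _ _ _ (fun s => enveloping_incl_fun (s * t))
  (fun s => enveloping_incl_fun s * enveloping_incl_fun t)).
- exact: (lin_comp enveloping_incl_linear (tmul_linl t)).
- exact: (lin_comp (linM1 _) enveloping_incl_linear).
move=> x y.
apply: (@enveloping_ext _ _ _ _ (fun t => enveloping_incl_fun (pure x y * t))
  (fun t => enveloping_incl_fun (pure x y) * enveloping_incl_fun t)).
- exact: (lin_comp enveloping_incl_linear (tmul_linr _)).
- exact: (lin_comp (linM2 _) enveloping_incl_linear).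
move=> x' y'; rewrite pureM !enveloping_incl_pure; apply: val_inj => /=.
by rewrite /left_right !lactM -sandwichM.
Qed.

Definition enveloping_incl : {rmorphism enveloping M -> elt vN_enveloping} :=
  HB.pack enveloping_incl_fun
    (GRing.isZmodMorphism.Build _ _ enveloping_incl_fun enveloping_incl_zmod)
    (GRing.isMonoidMorphism.Build _ _ enveloping_incl_fun enveloping_incl_monoid).

(* P_1, the trace vector of [vN_enveloping] *)
Definition rank_one_hat : K :=
  xget 0 [set k : K | forall v, hs_op k v = hdot v (hat S 1) *: hat S 1].

Definition enveloping_trace (z : elt vN_enveloping) : R[i] :=
  hdot (z rank_one_hat) rank_one_hat.

Definition mx_projection n (p : 'M[elt vN_enveloping]_n) :=
  p *m p = p /\ p = map_mx (@star _ _ _) p^T.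

(* W is a submodule of V isomorphic to N^n p for a projection p of M_n(N), and
   d = (Tr (x) trace)(p) is its Murray-von Neumann dimension. Every finitely
   generated projective left N-module is isomorphic to such an N^n p. *)
Definition fg_projective_dim (V : lmodType (elt vN_enveloping)) (W : set V) (d : R) :=
  exists n (p : 'M[elt vN_enveloping]_n) (f : {linear 'rV[elt vN_enveloping]_n -> V}),
    let Np := [set v : 'rV[elt vN_enveloping]_n | v *m p = v] in
    [/\ mx_projection p, {in Np &, injective f}, W = f @` Np &
        d = complex.Re (\sum_i enveloping_trace (p i i))].

Definition lueck_dim (V : lmodType (elt vN_enveloping)) : \bar R :=
  ereal_sup [set e | exists W d, @fg_projective_dim V W d /\ e = d%:E].

Definition betti (k : nat) : \bar R :=
  lueck_dim (Tor enveloping_incl (bimod M : lmodType (enveloping M)) k).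

End BettiNumbers.

Section Delta.
Variables (R : realType) (H : hilbert R) (M : vN_algebra H).
Variables (tau : elt M -> R[i]) (S : standard_form tau) (K : hs_space S).

Definition hs_dot n (T U : 'I_n -> K) : R[i] := \sum_i hdot (T i) (U i).

(* the orthogonal projection onto a closed subspace E of HS^n *)
Definition hs_proj n (E : set ('I_n -> K)) (T : 'I_n -> K) : 'I_n -> K :=
  xget (fun=> 0) [set U | E U /\ forall V, E V -> hs_dot (T - U) V = 0].

Definition hs_unit n (i : 'I_n) : 'I_n -> K :=
  fun j => if j == i then rank_one_hat K else 0.

(* The Murray-von Neumann dimension (Tr (x) trace)(P) of a closed submodule E of
   HS^n, P being the orthogonal projection onto E: the sum of the <P e_i, e_i>,
   where e_i is P_1 in the i-th coordinate. *)
Definition hs_dim n (E : set ('I_n -> K)) : R :=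
  complex.Re (\sum_i hs_dot (hs_proj E (hs_unit i)) (hs_unit i)).

(* T^sigma = J T^* J, and [k, x^sigma] *)
Definition sigma (T : operator S) : S -> S :=
  fun v => tomita (adjoint T (tomita v)).

Definition comm_sigma (k : K) (x : elt M) : S -> S :=
  fun v => hs_op k (sigma (lact S x) v) - sigma (lact S x) (hs_op k v).

Definition cocycles n m (X : 'I_n -> elt M) (Y : 'I_m -> elt M) :
    set (('I_n -> K) * ('I_m -> K)) :=
  [set TU | [/\ forall j, finite_rank (hs_op (TU.1 j)),
                forall j, finite_rank (hs_op (TU.2 j)) &
                forall v, \sum_j comm_sigma (TU.1 j) (X j) v +
                          \sum_j comm_sigma (TU.2 j) (Y j) v = 0]].

Definition hs_closure n m (E : set (('I_n -> K) * ('I_m -> K))) :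
    set (('I_n -> K) * ('I_m -> K)) :=
  [set TU | forall eps : R[i], 0 < eps -> exists2 TU', E TU' &
     (forall j, `|TU.1 j - TU'.1 j| < eps) /\
     (forall j, `|TU.2 j - TU'.2 j| < eps)].

(* The set is that of the T with (T, 0) in the closure, i.e. its intersection
   with HS^n (+) 0, seen in HS^n. *)
Definition Delta_rel n m (X : 'I_n -> elt M) (Y : 'I_m -> elt M) : R :=
  n%:R - hs_dim [set T | hs_closure (cocycles X Y) (T, fun=> 0)].

Definition star_closed_family (F : set (elt M)) := forall x, F x -> F (star x).

(* F = range X and F' = range X `|` range Y, listed without repetition *)
Definition Delta : \bar R :=
  ereal_sup [set d | exists n (X : 'I_n -> elt M),
    [/\ injective X, star_closed_family (range X), generates X &
        d = ereal_inf [set e | exists m (Y : 'I_m -> elt M),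
          [/\ injective Y, (forall i j, X i <> Y j),
              star_closed_family (range X `|` range Y) &
              e = (Delta_rel X Y)%:E]]]].

End Delta.

(* Main.v *)
(* Central elements do everything. As the center is diffuse, 1 is a finite sum of
   central projections q_k of small trace, and the projection
   E = sum_k q_k (x) q_k^o of the von Neumann tensor product satisfies
   |E P_1|^2 = sum_k tau(q_k)^2, which is small.

   Betti number: q (x) 1 - 1 (x) q^o is central in M (x) M^o and kills M, so it kills
   Tor_1. If N^n p embeds in Tor_1, each p_ii P_1 is thus a Hilbert-Schmidt
   operator commuting with all central projections; it is fixed by E, whence
   <p_ii P_1, P_1> = <p_ii P_1, E P_1> is arbitrarily small.

   Delta: let d : HS^n -> HS, T |-> sum_j [T_j, X_j^sigma]. Comparing the traces of
   (1 - d^* d / C)^m and (1 - d d^* / C)^m as m grows gives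
   dim ker d = n - 1 + dim ker d^*. If the q_k are among the X_j, then ker d^* lies
   in the range of E, so dim ker d is almost n - 1, and the module defining
   Delta(F : F') is contained in ker d. Conversely, if F' adds multiples of the q_k
   to F, this module contains (1 - E) ker d: for T in ker d and finite-rank A close
   to T, the tuple A - E A is completed to a cocycle by multiples of (d A) q_k,
   which tend to 0. *)
Require Import Defs.
From mathcomp Require Import all_boot all_order all_algebra.
From mathcomp Require Import all_classical all_reals all_analysis.
From mathcomp Require Import complex ring lra.

Set Implicit Arguments.
Unset Strict Implicit.
Unset Printing Implicit Defensive.

Import Order.TTheory GRing.Theory Num.Theory.
Import numFieldNormedType.Exports.
Local Open Scope ring_scope.
Local Open Scope classical_set_scope.
Local Open Scope complex_scope.

(** The obstacle is rank-nullity for [d], a statement about traces of spectral projections. It is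
    reduced to algebra: the damped powers are polynomials in the commutator maps, which come from M
    (x) M^o acting on HS on the other side, and on this algebra the trace property can be checked on
    pure tensors. The constant C bounds the squared norm of [d], so both damped operators lie
    between 0 and 1, and iterating them replaces a functional calculus. The number n - 1 is the
    difference of the two traces at m = 0: n unit vectors in HS^n against one in HS. For a central q
    the operator q^sigma is the left action of q, so [T, q^sigma] = 0 says that T commutes with q;
    this is how the same E governs the Betti number and Delta. As E belongs to the left action and d
    to the right one, they commute, so that cutting by 1 - E preserves ker d; it also preserves
    finite rank. Diffuseness yields small projections only by repeated halving. Adding them up to 1
    needs a supremum of projections, and this is where normality of the trace enters. *)

(** * Projections and contractions in a real inner product space *)

(* A Hilbert space through the real part of its inner product; for complex
   subspaces real orthogonality is orthogonality. *)
Record inner_space (R : realType) := InnerSpace {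
  icar :> lmodType R[i];
  rdot : icar -> icar -> R;
  rdotDl : forall x y z, rdot (x + y) z = rdot x z + rdot y z;
  rdotZl : forall (a : R) x y, rdot (a%:C *: x) y = a * rdot x y;
  rdotC : forall x y, rdot x y = rdot y x;
  rdot_ge0 : forall x, 0 <= rdot x x;
  rdot_eq0 : forall x, rdot x x = 0 -> x = 0;
  rdot_complete : forall u : nat -> icar,
    (forall eps : R, 0 < eps -> exists N, forall m n, (N <= m)%N -> (N <= n)%N ->
       rdot (u m - u n) (u m - u n) < eps) ->
    exists l, forall eps : R, 0 < eps -> exists N, forall n, (N <= n)%N ->
       rdot (u n - l) (u n - l) < eps }.

Section InnerSpace.
Variables (R : realType) (V : inner_space R).
Implicit Types (x y z v w : V) (a : R) (E : set V) (c : V -> V).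

Lemma rdotDr x y z : rdot x (y + z) = rdot x y + rdot x z.
Proof. by rewrite rdotC rdotDl !(rdotC _ x). Qed.
Lemma rdotZr a x y : rdot x (a%:C *: y) = a * rdot x y.
Proof. by rewrite rdotC rdotZl (rdotC _ x). Qed.
Lemma rdotNl x y : rdot (- x) y = - rdot x y.
Proof.
have -> : - x = (-1 : R)%:C *: x by rewrite rmorphN1 scaleN1r.
by rewrite rdotZl mulN1r.
Qed.
Lemma rdotNr x y : rdot x (- y) = - rdot x y.
Proof. by rewrite rdotC rdotNl (rdotC _ x). Qed.
Lemma rdot0l x : rdot 0 x = 0.
Proof. by apply: (addrI (rdot 0 x)); rewrite -rdotDl !addr0. Qed.
Lemma rdot0r x : rdot x 0 = 0.
Proof. by rewrite rdotC rdot0l. Qed.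
Definition rdotE := (rdotDl, rdotDr, rdotNl, rdotNr, rdotZl, rdotZr).

Definition nsq x : R := rdot x x.
Definition nrm x : R := Num.sqrt (nsq x).

Lemma nrm_ge0 x : 0 <= nrm x. Proof. exact: sqrtr_ge0. Qed.
Lemma nrm_sq x : nrm x ^+ 2 = nsq x. Proof. by rewrite sqr_sqrtr// rdot_ge0. Qed.
Lemma nsqN x : nsq (- x) = nsq x. Proof. by rewrite /nsq !rdotE opprK. Qed.
Lemma nrmN x : nrm (- x) = nrm x. Proof. by rewrite /nrm nsqN. Qed.
Lemma nrm_lt x a : 0 < a -> nsq x < a ^+ 2 -> nrm x < a.
Proof. by move=> a0; rewrite -nrm_sq ltr_pXn2r// ?nnegrE ?nrm_ge0// ltW. Qed.
Lemma nrm_le x a : 0 <= a -> nsq x <= a ^+ 2 -> nrm x <= a.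
Proof. by move=> a0; rewrite -nrm_sq ler_pXn2r// ?nnegrE ?nrm_ge0. Qed.

Lemma rdot_CS x y : rdot x y ^+ 2 <= nsq x * nsq y.
Proof.
have := rdot_ge0 ((nsq y)%:C *: x - (rdot x y)%:C *: y).
have y0 := rdot_ge0 y.
rewrite !rdotE (rdotC y x) -/(nsq x) -/(nsq y) => h.
case: (eqVneq (nsq y) 0) => [yz|yz].
  by rewrite (rdot_eq0 yz) rdot0r expr0n /= /nsq rdot0r mulr0.
have yp : 0 < nsq y by rewrite lt_neqAle eq_sym yz.
rewrite -subr_ge0 -(pmulr_rge0 _ yp); lra.
Qed.

Lemma rdot_le x y : `|rdot x y| <= nrm x * nrm y.
Proof.
rewrite -[leLHS]ger0_norm// -ler_sqr ?nnegrE ?normr_ge0 ?mulr_ge0 ?nrm_ge0//.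
by rewrite normr_id real_normK ?num_real// exprMn !nrm_sq rdot_CS.
Qed.

Lemma nrmD x y : nrm (x + y) <= nrm x + nrm y.
Proof.
apply: nrm_le; first by rewrite addr_ge0 ?nrm_ge0.
rewrite sqrrD !nrm_sq /nsq !rdotE (rdotC y x).
have := rdot_le x y; rewrite ler_norml => /andP[_]; lra.
Qed.

Lemma nrmB x y z : nrm (x - z) <= nrm (x - y) + nrm (y - z).
Proof. by have := nrmD (x - y) (y - z); rewrite addrA subrK. Qed.

Definition tends (u : nat -> V) (l : V) :=
  forall eps : R, 0 < eps -> exists N, forall n, (N <= n)%N -> nrm (u n - l) < eps.

Lemma nrm_complete (u : nat -> V) :
  (forall eps : R, 0 < eps -> exists N, forall m n, (N <= m)%N -> (N <= n)%N ->
       nsq (u m - u n) < eps) -> exists l, tends u l.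
Proof.
move=> /rdot_complete[l h]; exists l => eps e0.
have [|N hN] := h (eps ^+ 2); first by rewrite exprn_gt0.
by exists N => n /hN; exact: nrm_lt.
Qed.

Lemma tends_rdot u l w : tends u l ->
  forall eps : R, 0 < eps -> exists N, forall n, (N <= n)%N ->
    `|rdot (u n) w - rdot l w| < eps.
Proof.
move=> ul eps e0; have n1 : 0 < nrm w + 1 by rewrite ltr_wpDl ?nrm_ge0.
have [|N hN] := ul (eps / (nrm w + 1)); first by rewrite divr_gt0.
exists N => n /hN; rewrite ltr_pdivlMr// => h.
have := rdot_le (u n - l) w; rewrite rdotDl rdotNl => /le_lt_trans; apply.
apply: le_lt_trans h; rewrite ler_wpM2l ?nrm_ge0//; lra.
Qed.

Lemma lim_eq (s : nat -> R) (a b : R) :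
  (forall eps : R, 0 < eps -> exists N, forall n, (N <= n)%N -> `|s n - a| < eps) ->
  (forall n, s n = b) -> a = b.
Proof.
move=> h sb; apply/eqP; rewrite -subr_eq0 -normr_le0; apply/ler_addgt0Pr => e e0.
have [N hN] := h _ e0; have := hN N (leqnn _); rewrite sb add0r distrC.
exact: ltW.
Qed.

Definition real_subspace E :=
  E 0 /\ forall a x y, E x -> E y -> E (a%:C *: x + y).
Definition nrm_closed E :=
  forall l, (forall eps : R, 0 < eps -> exists2 x, E x & nrm (x - l) < eps) -> E l.

Lemma quad_ge0_eq0 (a s : R) : 0 <= s ->
  (forall t : R, 0 <= - 2 * t * a + t ^+ 2 * s) -> a = 0.
Proof.
(* The quadratic is minimal at [a / s]; the denominator [s + 1] also covers [s = 0]. *)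
move=> s0 h; have := h (a / (s + 1)); have s1 : 0 < s + 1 by lra.
have -> : - 2 * (a / (s + 1)) * a + (a / (s + 1)) ^+ 2 * s
   = - (a ^+ 2 * (s + 2) / (s + 1) ^+ 2) by field; rewrite gt_eqF.
rewrite oppr_ge0 pmulr_lle0 ?invr_gt0 ?exprn_gt0//.
rewrite pmulr_lle0; last by lra.
by move=> a2; apply/eqP; rewrite -sqrf_eq0 eq_le a2 sqr_ge0.
Qed.

Lemma min_orthogonal E v u : real_subspace E -> E u ->
  (forall w, E w -> nsq (v - u) <= nsq (v - w)) ->
  forall w, E w -> rdot (v - u) w = 0.
Proof.
move=> [E0 EL] Eu umin w Ew; apply: (@quad_ge0_eq0 _ (nsq w)); first exact: rdot_ge0.
move=> t; have := umin (t%:C *: w + u) (EL _ _ _ Ew Eu).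
have -> : v - (t%:C *: w + u) = (v - u) - t%:C *: w by rewrite opprD addrA addrAC.
rewrite {2}/nsq [X in _ <= X]rdotDl !(rdotDr _ (v - u)) !rdotNl !rdotNr !rdotZl !rdotZr.
rewrite (rdotC w (v - u)) -/(nsq (v - u)) -/(nsq w).
lra.
Qed.

Lemma projection_exists E v : real_subspace E -> nrm_closed E ->
  exists2 u, E u & forall w, E w -> rdot (v - u) w = 0.
Proof.
move=> sE cE; have [E0 EL] := sE.
pose D := [set d | exists2 w, E w & d = nsq (v - w)].
have lD : has_inf D.
  split; first by exists (nsq (v - 0)), 0.
  by exists 0 => _ [w _ ->]; exact: rdot_ge0.
have dle w : E w -> inf D <= nsq (v - w).
  by move=> Ew; apply: ge_inf; [exact: lD.2|exists w].
have /choice[u hu] (n : nat) : exists w, E w /\ nsq (v - w) < inf D + n.+1%:R^-1.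
  have [|_ [w Ew ->] h] := @inf_adherent _ _ (n.+1%:R^-1 : R) _ lD.
    by rewrite invr_gt0 ltr0n.
  by exists w.
(* Parallelogram law: the midpoint of [u m] and [u n] lies in [E], so its squared distance to [v] is
   at least [inf D]. *)
have par m n : nsq (u m - u n) <= 2 * (m.+1%:R^-1 + n.+1%:R^-1).
  have [Em hm] := hu m; have [En hn] := hu n.
  have Emn : E ((2^-1 : R)%:C *: u m + (2^-1 : R)%:C *: u n).
    by apply: (EL) => //; rewrite -[_ *: _]addr0; apply: EL.
  have := dle _ Emn; move: hm hn.
  rewrite /nsq !rdotE (rdotC (u m) v) (rdotC (u n) v) (rdotC (u n) (u m)).
  by move: (m.+1%:R^-1 : R) (n.+1%:R^-1 : R) => a b; lra.
have [l ul] : exists l, tends u l.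
  apply: nrm_complete => eps e0.
  have [N hN] : exists N, forall n, (N <= n)%N -> 4 * n.+1%:R^-1 < eps.
    exists (Num.bound (4 / eps)) => n hn.
    rewrite ltr_pdivrMr ?ltr0n// mulrC -ltr_pdivrMr//.
    apply: lt_le_trans (_ : (Num.bound (4 / eps))%:R <= _).
      by apply: archi_boundP; rewrite divr_ge0// ltW.
    by rewrite ler_nat (leq_trans hn).
  exists N => m n /hN hm /hN hn; apply: le_lt_trans (par m n) _.
  by move: (m.+1%:R^-1 : R) (n.+1%:R^-1 : R) hm hn => a b; lra.
have El : E l.
  by apply: cE => eps /ul[N hN]; exists (u N); [exact: (hu N).1|exact: hN].
exists l => //; apply: min_orthogonal => // w Ew.
apply: le_trans (dle _ Ew).
have vl : nrm (v - l) <= Num.sqrt (inf D).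
  apply/ler_addgt0Pr => e e0.
  have e2 : 0 < e / 2 by lra.
  have [N hN] := ul _ e2.
  pose r := Num.sqrt (inf D) + e / 2.
  have d0 : 0 <= inf D by apply: lb_le_inf; [exact: lD.1|move=> _ [z _ ->]; exact: rdot_ge0].
  have r0 : 0 < r by rewrite ltr_wpDl ?sqrtr_ge0.
  have rd : inf D < r ^+ 2.
    rewrite /r sqrrD sqr_sqrtr//.
    have : 0 <= Num.sqrt (inf D) * (e / 2) by rewrite mulr_ge0 ?sqrtr_ge0// ltW.
    have : 0 < (e / 2) ^+ 2 by rewrite exprn_gt0.
    by lra.
  pose n := maxn N (Num.bound (r ^+ 2 - inf D)^-1).
  have hn : nrm (v - u n) < r.
    apply: nrm_lt => //; apply: lt_trans (hu n).2 _.
    have rp : 0 < r ^+ 2 - inf D by rewrite subr_gt0.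
    rewrite -ltrBrDl invf_plt ?posrE ?ltr0n//.
    apply: lt_le_trans (_ : (Num.bound (r ^+ 2 - inf D)^-1)%:R <= _).
      by apply: archi_boundP; rewrite invr_ge0 ltW.
    by rewrite ler_nat (leq_trans _ (leqnSn _))// leq_maxr.
  have := nrmB v (u n) l; have := hN n (leq_maxl _ _).
  rewrite /r in hn; lra.
rewrite -nrm_sq -[leRHS]sqr_sqrtr; last first.
  by apply: lb_le_inf; [exact: lD.1|move=> _ [z _ ->]; exact: rdot_ge0].
by rewrite ler_pXn2r// nnegrE ?nrm_ge0 ?sqrtr_ge0.
Qed.

(** Diagonal entries of a projection are squared norms, so the dimensions below can be compared by
    Cauchy-Schwarz. *)
Lemma projection_nsq E v u : E u -> (forall w, E w -> rdot (v - u) w = 0) ->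
  rdot u v = nsq u.
Proof. by move=> Eu h; apply/eqP; rewrite -subr_eq0 -{1}(rdotC v) /nsq -rdotNl -rdotDl h. Qed.

(* The numbers [|c^j v|^2] decrease, and they control [|c^2m v - c^2k v|^2]; only
   even powers converge, as -1 may be an eigenvalue of [c]. *)
Lemma iter_contraction c v :
  (forall x y, c (x - y) = c x - c y) ->
  (forall x y, rdot (c x) y = rdot x (c y)) ->
  (forall x, nsq (c x) <= nsq x) ->
  exists l, [/\ tends (fun m => iter m.*2 c v) l, nsq (c l) = nsq l &
                forall w, c w = w -> rdot (v - l) w = 0].
Proof.
move=> cB cS cC.
pose s j := nsq (iter j c v).
have sj j k : rdot (iter j c v) (iter k c v) = rdot (iter (j + k) c v) v.
  elim: k j => [|k IH] j; first by rewrite addn0.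
  by rewrite iterS -cS -iterS IH addSnnS.
have cauchy m k : nsq (iter m.*2 c v - iter k.*2 c v) = s m.*2 + s k.*2 - 2 * s (m + k)%N.
  have e : (m.*2 + k.*2 = m + k + (m + k))%N by rewrite addnn doubleD.
  by rewrite /s /nsq !rdotE !sj (addnC k.*2) e; lra.
have sdec j k : (j <= k)%N -> s k <= s j.
  move=> /subnKC <-; elim: (k - j)%N => [|d IH]; first by rewrite addn0.
  by rewrite addnS /s iterS (le_trans (cC _)).
have sinf : has_inf (range s).
  by split; [exists (s 0%N), 0%N|exists 0 => _ [j _ <-]; exact: rdot_ge0].
have slow j : inf (range s) <= s j by apply: ge_inf; [exact: sinf.2|exists j].
have [l hl] : exists l, tends (fun m => iter m.*2 c v) l.
  apply: nrm_complete => eps e0.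
  have [|_ [N _ <-] hN] := @inf_adherent _ _ (eps / 2) _ sinf; first by lra.
  exists N => m k hm hk; rewrite cauchy.
  have h1 := sdec N m.*2 (leq_trans hm (leq_trans (leq_addr _ _) (eq_leq (addnn m)))).
  have h2 := sdec N k.*2 (leq_trans hk (leq_trans (leq_addr _ _) (eq_leq (addnn k)))).
  have := slow (m + k)%N; lra.
have cn x : nrm (c x) <= nrm x by rewrite ler_wsqrtr.
(* Consecutive even iterates differ by two applications of [c], so the limit is seen to be fixed by
   the square of [c] only. *)
have fix2 : c (c l) = l.
  apply/eqP; rewrite -subr_eq0; apply/eqP/rdot_eq0/eqP.
  rewrite -/(nsq _) -nrm_sq sqrf_eq0 eq_le nrm_ge0 andbT.
  apply/ler_addgt0Pr => e e0; rewrite add0r.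
  have [|N hN] := hl (e / 2); first by lra.
  have h1 := hN N.+1 (leqnSn _); have h2 := hN N (leqnn _).
  apply: le_trans (nrmB _ (iter N.+1.*2 c v) _) _.
  have := le_trans (cn _) (cn (iter N.*2 c v - l)).
  rewrite !cB -nrmN opprB => h3.
  have h4 : nrm (c (c l) - iter N.+1.*2 c v) <= nrm (iter N.*2 c v - l).
    by rewrite -nrmN opprB doubleS !iterS -nrmN opprB.
  by lra.
exists l; split=> //.
- by apply/eqP; rewrite eq_le cC -{1}fix2 cC.
- move=> w cw; rewrite rdotDl rdotNl.
  rewrite -(lim_eq (tends_rdot w hl) (b := rdot v w)) ?subrr// => n.
  have -> : forall j, rdot (iter j c v) w = rdot v w; last by [].
  by elim=> // j IH; rewrite iterS cS cw.
Qed.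

End InnerSpace.

Section AdjointPair.
Variables (R : realType) (V W : inner_space R) (B : V -> W) (D : W -> V) (C : R).
Hypotheses (BB : forall x y, B (x - y) = B x - B y)
  (BZ : forall (a : R) x, B (a%:C *: x) = a%:C *: B x)
  (DB : forall x y, D (x - y) = D x - D y)
  (DZ : forall (a : R) x, D (a%:C *: x) = a%:C *: D x)
  (BD : forall x w, rdot (B x) w = rdot x (D w))
  (C0 : 0 < C) (DC : forall w, nsq (D w) <= C * nsq w).

(** By Cauchy-Schwarz, |B x|^4 = <x, D B x>^2 <= |x|^2 |D B x|^2 <= C |x|^2 |B x|^2; divide by |B
    x|^2. *)
Lemma adjoint_bound x : nsq (B x) <= C * nsq x.
Proof.
have [->|b0] := eqVneq (nsq (B x)) 0; first by rewrite mulr_ge0 ?rdot_ge0// ltW.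
have bp : 0 < nsq (B x) by rewrite lt_neqAle eq_sym b0 rdot_ge0.
rewrite -(ler_pM2r bp) -expr2 {1}/nsq BD; apply: le_trans (rdot_CS _ _) _.
by have := ler_wpM2l (rdot_ge0 x) (DC (B x)); rewrite /nsq; lra.
Qed.

(** With [D] the adjoint of [B], this is [1 - B^* B / C], an operator between 0 and 1 by the choice
    of [C]. *)
Definition damp x := x - (C^-1)%:C *: D (B x).

Lemma dampB x y : damp (x - y) = damp x - damp y.
Proof.
by rewrite /damp BB DB scalerBr opprB [in RHS]opprB addrACA [- y + _]addrC -!addrA;
  congr (_ + _); rewrite addrCA.
Qed.

Lemma damp_sym x y : rdot (damp x) y = rdot x (damp y).
Proof. by rewrite /damp !rdotE (rdotC (D _)) -BD (rdotC (B y)) BD. Qed.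

Lemma damp_nsq x : nsq (damp x) <= nsq x - C^-1 * nsq (B x).
Proof.
have h : C^-1 * nsq (D (B x)) <= nsq (B x) by rewrite ler_pdivrMl.
have c0 : 0 <= C^-1 by rewrite invr_ge0 ltW.
have := ler_wpM2l c0 h.
by rewrite /damp /nsq !rdotE (rdotC (D _) x) -!BD; lra.
Qed.

(** One more application of [damp] keeps the norm of the limit [l], while by [damp_nsq] it loses at
    least [C^-1 * nsq (B l)]; hence [B l = 0]. Orthogonality holds because [damp] fixes the kernel
    of [B]. *)
Lemma damp_limit v : exists l, [/\ tends (fun m => iter m.*2 damp v) l, B l = 0 &
  forall w, B w = 0 -> rdot (v - l) w = 0].
Proof.
have [|l [hl nl ol]] := iter_contraction v dampB damp_sym.
  move=> x; apply: le_trans (damp_nsq x) _.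
  by rewrite gerBl mulr_ge0 ?rdot_ge0// invr_ge0 ltW.
have B0 : B l = 0.
  apply/rdot_eq0/le_anti; rewrite rdot_ge0 andbT.
  have c0 : 0 < C^-1 by rewrite invr_gt0.
  rewrite -(pmulr_rle0 _ c0); have := damp_nsq l; rewrite nl /nsq; lra.
exists l; split=> // w Bw; apply: ol.
have D0 : D 0 = 0 by have := DB 0 0; rewrite !subrr.
by rewrite /damp Bw D0 scaler0 subr0.
Qed.

End AdjointPair.

(** * Real parts, and a complex Hilbert space as a real one *)

Section ComplexReal.
Variable R : realType.
Implicit Types (a b : R[i]) (r : R).
Lemma ReD a b : complex.Re (a + b) = complex.Re a + complex.Re b.
Proof. by case: a b => [? ?] [? ?]. Qed.
Lemma ReN a : complex.Re (- a) = - complex.Re a.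
Proof. by case: a. Qed.
Lemma ReZ r a : complex.Re (r%:C * a) = r * complex.Re a.
Proof. by case: a => x y /=; rewrite mul0r subr0. Qed.
Lemma ReJ a : complex.Re (a^*)%R = complex.Re a.
Proof. by case: a. Qed.
Lemma Re_sum (I : Type) (s : seq I) (P : pred I) (F : I -> R[i]) :
  complex.Re (\sum_(i <- s | P i) F i) = \sum_(i <- s | P i) complex.Re (F i).
Proof. by apply: big_morph => // x y; exact: ReD. Qed.
Lemma ge0_Re a : 0 <= a -> a = (complex.Re a)%:C.
Proof. by case: a => x y; rewrite lecE /= => /andP[/eqP -> _]. Qed.
Lemma Re_ge0 a : 0 <= a -> 0 <= complex.Re a.
Proof. by rewrite lecE => /andP[]. Qed.
Lemma gt0_Re a : 0 < a -> 0 < complex.Re a.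
Proof. by rewrite ltcE => /andP[]. Qed.
End ComplexReal.

Section HilbertInner.
Variables (R : realType) (H : hilbert R).
Implicit Types x y z : H.

Definition hrdot x y : R := complex.Re (hdot x y).

Lemma hdot_ge0 x : 0 <= hdot x x.
Proof. by rewrite hdot_norm exprn_ge0. Qed.
Lemma hdot_diag x : hdot x x = (hrdot x x)%:C.
Proof. by rewrite -ge0_Re// hdot_ge0. Qed.
Lemma norm_hrdot x : `|x| = (Num.sqrt (hrdot x x))%:C.
Proof.
apply/eqP; rewrite -(@eqrXn2 _ 2)// -?hdot_norm ?hdot_diag; last first.
  by rewrite ler0c sqrtr_ge0.
by rewrite -rmorphXn /= sqr_sqrtr// /hrdot Re_ge0// hdot_ge0.
Qed.

Lemma hrdotDl x y z : hrdot (x + y) z = hrdot x z + hrdot y z.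
Proof. by rewrite /hrdot hdotDl ReD. Qed.
Lemma hrdotZl (a : R) x y : hrdot (a%:C *: x) y = a * hrdot x y.
Proof. by rewrite /hrdot hdotZl ReZ. Qed.
Lemma hrdotC x y : hrdot x y = hrdot y x.
Proof. by rewrite /hrdot hdot_conj ReJ. Qed.
Lemma hrdot_ge0 x : 0 <= hrdot x x.
Proof. by rewrite Re_ge0// hdot_ge0. Qed.
Lemma hrdot_eq0 x : hrdot x x = 0 -> x = 0.
Proof. by move=> h; apply/eqP; rewrite -normr_eq0 norm_hrdot h sqrtr0. Qed.

Lemma norm_lt x (e : R) : 0 < e -> (`|x| < e%:C) = (hrdot x x < e ^+ 2).
Proof.
move=> e0; rewrite norm_hrdot ltcR -ltr_sqr ?nnegrE ?sqrtr_ge0 ?(ltW e0)//.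
by rewrite sqr_sqrtr ?hrdot_ge0.
Qed.

Lemma hrdot_complete (u : nat -> H) :
  (forall eps : R, 0 < eps -> exists N, forall m n, (N <= m)%N -> (N <= n)%N ->
     hrdot (u m - u n) (u m - u n) < eps) ->
  exists l, forall eps : R, 0 < eps -> exists N, forall n, (N <= n)%N ->
     hrdot (u n - l) (u n - l) < eps.
Proof.
move=> hu.
have /cauchy_cvgP cu : cauchy (u @ \oo).
  apply/cauchy_exP => e e0; rewrite (ge0_Re (ltW e0)).
  have e0' := gt0_Re e0.
  have [|N hN] := hu (complex.Re e ^+ 2); first by rewrite exprn_gt0.
  exists (u N); exists N => // n /= hn.
  by rewrite -ball_normE /= norm_lt// hN.
exists (lim (u @ \oo)) => eps e0.
have se : 0 < Num.sqrt eps by rewrite sqrtr_gt0.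
have se0 : 0 < (Num.sqrt eps)%:C by rewrite ltcR.
have /cvgrPdist_lt /(_ _ se0) [N _ hN] := cu.
exists N => n /hN /=; rewrite distrC norm_lt// sqr_sqrtr// ltW//.
Qed.

Definition hilbert_inner : inner_space R :=
  InnerSpace hrdotDl hrdotZl hrdotC hrdot_ge0 hrdot_eq0 hrdot_complete.

Lemma hrdotDr x y z : hrdot x (y + z) = hrdot x y + hrdot x z.
Proof. exact: (@rdotDr _ hilbert_inner). Qed.
Lemma hrdotNl x y : hrdot (- x) y = - hrdot x y.
Proof. exact: (@rdotNl _ hilbert_inner). Qed.
Lemma hrdotNr x y : hrdot x (- y) = - hrdot x y.
Proof. exact: (@rdotNr _ hilbert_inner). Qed.
Lemma hrdotZr (a : R) x y : hrdot x (a%:C *: y) = a * hrdot x y.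
Proof. exact: (@rdotZr _ hilbert_inner). Qed.
Definition hrdotE := (hrdotDl, hrdotDr, hrdotNl, hrdotNr, hrdotZl, hrdotZr).

Lemma nrmZ (a : R[i]) x :
  @nrm _ hilbert_inner (a *: x) = complex.Re `|a| * @nrm _ hilbert_inner x.
Proof.
have nE y : @nrm _ hilbert_inner y = complex.Re `|y| by rewrite norm_hrdot.
by rewrite !nE normrZ (ge0_Re (normr_ge0 a)) ReZ.
Qed.

(** The second argument is conjugate-linear: ['i] on it multiplies the product by -i, and the real
    part of -i z is the imaginary part of z. *)
Lemma hdot_i x y : hdot x y = (hrdot x y)%:C + 'i * (hrdot x ('i *: y))%:C.
Proof.
rewrite /hrdot hdotZr [LHS]complexE; congr (_ + _ * _%:C).
by case: (hdot x y) => a b /=; rewrite mul0r sub0r mulN1r opprK.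
Qed.

End HilbertInner.

Lemma hdotE_hrdot (R : realType) (H H' : hilbert R) (x y : H) (x' y' : H') :
  (forall a : R[i], hrdot x (a *: y) = hrdot x' (a *: y')) -> hdot x y = hdot x' y'.
Proof. by move=> h; rewrite hdot_i [RHS]hdot_i h; have := h 1; rewrite !scale1r => ->. Qed.

(** * Operators and projections in a Hilbert space *)

Section OperatorTheory.
Variables (R : realType) (H : hilbert R).
Implicit Types (T U : operator H) (x y : H).

Lemma operator0 T : T 0 = 0.
Proof. by apply: (addrI (T 0)); rewrite -operatorD !addr0. Qed.
Lemma operatorZ T a x : T (a *: x) = a *: T x.
Proof. by have := operator_linear T a x 0; rewrite operator0 !addr0. Qed.
Lemma operatorB T x y : T (x - y) = T x - T y.
Proof. by rewrite operatorD -scaleN1r operatorZ scaleN1r. Qed.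
Lemma operator_sum T (I : Type) (s : seq I) (F : I -> H) :
  T (\sum_(i <- s) F i) = \sum_(i <- s) T (F i).
Proof.
by elim: s => [|i s IH]; rewrite ?big_nil ?operator0// !big_cons operatorD IH.
Qed.
Lemma opDE T U x : (T + U : operator H) x = T x + U x. Proof. by []. Qed.
Lemma opBE T U x : (T - U : operator H) x = T x - U x. Proof. by []. Qed.
Lemma opME T U x : (T * U : operator H) x = T (U x). Proof. by []. Qed.
Lemma opZE a T x : (a *: T : operator H) x = a *: T x. Proof. by []. Qed.
Lemma op_sumE (I : Type) (s : seq I) (F : I -> operator H) x :
  (\sum_(i <- s) F i : operator H) x = \sum_(i <- s) F i x.
Proof. by elim: s => [|i s IH]; rewrite ?big_nil// !big_cons opDE IH. Qed.
Lemma hdot_adjointr T x y : hdot x (T y) = hdot (adjoint T x) y.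
Proof. by rewrite -{1}[T]adjointK -adjointP. Qed.

Lemma operator_bound T :
  exists2 C : R, 0 < C & forall x, hrdot (T x) (T x) <= C * hrdot x x.
Proof.
have [[_ [c c0 hc]] _] := operatorP T.
exists (complex.Re c ^+ 2 + 1) => [|x]; first by rewrite ltr_wpDl ?sqr_ge0.
have := hc x; rewrite !norm_hrdot (ge0_Re c0) -rmorphM lecR => h.
have : hrdot (T x) (T x) <= complex.Re c ^+ 2 * hrdot x x.
  rewrite -[leLHS]sqr_sqrtr ?hrdot_ge0// -[hrdot x x]sqr_sqrtr ?hrdot_ge0//.
  rewrite -exprMn ler_pXn2r// nnegrE ?sqrtr_ge0// mulr_ge0 ?sqrtr_ge0//.
  exact: Re_ge0.
by have := hrdot_ge0 x; lra.
Qed.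
End OperatorTheory.

Section ProjectionOperator.
Variables (R : realType) (H : hilbert R).
Local Notation I := (hilbert_inner H).
Variable E : set H.
Hypotheses (sE : real_subspace (E : set I)) (zE : forall a v, E v -> E (a *: v))
  (cE : nrm_closed (E : set I)).

Lemma subspaceB x y : E x -> E y -> E (x - y).
Proof.
move=> Ex Ey; rewrite addrC -scaleN1r -(rmorphN1 (real_complex R)).
exact: sE.2.
Qed.

Lemma subspace_proj_uniq v u u' : E u -> E u' ->
  (forall w, E w -> hdot (v - u) w = 0) -> (forall w, E w -> hdot (v - u') w = 0) ->
  u = u'.
Proof.
move=> Eu Eu' hu hu'; apply/eqP; rewrite -subr_eq0 -normr_eq0 -sqrf_eq0 -hdot_norm.
have Ed := subspaceB Eu Eu'.
have -> : u - u' = (v - u') - (v - u) by rewrite opprB [RHS]addrC addrA subrK.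
have := hu _ Ed; have := hu' _ Ed.
have -> : u - u' = (v - u') - (v - u) by rewrite opprB [RHS]addrC addrA subrK.
by rewrite [hdot (_ - (v - u)) _]hdotDl -[- (v - u)]scaleN1r hdotZl => -> ->; rewrite mulr0 addr0.
Qed.

Lemma subspace_projection : exists P : operator H,
  (forall v, E (P v)) /\ forall v w, E w -> hdot (v - P v) w = 0.
Proof.
have /choice[P hP] v : exists u, E u /\ forall w, E w -> hdot (v - u) w = 0.
  have [u Eu hu] := projection_exists (v : I) sE cE.
  (* Real orthogonality to [w] and to ['i *: w], which [zE] keeps in [E], is complex orthogonality
     to [w]. *)
  exists u; split=> // w Ew; rewrite hdot_i.
  by rewrite [hrdot _ w](hu _ Ew) [hrdot _ _](hu _ (zE _ Ew)) rmorph0 mulr0 addr0.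
have lP : linear P.
  move=> a x y; have [EP h] := hP (a *: x + y); have [Ex hx] := hP x; have [Ey hy] := hP y.
  apply: subspace_proj_uniq EP _ h _.
    rewrite -[P y]scale1r addrC; apply: sE.2 (zE _ Ex); exact: Ey.
  move=> w Ew; rewrite opprD addrACA -scalerBr hdotDl hdotZl hx// hy//.
  by rewrite mulr0 addr0.
have nP x : `|P x| <= `|x|.
  have [EP h] := hP x; rewrite !norm_hrdot lecR ler_wsqrtr//.
  have := h _ EP; move/(congr1 (@complex.Re R)); rewrite -/(hrdot _ _) /= => h0.
  have := hrdot_ge0 (x - P x); move: h0.
  rewrite !hrdotE (hrdotC (P x) x); lra.
have bP : bounded_linear P by split=> //; exists 1 => // x; rewrite mul1r.
have aP : adjoint_of P P.
  move=> x y; have [Ex hx] := hP x; have [Ey hy] := hP y.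
  have -> : hdot (P x) y = hdot (P x) (P y).
    apply/eqP; rewrite -subr_eq0 -hdotBr; apply/eqP.
    by rewrite hdot_conj hy// conjC0.
  apply/esym/eqP; rewrite -subr_eq0; apply/eqP.
  by have := hx _ Ey; rewrite hdotDl -[- P x]scaleN1r hdotZl mulN1r.
have oP : is_operator P by split=> //; exists P.
by exists (Operator oP); split=> [v|v w Ew] /=; [exact: (hP v).1|exact: (hP v).2].
Qed.

Section Projection.
Variable P : operator H.
Hypotheses (EP : forall v, E (P v)) (hP : forall v w, E w -> hdot (v - P v) w = 0).

Lemma subspace_proj_id v : E v -> P v = v.
Proof.
move=> Ev; apply: (@subspace_proj_uniq v) => // w Ew; first exact: hP.
by rewrite subrr hdot0l.
Qed.

Lemma subspace_proj_idem : P * P = P.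
Proof. by apply: operator_eq => v; rewrite opME subspace_proj_id. Qed.

Lemma subspace_proj_adj : adjoint P = P.
Proof.
apply/esym/adjoint_uniq => x y.
have -> : hdot (P x) y = hdot (P x) (P y).
  apply/eqP; rewrite -subr_eq0 -hdotBr; apply/eqP.
  by rewrite hdot_conj hP// conjC0.
apply/esym/eqP; rewrite -subr_eq0; apply/eqP.
by have := hP x (EP y); rewrite hdotDl -[- P x]scaleN1r hdotZl mulN1r.
Qed.

(** As the adjoint of [T] preserves [E], the vector [T v - T (P v) = T (v - P v)] is orthogonal to
    [E], so [T (P v)] is the projection of [T v]. *)
Lemma subspace_proj_comm (T : operator H) :
  (forall v, E v -> E (T v)) -> (forall v, E v -> E (adjoint T v)) -> T * P = P * T.
Proof.
move=> hT hT'; apply: operator_eq => v.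
apply: (@subspace_proj_uniq (T v)); [exact/hT|exact: EP| |exact: hP].
move=> w Ew; have -> : T v - (T * P : operator H) v = T (v - P v).
  by rewrite operatorB.
by rewrite adjointP hP//; exact: hT'.
Qed.
End Projection.
End ProjectionOperator.

(** * Central projections *)

Section CentralProjections.
Variables (R : realType) (H : hilbert R) (M : vN_algebra H).
Variables (tau : elt M -> R[i]) (tau_tr : faithful_normal_tracial_state tau).
Implicit Types (x y p q r s t : elt M) (v w : H).
Local Notation I := (hilbert_inner H).

Lemma elt_eq x y : (forall v, x v = y v) -> x = y.
Proof. by move=> h; apply: val_inj; exact: operator_eq. Qed.
Lemma eltM x y v : (x * y : elt M) v = x (y v). Proof. by []. Qed.
Lemma eltB x y v : (x - y : elt M) v = x v - y v. Proof. by []. Qed.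
Lemma star_dot x v w : hdot (x v) w = hdot v (star x w).
Proof. exact: adjointP. Qed.

Lemma star_eq x y : (forall v w, hdot (x v) w = hdot v (y w)) -> star x = y.
Proof.
move=> h; apply: elt_eq => w; apply: hdot_eq => v.
by rewrite -star_dot h.
Qed.
Lemma starK x : star (star x) = x.
Proof. by apply: val_inj; exact: adjointK. Qed.
Lemma starM x y : star (x * y) = star y * star x.
Proof. by apply: val_inj; exact: adjointM. Qed.
Lemma star1 : star (1 : elt M) = 1.
Proof. exact: star_eq. Qed.
Lemma starD x y : star (x + y) = star x + star y.
Proof.
apply: star_eq => v w; rewrite -[LHS]/(hdot (x v + y v) w) hdotDl !star_dot -hdotDr.
by [].
Qed.
Lemma starZ (a : R[i]) x : star (a *: x) = (a^*)%R *: star x.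
Proof.
apply: star_eq => v w; rewrite -[LHS]/(hdot (a *: x v) w) hdotZl star_dot.
by rewrite -[RHS]/(hdot v ((a^*)%R *: star x w)) hdotZr conjCK.
Qed.
Lemma starB x y : star (x - y) = star x - star y.
Proof. by rewrite starD -[- y]scaleN1r starZ rmorphN1 scaleN1r. Qed.

Definition cproj q := projection q /\ central q.

Lemma cproj_sa q : cproj q -> star q = q. Proof. by move=> [[]]. Qed.
Lemma cproj_idem q : cproj q -> q * q = q. Proof. by move=> [[]]. Qed.
Lemma cproj_C q x : cproj q -> q * x = x * q. Proof. by move=> [_ /(_ x)]. Qed.

Lemma cproj1 : cproj 1.
Proof. by split; [split; [exact: star1|exact: mul1r]|move=> x; rewrite mul1r mulr1]. Qed.
Lemma cprojM p q : cproj p -> cproj q -> cproj (p * q).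
Proof.
move=> cp cq; split; first split.
- by rewrite starM !cproj_sa// (cproj_C _ cq).
- by rewrite mulrA -(mulrA p) (cproj_C p cq) mulrA cproj_idem// -mulrA cproj_idem.
- by move=> x; rewrite -mulrA (cproj_C x cq) mulrA (cproj_C x cp) mulrA.
Qed.
Lemma cprojB p q : cproj p -> cproj q -> q * p = q -> cproj (p - q).
Proof.
move=> cp cq qp; split; first split.
- by rewrite starB !cproj_sa.
- have pq : p * q = q by rewrite -(cproj_C p cq).
  by rewrite mulrBl !mulrBr !cproj_idem// qp pq subrr subr0.
- by move=> x; rewrite mulrBl mulrBr (cproj_C x cp) (cproj_C x cq).
Qed.
Lemma cproj_compl q : cproj q -> cproj (1 - q).
Proof. by move=> cq; apply: cprojB => //; [exact: cproj1|rewrite mulr1]. Qed.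
Lemma cprojD p q : cproj p -> cproj q -> p * q = 0 -> cproj (p + q).
Proof.
move=> cp cq pq; split; first split.
- by rewrite starD !cproj_sa.
- by rewrite mulrDl !mulrDr !cproj_idem// (cproj_C p cq) pq addr0 add0r.
- by move=> x; rewrite mulrDl mulrDr (cproj_C x cp) (cproj_C x cq).
Qed.

Lemma cproj_positive q : cproj q -> positive q.
Proof.
move=> cq v; rewrite -{1}(cproj_idem cq) eltM star_dot cproj_sa//.
exact: hdot_ge0.
Qed.

Definition tr x : R := complex.Re (tau x).

Lemma tauD x y : tau (x + y) = tau x + tau y.
Proof. by have := state_linear tau_tr 1 x y; rewrite scale1r mul1r. Qed.
Lemma tau0 : tau 0 = 0.
Proof. by apply: (addrI (tau 0)); rewrite -tauD !addr0. Qed.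
Lemma tauZ (a : R[i]) x : tau (a *: x) = a * tau x.
Proof. by have := state_linear tau_tr a x 0; rewrite !addr0 tau0 addr0. Qed.
Lemma tauB x y : tau (x - y) = tau x - tau y.
Proof. by rewrite tauD -scaleN1r tauZ mulN1r. Qed.
Lemma tr0 : tr 0 = 0. Proof. by rewrite /tr tau0. Qed.
Lemma trD x y : tr (x + y) = tr x + tr y.
Proof. by rewrite /tr tauD ReD. Qed.
Lemma trB x y : tr (x - y) = tr x - tr y.
Proof. by rewrite /tr tauB ReD ReN. Qed.
Lemma tr1 : tr 1 = 1. Proof. by rewrite /tr (state1 tau_tr). Qed.
Lemma cproj_tau q : cproj q -> tau q = (tr q)%:C.
Proof. by move=> /cproj_positive/(state_ge0 tau_tr)/ge0_Re. Qed.
Lemma tr_ge0 q : cproj q -> 0 <= tr q.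
Proof. by move=> /cproj_positive/(state_ge0 tau_tr)/Re_ge0. Qed.
Lemma tr_eq0 q : cproj q -> tr q = 0 -> q = 0.
Proof.
move=> cq q0; apply: (state_faithful tau_tr).
by rewrite cproj_sa// cproj_idem// cproj_tau// q0.
Qed.
Lemma tr_gt0 q : cproj q -> q <> 0 -> 0 < tr q.
Proof.
move=> cq q0; rewrite lt_neqAle tr_ge0// andbT.
by apply/eqP => /esym/(tr_eq0 cq).
Qed.
Lemma tr_le p q : cproj p -> cproj q -> q * p = q -> tr q <= tr p.
Proof. by move=> cp cq qp; rewrite -subr_ge0 -trB tr_ge0//; exact: cprojB. Qed.

(** The supremum of a directed family is the projection onto the closure of the union of the ranges.
    It commutes with the commutant of [M], hence lies in [M]; normality of [tau] bounds its
    trace. *)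
Lemma cproj_sup (D : set (elt M)) : D !=set0 -> (forall q, D q -> cproj q) ->
  (forall q r, D q -> D r -> exists t, [/\ D t, q * t = q & r * t = r]) ->
  exists s, [/\ cproj s, forall q, D q -> q * s = q &
    forall b, (forall q, D q -> tr q <= b) -> tr s <= b].
Proof.
move=> [q0 Dq0] cD dD.
pose E : set H := [set v | forall eps : R, 0 < eps ->
  exists q w, D q /\ @nrm _ I (q w - v) < eps].
have EZ a v : E v -> E (a *: v).
  move=> Ev eps e0.
  have n0 : 0 < complex.Re `|a| + 1 by rewrite ltr_wpDl// Re_ge0.
  have [|q [w [Dq h]]] := Ev (eps / (complex.Re `|a| + 1)); first exact: divr_gt0.
  exists q, (a *: w); split=> //; rewrite operatorZ -scalerBr.
  apply: le_lt_trans (_ : _ <= complex.Re `|a| * @nrm _ I (q w - v)) _.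
    by rewrite nrmZ.
  move: h; rewrite ltr_pdivlMr// mulrC mulrDl mul1r.
  by apply: le_lt_trans; rewrite lerDl nrm_ge0.
have ED (x y : H) : E x -> E y -> E (x + y).
  move=> Ex Ey eps e0.
  have [|q [w [Dq hq]]] := Ex (eps / 2); first by lra.
  have [|r [u [Dr hr]]] := Ey (eps / 2); first by lra.
  have [t [Dt qt rt]] := dD _ _ Dq Dr.
  exists t, (q w + r u); split=> //.
  have -> : t (q w + r u) - (x + y) = (q w - x) + (r u - y).
    by rewrite operatorD -!eltM (cproj_C q (cD _ Dt)) (cproj_C r (cD _ Dt)) qt rt opprD addrACA.
  by apply: le_lt_trans (@nrmD _ I _ _) _; lra.
have sE : real_subspace (E : set I).
  split=> [eps e0|a x y Ex Ey]; last by apply: ED => //; exact: EZ.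
  exists q0, 0; split=> //; rewrite operator0 subr0.
  by rewrite /nrm /nsq (@rdot0l _ I) sqrtr0.
have cE : nrm_closed (E : set I).
  move=> l hl eps e0.
  have [|x Ex hx] := hl (eps / 2); first by lra.
  have [|q [w [Dq hq]]] := Ex (eps / 2); first by lra.
  exists q, w; split=> //.
  by apply: le_lt_trans (@nrmB _ I _ x _) _; lra.
have [P [EP hP]] := subspace_projection sE EZ cE.
have ran q w : D q -> E (q w).
  by move=> Dq eps e0; exists q, w; split=> //; rewrite subrr /nrm /nsq (@rdot0l _ I) sqrtr0.
have stab (T : operator H) : (forall q, D q -> T * operator_of_elt q = operator_of_elt q * T) -> forall v, E v -> E (T v).
  move=> hT v Ev eps e0; have [C C0 hC] := operator_bound T.
  have sC : 0 < Num.sqrt C by rewrite sqrtr_gt0.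
  have [|q [w [Dq h]]] := Ev (eps / Num.sqrt C); first exact: divr_gt0.
  exists q, (T w); split=> //; rewrite -opME -hT// opME -operatorB.
  move: h; rewrite ltr_pdivlMr//; apply: le_lt_trans.
  rewrite /nrm -sqrtrM ?(@rdot_ge0 _ I)// ler_wsqrtr// mulrC.
  exact: hC.
have commP (T : operator H) : (forall q, D q -> T * operator_of_elt q = operator_of_elt q * T) ->
    (forall q, D q -> adjoint T * operator_of_elt q = operator_of_elt q * adjoint T) -> T * P = P * T.
  move=> hT hT'; apply: (subspace_proj_comm sE EP hP); exact: stab.
have MP : vN_set M P.
  rewrite -vN_bicommutant => y hy; apply/esym/commP => q _; first exact/hy/eltP.
  exact/(commutant_star (@vN_star _ _ M) hy)/eltP.
pose s : elt M := Elt MP.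
have cs : cproj s.
  split; first split.
  - by apply: val_inj; exact: (subspace_proj_adj EP hP).
  - by apply: val_inj; exact: (subspace_proj_idem sE EP hP).
  - move=> x; apply/esym/val_inj/commP => q Dq.
      by have := cproj_C x (cD _ Dq) => /(congr1 val) /esym.
    by have := cproj_C (star x) (cD _ Dq) => /(congr1 val) /esym.
have qs q : D q -> q * s = q.
  move=> Dq; rewrite (cproj_C _ (cD _ Dq)); apply: elt_eq => v.
  rewrite eltM; exact: (subspace_proj_id sE EP hP (ran q v Dq)).
exists s; split=> // b hb.
have lub : is_lub D s.
  split; [exact: cproj_sa|move=> q Dq; apply: cproj_positive|].
    by apply: cprojB => //; [exact: cD|exact: qs].
  move=> t sat ub v.
  (* The order of [R[i]] compares only numbers with equal imaginary parts. *)
  have Im0 : complex.Im (hdot ((t - s : elt M) v) v) = 0.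
    have : hdot ((t - s : elt M) v) v = (hdot ((t - s : elt M) v) v)^*%R.
      by rewrite -hdot_conj {1}star_dot starB sat cproj_sa.
    by case: (hdot _ _) => a c /= [] h; lra.
  rewrite lecE Im0 eqxx /= -/(hrdot _ _) eltB hrdotDl hrdotNl.
  rewrite subr_ge0; apply/ler_addgt0Pr => e e0.
  have n0 : 0 < @nrm _ I v + 1 by rewrite ltr_wpDl// nrm_ge0.
  have [|q [w [Dq hq]]] := EP v (e / (@nrm _ I v + 1)); first exact: divr_gt0.
  have h1 : hrdot (q v) v <= hrdot (t v) v.
    have := ub q Dq v; move/Re_ge0; rewrite -/(hrdot _ _) eltB hrdotDl hrdotNl; lra.
  (* As [q v = q (s v)], this vector is the point of the range of [q] nearest to [s v], so it is at
     least as near as [q w]. *)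
  have h2 : @nrm _ I (s v - q v) <= @nrm _ I (q w - s v).
    rewrite /nrm ler_wsqrtr// /nsq.
    have -> : q v = q (s v) by rewrite -eltM qs.
    set x := s v.
    have o : hrdot (x - q x) (q (x - w)) = 0.
      rewrite /hrdot -{2}(cproj_sa (cD _ Dq)) -star_dot operatorB -eltM.
      by rewrite cproj_idem ?subrr ?hdot0l//; exact: cD.
    have -> : q w - x = - ((x - q x) + q (x - w)).
      by rewrite operatorB addrA subrK opprB.
    rewrite -[rdot (- _) _]/(hrdot (- _) (- _)) hrdotNl hrdotNr opprK.
    rewrite hrdotDl (hrdotDr (x - q x)) (hrdotDr (q (x - w))) (hrdotC (q (x - w)) (x - q x)) o.
    rewrite -[rdot _ _]/(hrdot (x - q x) (x - q x)).
    by have := hrdot_ge0 (q (x - w)); lra.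
  have := @rdot_le _ I (s v - q v) v.
  rewrite -[rdot _ _]/(hrdot (s v - q v) v) hrdotDl hrdotNl.
  rewrite ler_norml => /andP[_ h3].
  have h4 : @nrm _ I (s v - q v) * @nrm _ I v <= e.
    move: hq; rewrite ltr_pdivlMr// => hq.
    apply: le_trans (ltW hq); rewrite ler_pM ?nrm_ge0//; lra.
  lra.
have dirD : directed D.
  split; first by exists q0.
  move=> x y Dx Dy; have [z [Dz xz yz]] := dD _ _ Dx Dy; exists z; split=> //.
  - by apply/cproj_positive/cprojB => //; exact: cD.
  - by apply/cproj_positive/cprojB => //; exact: cD.
have := state_normal tau_tr (fun q Dq => cproj_sa (cD q Dq)) dirD lub (b := b%:C).
rewrite cproj_tau// lecR; apply=> q Dq; rewrite cproj_tau ?lecR ?hb//; exact: cD.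
Qed.

Hypothesis Z_diffuse : diffuse_center M.

(** Not being minimal, [p] splits into two nonzero central projections, one of which has at most
    half the trace. *)
Lemma cproj_half p : cproj p -> p <> 0 ->
  exists q, [/\ cproj q, q * p = q, q <> 0 & tr q <= tr p / 2].
Proof.
move=> cp p0.
have [q [cq qp q0 qnp]] : exists q, [/\ cproj q, q * p = q, q <> 0 & q <> p].
  apply: contrapT => hn; apply: Z_diffuse; exists p; split; [exact: cp.1|exact: cp.2|by []|].
  move=> q pq zq qp; apply: contrapT => /not_orP[q0 qnp].
  by apply: hn; exists q.
have := trB p q; case: (leP (tr q) (tr p / 2)) => hq tpq; first by exists q.
exists (p - q); split; [exact: cprojB| |by move/eqP; rewrite subr_eq0 => /eqP/esym|lra].
by rewrite mulrBl cproj_idem// qp.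
Qed.

Lemma cproj_small p (e : R) : cproj p -> p <> 0 -> 0 < e ->
  exists q, [/\ cproj q, q * p = q, q <> 0 & tr q < e].
Proof.
move=> cp p0 e0.
(* Halving beats the linear factor, since [n.+2 <= 2 * n.+1]. *)
have iter n : exists q, [/\ cproj q, q * p = q, q <> 0 & n.+1%:R * tr q <= tr p].
  elim: n => [|n [q [cq qp q0 hq]]].
    by exists p; split=> //; [exact: cproj_idem|rewrite mul1r].
  have [r [cr rq r0 hr]] := cproj_half cq q0.
  exists r; split=> //; first by rewrite -rq -mulrA qp.
  apply: le_trans hq; apply: le_trans (_ : _ <= n.+1%:R * (2 * tr r)) _.
    rewrite mulrA ler_wpM2r ?tr_ge0// -natrM ler_nat muln2 doubleS !ltnS.
    by rewrite -addnn leq_addr.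
  by rewrite ler_wpM2l//; lra.
have [q [cq qp q0 hq]] := iter (Num.bound (tr p / e)).
exists q; split=> //.
have hb : tr p / e < (Num.bound (tr p / e)).+1%:R.
  apply: lt_le_trans (archi_boundP _) _; last by rewrite ler_nat.
  by rewrite divr_ge0 ?tr_ge0// ltW.
have b0 : 0 < (Num.bound (tr p / e)).+1%:R :> R by rewrite ltr0n.
rewrite -(ltr_pM2l b0); apply: le_lt_trans hq _.
by rewrite -ltr_pdivrMr.
Qed.

(* Otherwise the projections below [p] of trace at most [e] all have trace less
   than [e / 2], so they are closed under joins and have a largest element,
   which could still be enlarged. *)
Lemma cproj_slice p (e : R) : cproj p -> 0 < e ->
  exists q, [/\ cproj q, q * p = q, tr q <= e & q = p \/ e / 2 <= tr q].
Proof.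
move=> cp e0; apply: contrapT => hn.
pose D := [set q | [/\ cproj q, q * p = q & tr q <= e]].
have Dlt q : D q -> q <> p /\ tr q < e / 2.
  move=> [cq qp qe]; split=> [qp'|]; first by apply: hn; exists q; split=> //; left.
  by rewrite ltNge; apply/negP => h; apply: hn; exists q; split=> //; right.
have c0 : cproj 0.
  rewrite -(subrr (1 : elt M)); apply: cprojB; [exact: cproj1|exact: cproj1|exact: mul1r].
have D0 : D 0 by split; rewrite ?mul0r ?tr0// ltW.
have cD q : D q -> cproj q by case.
have join q r : D q -> D r -> exists t, [/\ D t, q * t = q & r * t = r].
  move=> Dq Dr; have [cq qp qe] := Dq; have [cr rp re] := Dr.
  have [_ qe2] := Dlt _ Dq; have [_ re2] := Dlt _ Dr.
  have cr' : cproj (r * (1 - q)) by apply: cprojM => //; exact: cproj_compl.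
  have ort : q * (r * (1 - q)) = 0.
    by rewrite (cproj_C _ cq) -mulrA mulrBl mul1r cproj_idem// subrr mulr0.
  (* The join of [q] and [r]; both traces are below [e / 2], so its trace is below [e]. *)
  exists (q + r * (1 - q)); split.
  - split; first exact: cprojD.
    + by rewrite mulrDl qp -mulrA (cproj_C p (cproj_compl cq)) mulrA rp.
    + rewrite trD; have : tr (r * (1 - q)) <= tr r.
        apply: tr_le => //; rewrite -mulrA (cproj_C r (cproj_compl cq)) mulrA.
        by rewrite cproj_idem.
      lra.
  - by rewrite mulrDr ort cproj_idem// addr0.
  - by rewrite mulrDr mulrA cproj_idem// -mulrDr addrC subrK mulr1.
have [s0 [cs0 qs0 ts0]] := cproj_sup (ex_intro _ _ D0) cD join.
(* Cutting by [p] puts the supremum below [p]; it still dominates [D], whose members are below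
   [p]. *)
pose s := s0 * p.
have cs : cproj s by exact: cprojM.
have sp : s * p = s by rewrite /s -mulrA cproj_idem.
have qs q : D q -> q * s = q.
  by move=> Dq; have [cq qp _] := Dq; rewrite /s mulrA qs0.
have tse : tr s <= e / 2.
  apply: le_trans (_ : tr s0 <= _); last first.
    by apply: ts0 => q /Dlt[_ /ltW].
  by apply: tr_le => //; rewrite /s (cproj_C p cs0) -mulrA cproj_idem.
have Ds : D s by split=> //; lra.
have [snp slt] := Dlt _ Ds.
(* The enlargement: a small nonzero [r] below [p - s] puts [r + s] in [D], hence below [s], which
   forces [r = 0]. *)
have [|ps0||r [cr rps r0 rlt]] := @cproj_small (p - s) (e / 2).
- exact: cprojB.
- by apply: snp; apply/esym/eqP; rewrite -subr_eq0; apply/eqP.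
- by lra.
have rs : r * s = 0.
  by rewrite -rps -mulrA mulrBl -(cproj_C p cs) sp cproj_idem// subrr mulr0.
have rp : r * p = r.
  by rewrite -[in LHS]rps -mulrA mulrBl cproj_idem// sp.
have Dr : D (r + s).
  split; [exact: cprojD|by rewrite mulrDl rp sp|rewrite trD; lra].
apply: r0; have := qs _ Dr; rewrite mulrDl rs cproj_idem// add0r.
by move/eqP; rewrite -subr_eq0 opprD addrC addrNK oppr_eq0 => /eqP.
Qed.

(** Nonzero members make the list free of repetitions and the traces positive; both serve when a
    multiple of the partition has to be listed as part of some F'. *)
Definition cpartition (e : R) p (l : seq (elt M)) :=
  [/\ forall q, q \in l -> [/\ cproj q, q <> 0, q * p = q & tr q <= e],
      pairwise (fun q r => q * r == 0) l & \sum_(q <- l) q = p].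

(** Each slice exhausts [p] or removes trace at least [e / 2], so [m] bounds the number of
    slices. *)
Lemma cpartition_exists p (e : R) : cproj p -> 0 < e -> exists l, cpartition e p l.
Proof.
move=> cp e0.
have [m hm] : exists m : nat, tr p <= m%:R * (e / 2).
  exists (Num.bound (tr p / (e / 2))); rewrite -ler_pdivrMr; last by lra.
  by apply/ltW/archi_boundP; rewrite divr_ge0 ?tr_ge0//; lra.
elim: m p cp hm => [|m IH] p cp hm.
  have -> : p = 0 by apply: tr_eq0 => //; apply: le_anti; rewrite tr_ge0// andbT -(mul0r (e / 2)).
  by exists [::]; split=> //; rewrite big_nil.
have [p0|p0] := eqVneq p 0.
  by rewrite p0; exists [::]; split=> //; rewrite big_nil.
have [q [cq qp qe [qp1|qe2]]] := cproj_slice cp e0.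
  rewrite qp1 in qe; exists [:: p]; split=> //; last by rewrite big_seq1.
  by move=> r; rewrite inE => /eqP ->; split; [|exact/eqP|exact: cproj_idem|].
have cpq : cproj (p - q) by exact: cprojB.
have [|l [hl ol sl]] := IH _ cpq.
  by move: hm; rewrite trB -natr1 mulrDl mul1r; lra.
have ql r : r \in l -> q * r = 0.
  by move=> /hl[cr _ rpq _]; rewrite (cproj_C _ cq) -rpq -mulrA mulrBl (cproj_C q cp) qp
    cproj_idem// subrr mulr0.
exists (q :: l); split.
- move=> r; rewrite inE => /predU1P[->|/hl[cr r0 rpq re]].
    by split=> // q0; move: qe2; rewrite q0 tr0; lra.
  by split=> //; rewrite -rpq -mulrA mulrBl cproj_idem// qp.
- by rewrite /= ol andbT; apply/allP => r /ql ->.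
- by rewrite big_cons sl addrC subrK.
Qed.
End CentralProjections.

(** * The inner product of Hilbert-Schmidt operators *)

Section Orthonormal.
Variables (R : realType) (H : hilbert R).
Implicit Types (x y v : H) (a : R[i]).
Local Notation I := (hilbert_inner H).

Lemma hdot0r x : hdot x (0 : H) = 0.
Proof. by rewrite hdot_conj hdot0l conjC0. Qed.

Lemma hdot_sq_norm x : complex.Re (`|x| ^+ 2) = hrdot x x.
Proof. by rewrite -hdot_norm. Qed.

(** Multiplying [x] by the conjugate of [hdot x y] makes the product real and nonnegative, so that
    the real inequality applies. *)
Lemma hdot_CS x y : `|hdot x y| <= `|x| * `|y|.
Proof.
have [->|z0] := eqVneq (hdot x y) 0; first by rewrite normr0 mulr_ge0.
have n0 : 0 < complex.Re `|hdot x y| by rewrite gt0_Re// normr_gt0.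
have nE v : `|v| = (@nrm _ I v)%:C by rewrite norm_hrdot.
rewrite (ge0_Re (normr_ge0 (hdot x y))) !nE -rmorphM lecR.
rewrite -(ler_pM2l n0).
have : hrdot ((hdot x y)^*%R *: x) y = complex.Re `|hdot x y| * complex.Re `|hdot x y|.
  rewrite /hrdot hdotZl mulrC -normCK (ge0_Re (normr_ge0 (hdot x y))) -rmorphXn /=.
  by rewrite expr2.
move=> <-; have := @rdot_le _ I ((hdot x y)^*%R *: x) y.
rewrite nrmZ norm_conjC mulrA ler_norml => /andP[_].
by [].
Qed.

Lemma normalize v : v != 0 -> hdot (`|v|^-1 *: v) (`|v|^-1 *: v) = 1.
Proof.
move=> v0; rewrite hdotZl hdotZr geC0_conj ?invr_ge0// hdot_norm expr2.
have n0 : `|v| != 0 by rewrite normr_eq0.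
by rewrite mulKf// mulVf.
Qed.

Lemma orthonormal_basis_extend (e0 : H) : hdot e0 e0 = 1 ->
  exists2 E, orthonormal_basis E & E e0.
Proof.
move=> n1.
pose on (A : set H) := forall e f, A e -> A f -> hdot e f = (e == f)%:R.
(* With [e0] adjoined inside the predicate, the union of the empty chain qualifies too. *)
pose P (A : set H) := on (A `|` [set e0]).
have [F FP tF|A [PA Amax]] := @Zorn_bigcup _ P.
  move=> e f [[X FX Xe]|->] [[Y FY Yf]|->]; last by rewrite eqxx.
  - have [XY|YX] := tF _ _ FX FY.
    + by apply: (FP _ FY); left => //; exact: XY.
    + by apply: (FP _ FX); left => //; exact: YX.
  - by apply: (FP _ FX); [left|right].
  - by apply: (FP _ FY); [right|left].
exists (A `|` [set e0]); last by right.
split=> // v hv; apply: contrapT => /eqP v0.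
pose u : H := `|v|^-1 *: v.
have hu e : (A `|` [set e0]) e -> hdot u e = 0 by move=> Ae; rewrite hdotZl hv// mulr0.
have uu : hdot u u = 1 by exact: normalize.
have hu' e : (A `|` [set e0]) e -> hdot e u = 0.
  by move=> Ae; rewrite hdot_conj hu// conjC0.
have nu e : (A `|` [set e0]) e -> u != e.
  by move=> Ae; apply/eqP => ue; have := hu _ Ae; rewrite -ue uu => /eqP; rewrite oner_eq0.
apply: (Amax (A `|` [set u])).
  split=> [e Ae|sub]; first by left.
  have Au : A u by apply: sub; right.
  by have := nu u (or_introl Au); rewrite eqxx.
have aux e : ((A `|` [set u]) `|` [set e0]) e -> (A `|` [set e0]) e \/ e = u.
  by move=> [[]|]; [left; left|right|left; right].
move=> e f /aux[Ae|->] /aux[Af|->]; first exact: PA.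
- by rewrite hu'// eq_sym (negbTE (nu _ Ae)).
- by rewrite hu// (negbTE (nu _ Af)).
- by rewrite uu eqxx.
Qed.

Definition rank1_fun x y : H -> H := fun v => hdot v y *: x.

Lemma rank1_bounded x y : bounded_linear (rank1_fun x y).
Proof.
split=> [a u v|]; first by rewrite /rank1_fun hdotDl hdotZl scalerDl scalerA.
exists (`|x| * `|y|) => [|v]; first exact: mulr_ge0.
by rewrite normrZ mulrC -mulrA ler_wpM2l// mulrC hdot_CS.
Qed.

Lemma rank1_adjoint_of x y : adjoint_of (rank1_fun x y) (rank1_fun y x).
Proof.
move=> u v; rewrite /rank1_fun hdotZl hdotZr mulrC [hdot v x]hdot_conj conjCK.
by [].
Qed.

Lemma is_operator_rank1 x y : is_operator (rank1_fun x y).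
Proof.
split; first exact: rank1_bounded.
by exists (rank1_fun y x); [exact: rank1_bounded|exact: rank1_adjoint_of].
Qed.
Definition rank1 x y : operator H := Operator (is_operator_rank1 x y).

Lemma rank1E x y v : rank1 x y v = hdot v y *: x. Proof. by []. Qed.
Lemma rank1_sandwich (S T : operator H) x y :
  S * rank1 x y * T = rank1 (S x) (adjoint T y).
Proof. by apply: operator_eq => v; rewrite !opME !rank1E operatorZ adjointP. Qed.
End Orthonormal.

Section HilbertSchmidtInner.
Variables (R : realType) (H : hilbert R) (K : hs_space H).
Implicit Types (k l : K) (x y v : H) (S T : operator H).

Lemma hs_opD k l : hs_op (k + l) = hs_op k + hs_op l.
Proof. by have := hs_op_linear 1 k l; rewrite !scale1r. Qed.
Lemma hs_op0 : hs_op (0 : K) = 0.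
Proof. by apply: (addrI (hs_op (0 : K))); rewrite -hs_opD !addr0. Qed.
Lemma hs_opZ a k : hs_op (a *: k) = a *: hs_op k.
Proof. by have := hs_op_linear a k 0; rewrite hs_op0 !addr0. Qed.
Lemma hs_opN k : hs_op (- k) = - hs_op k.
Proof. by rewrite -scaleN1r hs_opZ scaleN1r. Qed.
Lemma hs_opB k l : hs_op (k - l) = hs_op k - hs_op l.
Proof. by rewrite hs_opD hs_opN. Qed.
Lemma hs_op_sum (I : Type) (s : seq I) (F : I -> K) :
  hs_op (\sum_(i <- s) F i) = \sum_(i <- s) hs_op (F i).
Proof. by elim: s => [|i s IH]; rewrite ?big_nil ?hs_op0// !big_cons hs_opD IH. Qed.

Lemma hs_norm2_split (E : set H) (e0 : H) T : E e0 ->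
  hs_norm2 E T = ((hrdot (T e0) (T e0))%:E +
    \esum_(e in E `&` ~` [set e0]) (hrdot (T e) (T e))%:E)%E.
Proof.
move=> Ee0; have pos e : E e -> (0 <= (complex.Re (`|T e| ^+ 2))%:E)%E.
  by rewrite lee_fin hdot_sq_norm hrdot_ge0.
rewrite /hs_norm2 (esumID [set e0] _ _ pos).
  congr (_ + _)%E; last by apply: eq_esum => e _; rewrite hdot_sq_norm.
  have e1 : E `&` [set e0] = [set e0] by apply/setIidPr => _ ->.
  transitivity (\esum_(e in [set e0]) (complex.Re (`|T e| ^+ 2))%:E)%E.
    by congr esum; exact: e1.
  by rewrite esum_set1 hdot_sq_norm// lee_fin hrdot_ge0.
Qed.

Lemma hs_norm_split (E : set H) (e0 : H) k : orthonormal_basis E -> E e0 ->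
  (hrdot k k)%:E = ((hrdot (hs_op k e0) (hs_op k e0))%:E +
    \esum_(e in E `&` ~` [set e0]) (hrdot (hs_op k e) (hs_op k e))%:E)%E.
Proof.
by move=> oE Ee0; rewrite -(hs_norm2_split _ Ee0) -hs_op_norm// hdot_sq_norm.
Qed.

Lemma rank1_away (E : set H) x y e : orthonormal_basis E -> E (`|y|^-1 *: y) ->
  y != 0 -> (E `&` ~` [set `|y|^-1 *: y]) e -> rank1 x y e = 0.
Proof.
move=> [oE _] Ey y0 [Ee /eqP ne]; rewrite rank1E.
have := oE _ _ Ee Ey; rewrite (negbTE ne) hdotZr => /eqP.
rewrite mulf_eq0 conjC_eq0 invr_eq0 normr_eq0 (negbTE y0) /= => /eqP ->.
by rewrite scale0r.
Qed.

Lemma rank1_hs x y : hilbert_schmidt (rank1 x y).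
Proof.
have [->|y0] := eqVneq y 0.
  have -> : rank1 x 0 = 0 :> operator H.
    by apply: operator_eq => v; rewrite rank1E hdot0r scale0r.
  by rewrite -(hs_op_range K); exists 0 => //; exact: hs_op0.
have [E oE Ee] := orthonormal_basis_extend (normalize y0).
exists E => //; rewrite (hs_norm2_split _ Ee) esum1 ?adde0 ?ltry//.
by move=> e he; rewrite (rank1_away x oE Ee y0 he) /hrdot hdot0l.
Qed.

Definition hs_rank1 x y : K := xget 0 [set k | hs_op k = rank1 x y].

Lemma hs_op_rank1 x y : hs_op (hs_rank1 x y) = rank1 x y.
Proof.
rewrite /hs_rank1; case: xgetP => // h.
by have := rank1_hs x y; rewrite -(hs_op_range K) => -[k _ /h].
Qed.

Lemma hs_rank1_unique x y k : (forall v, hs_op k v = hdot v y *: x) -> k = hs_rank1 x y.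
Proof.
by move=> h; apply: hs_op_eq; rewrite hs_op_rank1; apply: operator_eq.
Qed.

(** The norm of [K] is known in any orthonormal basis. In one through [y / |y|], the operators of
    [k + r] and [k] differ at that vector only; the remaining sums are finite and cancel, and
    polarization leaves the inner product. *)
Lemma hrdot_rank1 k x y : hrdot k (hs_rank1 x y) = hrdot (hs_op k y) x.
Proof.
have [->|y0] := eqVneq y 0.
  rewrite operator0 /hrdot hdot0l.
  have -> : hs_rank1 x 0 = 0; last by rewrite hdot0r.
  by apply/esym/hs_rank1_unique => v; rewrite hs_op0 hdot0r scale0r.
have [E oE Ee] := orthonormal_basis_extend (normalize y0).
set e0 := `|y|^-1 *: y in Ee.
set r := hs_rank1 x y.
have r0 e : (E `&` ~` [set e0]) e -> hs_op r e = 0.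
  by move=> he; rewrite hs_op_rank1; exact: rank1_away he.
have := hs_norm_split (k + r) oE Ee; rewrite (_ : \esum_(_ in _) _ =
    \esum_(e in E `&` ~` [set e0]) (hrdot (hs_op k e) (hs_op k e))%:E)%E; last first.
  by apply: eq_esum => e he; rewrite hs_opD opDE r0// addr0.
have := hs_norm_split r oE Ee; rewrite esum1 ?adde0; last first.
  by move=> e he; rewrite r0// /hrdot hdot0l.
have := hs_norm_split k oE Ee.
have fin0 (c d : R) (e : \bar R) : (0 <= e)%E -> (c%:E = d%:E + e)%E -> e = (c - d)%:E.
  by case: e => [e| |] // _ [] ->; rewrite addrAC subrr add0r.
move=> hk [hr] hkr.
have /fin0/(_ hk) e1 : (0 <= \esum_(e in E `&` ~` [set e0]) (hrdot (hs_op k e) (hs_op k e))%:E)%E.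
  by apply: esum_ge0 => e _; rewrite lee_fin hrdot_ge0.
move: hkr; rewrite e1 => -[]; rewrite hs_opD opDE !hrdotE (hrdotC r k).
rewrite (hrdotC (hs_op r e0) (hs_op k e0)) hr.
have -> : hrdot (hs_op k e0) (hs_op r e0) = hrdot (hs_op k y) x.
  rewrite hs_op_rank1 rank1E /e0 operatorZ hdotZl hdot_norm /hrdot hdotZl hdotZr.
  have n0 : `|y| != 0 by rewrite normr_eq0.
  by rewrite expr2 mulKf// geC0_conj// mulKf.
lra.
Qed.

Lemma hs_rank1Z a x y : a *: hs_rank1 x y = hs_rank1 (a *: x) y.
Proof.
apply: hs_rank1_unique => v.
by rewrite hs_opZ opZE hs_op_rank1 rank1E !scalerA mulrC.
Qed.

Lemma hdot_rank1 k x y : hdot k (hs_rank1 x y) = hdot (hs_op k y) x.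
Proof. by apply: hdotE_hrdot => a; rewrite hs_rank1Z hrdot_rank1. Qed.

Lemma hdot_rank1_eq k l :
  (forall x y, hdot k (hs_rank1 x y) = hdot l (hs_rank1 x y)) -> k = l.
Proof.
move=> h; apply: hs_op_eq; apply: operator_eq => y; apply: hdot_eq => x.
by rewrite hdot_conj -hdot_rank1 h hdot_rank1 -hdot_conj.
Qed.

(** Rank-one operators separate the points of [K], so the adjoints of [T] and [U] agree, and with
    them [T] and [U]. *)
Lemma rank1_operator_eq (T U : operator K) :
  (forall x y, T (hs_rank1 x y) = U (hs_rank1 x y)) -> T = U.
Proof.
move=> h; rewrite -[T]adjointK -[U]adjointK; congr adjoint.
apply: operator_eq => k; apply: hdot_rank1_eq => x y.
by rewrite !(adjointP (adjoint _)) !adjointK h.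
Qed.

Lemma sandwich_rank1 S T x y :
  sandwich K S T (hs_rank1 x y) = hs_rank1 (S x) (adjoint T y).
Proof.
by apply: hs_op_eq; rewrite sandwichE !hs_op_rank1 rank1_sandwich.
Qed.

Lemma adjoint_sandwich S T :
  adjoint (sandwich K S T) = sandwich K (adjoint S) (adjoint T).
Proof.
apply: rank1_operator_eq => x y; apply: hdot_eq => k.
rewrite -adjointP sandwich_rank1 adjointK !hdot_rank1 sandwichE !opME.
by rewrite adjointP.
Qed.

End HilbertSchmidtInner.

(** * The right action and its trace *)

(** The rank-one operator built on [x - y] vanishes on a dense set, hence at [x - y], where its
    value is |x - y|^2 (x - y). *)
Lemma dense_hdot_eq (R : realType) (H : hilbert R) (A : set H) (x y : H) :
  dense A -> (forall a, A a -> hdot a x = hdot a y) -> x = y.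
Proof.
move=> dA xy; apply/eqP; rewrite -subr_eq0; apply: contraT => d0.
have T0 : rank1 (x - y) (x - y) = 0.
  apply: (operator_dense_eq dA) => a Aa.
  by rewrite rank1E hdotBr xy// subrr scale0r.
have : rank1 (x - y) (x - y) (x - y) = 0 by rewrite T0.
rewrite rank1E => /eqP; rewrite scaler_eq0 (negbTE d0) orbF hdot_norm.
by rewrite sqrf_eq0 normr_eq0 (negbTE d0).
Qed.

Section RightAction.
Variables (R : realType) (H : hilbert R) (M : vN_algebra H).
Variables (tau : elt M -> R[i]) (tau_tr : faithful_normal_tracial_state tau).
Variables (S : standard_form tau).
Implicit Types (x y z q : elt M) (u v w : S).
Local Notation hat := (hat S).
Local Notation lact := (lact S).

Lemma hat_dot_eq u v : (forall x, hdot (hat x) u = hdot (hat x) v) -> u = v.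
Proof. by move=> h; apply: (dense_hdot_eq (@hat_dense _ _ _ _ S)) => _ [x _ <-]. Qed.

Lemma adjoint_lact x : adjoint (lact x) = lact (star x).
Proof.
apply: lact_eq => z; apply: hat_dot_eq => y.
by rewrite -adjointP !lactE !hat_dot starM starK mulrA.
Qed.

Local Notation J := (@tomita _ _ _ _ S).

Lemma tomitaD u v : J (u + v) = J u + J v.
Proof. by have := tomita_antilinear 1 u v; rewrite conjC1 !scale1r. Qed.
Lemma tomita0 : J 0 = 0.
Proof. by apply: (addrI (J 0)); rewrite -tomitaD !addr0. Qed.
Lemma tomitaZ a u : J (a *: u) = (a^*)%R *: J u.
Proof. by have := tomita_antilinear a u 0; rewrite tomita0 !addr0. Qed.

Lemma tomita_hrdot u v : hrdot (J u) (J v) = hrdot u v.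
Proof.
have nJ w : hrdot (J w) (J w) = hrdot w w by rewrite -!hdot_sq_norm tomita_isometric.
have := nJ (u + v); rewrite tomitaD !hrdotE !nJ (hrdotC (J v)) (hrdotC v u); lra.
Qed.
Lemma tomita_dot u v : hdot (J u) (J v) = hdot v u.
Proof.
rewrite hdot_i tomita_hrdot.
have -> : 'i *: J v = J ((- 'i) *: v) by rewrite tomitaZ; congr (_ *: _); apply/eqP; rewrite eq_complex /= oppr0 opprK !eqxx.
rewrite tomita_hrdot /hrdot hdotZr [hdot v u]hdot_conj.
by case: (hdot u v) => a b; apply/eqP; rewrite eq_complex /=; apply/andP; split; apply/eqP; ring.
Qed.
Lemma tomitaK u : J (J u) = u.
Proof.
by apply: hat_dot_eq => x; rewrite -[in LHS](starK x) -tomitaE tomita_dot -{1}tomitaE tomita_dot.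
Qed.

Lemma sigma_hat x y : sigma (lact x) (hat y) = hat (y * x).
Proof. by rewrite /sigma adjoint_lact tomitaE lactE tomitaE starM !starK. Qed.

Lemma sigma_bounded x : bounded_linear (sigma (lact x)).
Proof.
split=> [a u v|].
  rewrite /sigma tomita_antilinear operatorD operatorZ tomitaD tomitaZ conjCK.
  by [].
have [[_ [c c0 hc]] _] := operatorP (adjoint (lact x)).
by exists c => // u; rewrite /sigma tomita_isometric (le_trans (hc _))// tomita_isometric.
Qed.

Lemma sigma_adjoint_of x : adjoint_of (sigma (lact x)) (sigma (lact (star x))).
Proof.
move=> u v; rewrite /sigma !adjoint_lact starK.
rewrite -{1}[v]tomitaK tomita_dot -{2}[u]tomitaK tomita_dot.
by rewrite hdot_adjointr adjoint_lact starK.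
Qed.

(** The operator x^sigma: on the dense copy of [M] it is right multiplication by [x], so it reverses
    products and commutes with the left action. *)
Definition ract x : operator S :=
  Operator (conj (sigma_bounded x)
    (ex_intro2 _ _ _ (sigma_bounded (star x)) (@sigma_adjoint_of x))).

Lemma ractE x y : ract x (hat y) = hat (y * x).
Proof. exact: sigma_hat. Qed.
Lemma adjoint_ract x : adjoint (ract x) = ract (star x).
Proof. by apply/esym/adjoint_uniq; exact: sigma_adjoint_of. Qed.
Lemma ractM x y : ract (x * y) = ract y * ract x.
Proof. by apply: lact_eq => z; rewrite opME !ractE mulrA. Qed.
Lemma ract1 : ract 1 = 1.
Proof. by apply: lact_eq => z; rewrite ractE mulr1. Qed.
Lemma ract_linear : linear ract.
Proof.
move=> a x y; apply: lact_eq => z.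
by rewrite opDE opZE !ractE mulrDr elt_scaleAr hat_linear.
Qed.
Lemma ractZ a x : ract (a *: x) = a *: ract x.
Proof.
have r0 : ract 0 = 0.
  have := ract_linear 1 0 0; rewrite !scale1r addr0 => h.
  by apply: (addrI (ract 0)); rewrite -h addr0.
by have := ract_linear a x 0; rewrite r0 !addr0.
Qed.
Lemma ract_lact x y : ract x * lact y = lact y * ract x.
Proof. by apply: lact_eq => z; rewrite !opME lactE !ractE lactE mulrA. Qed.
(** The bridge from cocycles to block diagonal operators: [k, q^sigma] = 0 becomes commutation with
    the left action of [q]. *)
Lemma ract_central q : central q -> ract q = lact q.
Proof. by move=> cq; apply: lact_eq => z; rewrite ractE lactE cq. Qed.

Variable K : hs_space S.

Lemma rank_one_hatE : rank_one_hat K = hs_rank1 K (hat 1) (hat 1).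
Proof.
rewrite /rank_one_hat; case: xgetP => [k _ hk|h]; first exact: hs_rank1_unique.
exfalso; apply: (h (hs_rank1 K (hat 1) (hat 1))) => v.
by rewrite hs_op_rank1.
Qed.

Definition right_pair (u : elt M * elt M) : operator K :=
  sandwich K (ract u.2) (ract u.1).

Lemma right_pair_bilin : bilinear_on right_pair.
Proof.
by split=> z a x y; rewrite /right_pair /= ract_linear; [exact: sandwich_linr|exact: sandwich_linl].
Qed.

(* [x (x) y^o] acts by [T |-> y^sigma T x^sigma], commuting with [left_right]. *)
Definition right_rep : enveloping M -> operator K := plift right_pair.

Lemma right_rep_pure x y : right_rep (pure x y) = sandwich K (ract y) (ract x).
Proof. by rewrite /right_rep plift_gen//; exact: right_pair_bilin. Qed.
Lemma right_rep_linear : linear right_rep.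
Proof. exact: plift_is_linear right_pair_bilin. Qed.
Lemma right_repD s t : right_rep (s + t) = right_rep s + right_rep t.
Proof. by have := right_rep_linear 1 s t; rewrite !scale1r. Qed.
Lemma right_rep0 : right_rep 0 = 0.
Proof. by apply: (addrI (right_rep 0)); rewrite -right_repD !addr0. Qed.
Lemma right_repZ a s : right_rep (a *: s : enveloping M) = a *: right_rep s.
Proof. by have := right_rep_linear a s 0; rewrite right_rep0 !addr0. Qed.
Lemma right_repN s : right_rep (- s) = - right_rep s.
Proof. by rewrite -scaleN1r right_repZ scaleN1r. Qed.
Lemma right_rep1 : right_rep 1 = 1.
Proof. by rewrite -[1]/(pure 1 1) right_rep_pure ract1 sandwich1. Qed.

Lemma right_repM s t : right_rep (s * t) = right_rep s * right_rep t.
Proof.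
have linM1 (r : operator K) : linear (fun z : operator K => z * r).
  by move=> a x y; rewrite mulrDl op_scaleAl.
have linM2 (r : operator K) : linear (fun z : operator K => r * z).
  by move=> a x y; rewrite mulrDr op_scaleAr.
apply: (@enveloping_ext _ _ _ _ (fun s => right_rep (s * t))
  (fun s => right_rep s * right_rep t)).
- exact: (lin_comp right_rep_linear (tmul_linl t)).
- exact: (lin_comp (linM1 _) right_rep_linear).
move=> x y.
apply: (@enveloping_ext _ _ _ _ (fun t => right_rep (pure x y * t))
  (fun t => right_rep (pure x y) * right_rep t)).
- exact: (lin_comp right_rep_linear (tmul_linr _)).
- exact: (lin_comp (linM2 _) right_rep_linear).
by move=> x' y'; rewrite pureM !right_rep_pure sandwichM !ractM.
Qed.

Local Notation e := (rank_one_hat K).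

Definition right_trace (s : enveloping M) : R[i] := hdot (right_rep s e) e.

Lemma right_trace_pure x y : right_trace (pure x y) = tau x * tau y.
Proof.
rewrite /right_trace right_rep_pure rank_one_hatE hdot_rank1 sandwichE !opME.
rewrite hs_op_rank1 rank1E operatorZ hdotZl !ractE !hat_dot.
by rewrite !mul1r star1 !mul1r.
Qed.

Lemma right_trace_linear : scalar right_trace.
Proof.
by move=> a s t; rewrite /right_trace right_rep_linear opDE opZE hdotDl hdotZl.
Qed.

(** On pure tensors [right_trace] is a product of two values of [tau], so traciality of [tau]
    extends by bilinearity. *)
Lemma right_traceC s t : right_trace (s * t) = right_trace (t * s).
Proof.
apply: (@enveloping_ext _ _ _ R[i]^o (fun s => right_trace (s * t))
  (fun s => right_trace (t * s))).
- by move=> a x y; rewrite [(_ + _) * t]tmul_linl right_trace_linear.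
- by move=> a x y; rewrite [t * (_ + _)]tmul_linr right_trace_linear.
move=> x y.
apply: (@enveloping_ext _ _ _ R[i]^o (fun t => right_trace (pure x y * t))
  (fun t => right_trace (t * pure x y))).
- by move=> a u v; rewrite [_ * (_ + _)]tmul_linr right_trace_linear.
- by move=> a u v; rewrite [(_ + _) * _]tmul_linl right_trace_linear.
move=> x' y'; rewrite !pureM !right_trace_pure.
by rewrite (state_tracial tau_tr x) (state_tracial tau_tr y').
Qed.

End RightAction.

(** * Block diagonal parts *)

Section Block.
Variables (R : realType) (H : hilbert R) (M : vN_algebra H).
Variables (tau : elt M -> R[i]) (tau_tr : faithful_normal_tracial_state tau).
Variables (S : standard_form tau) (K : hs_space S).
Implicit Types (x y q r : elt M) (k : K).
Local Notation e := (rank_one_hat K).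
Local Notation I := (hilbert_inner K).

Lemma adjointD (H' : hilbert R) (T U : operator H') :
  adjoint (T + U) = adjoint T + adjoint U.
Proof.
apply/esym/adjoint_uniq => v w; rewrite !opDE hdotDl hdotDr.
by rewrite !adjointP.
Qed.
Lemma adjoint0 (H' : hilbert R) : adjoint (0 : operator H') = 0.
Proof.
by apply/esym/adjoint_uniq => v w; rewrite -[LHS]/(hdot 0 w) -[RHS]/(hdot v 0) hdot0l hdot0r.
Qed.
Lemma adjoint1 (H' : hilbert R) : adjoint (1 : operator H') = 1.
Proof. exact/esym/adjoint_uniq. Qed.

Lemma lact0 : lact S 0 = 0.
Proof.
have := lact_linear S 1 0 0; rewrite !scale1r addr0 => h.
by apply: (addrI (lact S 0)); rewrite -h addr0.
Qed.
Lemma lact_sum (l : seq (elt M)) : lact S (\sum_(q <- l) q) = \sum_(q <- l) lact S q.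
Proof.
elim: l => [|q l IH]; first by rewrite !big_nil lact0.
rewrite !big_cons -IH; have := lact_linear S 1 q (\sum_(j <- l) j).
by rewrite !scale1r.
Qed.

(** For a central partition of 1 this is the projection E of the overview, T |-> sum_k q_k T q_k. *)
Definition block (l : seq (elt M)) : operator K := \sum_(q <- l) left_right K q q.

Lemma hs_op_block l k :
  hs_op (block l k) = \sum_(q <- l) lact S q * hs_op k * lact S q.
Proof. by rewrite op_sumE hs_op_sum; apply: eq_bigr => q _; rewrite sandwichE. Qed.

(** [block] is made of left actions, which commute with every [ract]; this is why it commutes with
    the boundary maps below. *)
Lemma block_right l x y :
  block l * sandwich K (ract S x) (ract S y) = sandwich K (ract S x) (ract S y) * block l.
Proof.
rewrite /block mulr_suml mulr_sumr; apply: eq_bigr => q _.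
by rewrite /left_right !sandwichM -!ract_lact.
Qed.

Lemma block_right_rep l s : block l * right_rep K s = right_rep K s * block l.
Proof.
have linM1 (r : operator K) : linear (fun z : operator K => z * r).
  by move=> a x y; rewrite mulrDl op_scaleAl.
have linM2 (r : operator K) : linear (fun z : operator K => r * z).
  by move=> a x y; rewrite mulrDr op_scaleAr.
apply: (@enveloping_ext _ _ _ _ (fun s => block l * right_rep K s)
  (fun s => right_rep K s * block l)).
- exact: (lin_comp (linM2 _) (@right_rep_linear _ _ _ _ _ _)).
- exact: (lin_comp (linM1 _) (@right_rep_linear _ _ _ _ _ _)).
by move=> x y; rewrite !right_rep_pure block_right.
Qed.

Section Partition.
Variables (eps : R) (l : seq (elt M)).
Hypothesis hl : cpartition tau eps 1 l.

Lemma part_cproj q : q \in l -> cproj q.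
Proof. by have [h _ _] := hl => /h[]. Qed.
Lemma part_neq0 q : q \in l -> q != 0.
Proof. by have [h _ _] := hl => /h[_ /eqP]. Qed.
Lemma part_tr q : q \in l -> tr tau q <= eps.
Proof. by have [h _ _] := hl => /h[]. Qed.

Lemma part_orth q r : q \in l -> r \in l -> q != r -> q * r = 0.
Proof.
have [h p _] := hl.
have {h} hc s : s \in l -> cproj s by move=> /h[].
elim: l p hc => // s l' IH /= /andP[/allP ps pl] hc.
rewrite !inE => /predU1P[->|ql] /predU1P[->|rl] //.
- by rewrite eqxx.
- by move=> _; exact/eqP/ps.
- by move=> _; rewrite (cproj_C _ (hc _ _)) ?inE ?ql ?orbT//; exact/eqP/ps.
- by apply: IH => // t tl; apply: hc; rewrite inE tl orbT.
Qed.

(** A repeated member would be orthogonal to itself, hence zero. *)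
Lemma part_uniq : uniq l.
Proof.
have [h p _] := hl; elim: l p h => // s l' IH /= /andP[/allP ps pl] h.
rewrite IH// ?andbT; last by move=> q ql; apply: h; rewrite inE ql orbT.
apply/negP => /ps; have [cs s0 _ _] := h s (mem_head _ _).
by rewrite cproj_idem// => /eqP.
Qed.

Lemma block_adj : adjoint (block l) = block l.
Proof.
have : {in l, forall q, adjoint (left_right K q q) = left_right K q q}.
  by move=> q /part_cproj cq; rewrite adjoint_sandwich !adjoint_lact// cproj_sa.
rewrite /block; elim: l => [|q l' IH] h; first by rewrite !big_nil adjoint0.
rewrite !big_cons adjointD h ?mem_head// IH// => r rl.
by apply: h; rewrite inE rl orbT.
Qed.

Lemma block_idem : block l * block l = block l.
Proof.
rewrite {1}/block mulr_suml; apply: eq_big_seq => q ql.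
rewrite /block mulr_sumr (bigD1_seq q)//=; last exact: part_uniq.
rewrite big1_seq ?addr0 => [|r /andP[rq rl]].
  by rewrite /left_right sandwichM -lactM cproj_idem//; exact: part_cproj.
rewrite /left_right sandwichM -!lactM (part_orth ql rl) 1?eq_sym//.
rewrite (part_orth rl ql)// lact0; apply: operator_eq => k; apply: hs_op_eq.
by rewrite sandwichE mul0r mul0r hs_op0.
Qed.

Lemma block_fix k : (forall q, q \in l -> lact S q * hs_op k = hs_op k * lact S q) ->
  block l k = k.
Proof.
move=> hk; apply: hs_op_eq; rewrite hs_op_block.
have [_ _ s1] := hl.
rewrite (eq_big_seq (fun q => lact S q * hs_op k)) => [|q ql].
  by rewrite -mulr_suml -lact_sum s1 lact1 mul1r.
by rewrite -mulrA -hk// mulrA -lactM cproj_idem//; exact: part_cproj.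
Qed.

Lemma block_small : hrdot (block l e) (block l e) <= eps.
Proof.
have [_ _ s1] := hl.
rewrite /hrdot adjointP block_adj -opME block_idem.
rewrite -/(hrdot _ _) hrdotC {1}/block op_sumE /hrdot.
rewrite (big_morph (fun k => hdot k e) (fun k k' => hdotDl k k' e) (hdot0l e)) Re_sum.
(* In each square of a trace one factor is at most [eps]; the other factors add up to the trace of
   1. *)
apply: le_trans (_ : \sum_(q <- l) eps * tr tau q <= _).
  rewrite big_seq [leRHS]big_seq; apply: ler_sum => q ql.
  rewrite rank_one_hatE hdot_rank1 sandwichE !opME hs_op_rank1 rank1E operatorZ hdotZl.
  rewrite !lactE !hat_dot star1 !mul1r !mulr1.
  rewrite (cproj_tau tau_tr (part_cproj ql)) -rmorphM /= ler_wpM2r ?part_tr//.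
  exact: tr_ge0 (part_cproj ql).
rewrite -mulr_sumr.
have -> : \sum_(q <- l) tr tau q = tr tau (\sum_(q <- l) q).
  by rewrite (big_morph _ (trD tau_tr) (tr0 tau_tr)).
by rewrite s1 tr1// mulr1.
Qed.

End Partition.

Hypothesis Z_diffuse : diffuse_center M.

Lemma part_exists (eps : R) : 0 < eps -> exists l, cpartition tau eps 1 l.
Proof. by apply: cpartition_exists => //; exact: cproj1. Qed.

Lemma commuting_hs_trace0 k :
  (forall q, cproj q -> lact S q * hs_op k = hs_op k * lact S q) -> hrdot k e = 0.
Proof.
move=> hk; apply/eqP; rewrite -normr_le0; apply/ler_addgt0Pr => d d0; rewrite add0r.
have n0 : 0 < @nrm _ I k + 1 by rewrite ltr_wpDl ?nrm_ge0.
(* This bound on the traces gives [block l e] norm at most [d / (|k| + 1)]; the 1 covers [k = 0]. *)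
have [|l hl] := @part_exists ((d / (@nrm _ I k + 1)) ^+ 2).
  by rewrite exprn_gt0// divr_gt0.
have -> : hrdot k e = hrdot k (block l e).
  have {1}<- : block l k = k by apply: (block_fix hl) => q /(part_cproj hl) /hk.
  by rewrite /hrdot adjointP (block_adj hl).
apply: le_trans (@rdot_le _ I _ _) _.
have : @nrm _ I (block l e) <= d / (@nrm _ I k + 1).
  by apply: nrm_le; [rewrite divr_ge0 ?(ltW d0)// ltW|exact: block_small hl].
rewrite ler_pdivlMr// => h; apply: le_trans h.
by rewrite mulrC ler_wpM2l ?nrm_ge0//; lra.
Qed.

End Block.

(** * The first Betti number *)

Lemma free_map_gen (A : pzRingType) (X : Type) (Q : lmodType A) (g : X -> Q) x :
  free_map g (pgen _ x) = g x.
Proof. exact: plift_gen. Qed.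

Lemma basechange_map_gen (A B : pzRingType) (rho : {rmorphism A -> B}) (P Q : lmodType A)
    (f : {linear P -> Q}) b p :
  basechange_map rho f (pgen _ (b, p)) = pgen _ (b, f p).
Proof. by rewrite /= plift_gen//; exact: balanced_comp. Qed.

Section TorAnnihilator.
Variables (A B : pzRingType) (rho : {rmorphism A -> B}) (M : lmodType A).
Variable z : A.
Hypotheses (zC : forall a, z * a = a * z) (zM : forall m : M, z *: m = 0)
  (rzC : forall b, rho z * b = b * rho z).

Lemma central_scale_linear (V : lmodType A) : linear (fun v : V => z *: v).
Proof. by move=> a u v; rewrite scalerDr !scalerA zC. Qed.

Lemma pgen_homology (C : pzRingType) (U V W : lmodType C) (d' : {linear U -> V})
    (d : {linear V -> W}) : cycles_mod_boundaries d' (pgen (@cycles_mod_boundaries _ _ _ _ d' d)).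
Proof.
split=> [x y w xy|a x y xy|x u xu]; apply: plift_inj => X g ag; have [h1 h2 h3] := ag.
- by rewrite [plift _ (_ + _)](pliftD _ _ ag) !plift_gen//; exact: h1.
- by rewrite [plift _ (_ *: _)](pliftZ _ _ ag) !plift_gen//; exact: h2.
- by rewrite [RHS](plift0 ag) plift_gen//; exact: h3 xu.
Qed.

Local Notation eps := (amap (free_res M 0)).
Local Notation d1 := (res_diff M 0).
Local Notation d2 := (res_diff M 1).

Lemma homotopy0_subproof (m : M) : eps (z *: pgen _ m) = 0.
Proof. by rewrite linearZ /= plift_gen// zM. Qed.

(** As [z] kills [M], multiplication by [z] on the resolution is null-homotopic. The canonical
    resolution gives the homotopy explicitly: the cycle [z [m]] is itself a generator one degree
    up. *)
Definition homotopy0 : {linear res_mod M 0 -> res_mod M 1} :=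
  free_map (fun m : M => pgen (A := A) (fun _ _ => True)
    (exist (fun p => eps p = 0) _ (homotopy0_subproof m)) : res_mod M 1).

Lemma homotopy0E p : d1 (homotopy0 p) = z *: p.
Proof.
move: p; apply: linear_pgen_eq.
- by move=> a u v; rewrite !linearP.
- exact: central_scale_linear.
- by move=> m; rewrite /homotopy0 free_map_gen [d1 _]free_map_gen.
Qed.

Lemma homotopy1_subproof (x : {p : res_mod M 0 | eps p = 0}) :
  d1 (z *: (pgen (A := A) (fun _ _ => True) x : res_mod M 1) - homotopy0 (sval x)) = 0.
Proof. by rewrite linearB homotopy0E linearZ /= plift_gen// subrr. Qed.

(** The same device one degree higher, for the cycle [z [x] - homotopy0 x]; subtracting [homotopy0]
    is what yields the homotopy identity [homotopy1E]. *)
Definition homotopy1 : {linear res_mod M 1 -> res_mod M 2} :=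
  free_map (fun x => pgen (A := A) (fun _ _ => True)
    (exist (fun p => d1 p = 0) _ (homotopy1_subproof x)) : res_mod M 2).

Lemma homotopy1E p : d2 (homotopy1 p) + homotopy0 (d1 p) = z *: p.
Proof.
move: p; apply: linear_pgen_eq.
- by move=> a u v; rewrite !linearP scalerDr addrACA.
- exact: central_scale_linear.
- by move=> x; rewrite /homotopy1 free_map_gen [d2 _]free_map_gen [d1 _]free_map_gen subrK.
Qed.

Lemma Tor1_annihilator (v : Tor rho M 1) : rho z *: v = 0.
Proof.
move: v; apply: linear_pgen_eq => [a u v|a u v|x].
- by rewrite scalerDr !scalerA rzC.
- by rewrite scaler0 addr0.
have [g1 g2 g3] := pgen_homology (tor_diff rho M 2) (tor_diff rho M 1).
(* The homotopy identity after base change. On a cycle its last term vanishes, which leaves a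
   boundary. *)
have hE y : rho z *: y = basechange_map rho d2 (basechange_map rho homotopy1 y)
    + basechange_map rho homotopy0 (basechange_map rho d1 y).
  move: y; apply: linear_pgen_eq => [a u v|a u v|[b p]].
  - by rewrite scalerDr !scalerA rzC.
  - by rewrite !linearP scalerDr addrACA.
  have [p1 p2 p3 p4] := pgen_balanced rho (res_mod M 1).
  rewrite -p1 rzC p4 -homotopy1E p3.
  by rewrite !basechange_map_gen.
have y0 : tor_diff rho M 1 (rho z *: sval x) = 0 by rewrite linearZZ; have -> := svalP x; rewrite scaler0.
pose y : {v | tor_diff rho M 1 v = 0} := exist _ _ y0.
rewrite -(g2 (rho z) x y)//; apply: (g3 y (basechange_map rho homotopy1 (sval x))).
rewrite /y /= hE.
have -> : basechange_map rho d1 (sval x) = 0 := svalP x.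
by rewrite linear0 addr0.
Qed.
End TorAnnihilator.

Section BettiOne.
Variables (R : realType) (H : hilbert R) (M : vN_algebra H).
Variables (tau : elt M -> R[i]) (tau_tr : faithful_normal_tracial_state tau).
Variables (S : standard_form tau) (K : hs_space S).
Implicit Types (x y q : elt M).
Local Notation rho := (enveloping_incl K).

(** It serves twice: for central [q] it annihilates [M], and for any [q] its image under [right_rep]
    is T |-> [T, q^sigma]. *)
Definition commutator_tensor q : enveloping M := pure q 1 - pure 1 q.

Lemma commutator_tensor_central q s : central q ->
  commutator_tensor q * s = s * commutator_tensor q.
Proof.
move=> cq; rewrite /commutator_tensor mulrBl mulrBr.
have lin (t : enveloping M) : linear (fun s => t * s - s * t).
  by move=> a u v; rewrite [t * _]tmul_linr [_ * t]tmul_linl scalerBr opprD addrACA.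
have z0 (t : enveloping M) : (forall x y, t * pure x y = pure x y * t) -> t * s = s * t.
  move=> ht; apply/eqP; rewrite -subr_eq0; apply/eqP; move: s.
  apply: (enveloping_ext (lin t) (g := fun=> 0)) => [a u v|x y].
    by rewrite scaler0 addr0.
  by rewrite ht subrr.
congr (_ - _); apply: z0 => x y; rewrite !pureM ?mul1r ?mulr1 ?cq//.
Qed.

Lemma commutator_tensor_kills q (m : bimod M : lmodType (enveloping M)) : central q ->
  commutator_tensor q *: m = 0.
Proof.
move=> cq; rewrite scalerBl; apply/eqP; rewrite subr_eq0; apply/eqP.
rewrite -[LHS]/(bimod_scale (pure q 1) m) -[RHS]/(bimod_scale (pure 1 q) m).
by rewrite !bimod_scale_pure mul1r mulr1 cq.
Qed.

Lemma commutator_tensor_incl q :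
  rho (commutator_tensor q) = left_right_elt K (q, 1) - left_right_elt K (1, q).
Proof. by rewrite rmorphB /= !enveloping_incl_pure. Qed.

(** The generators of the double commutant are the [left_right] and their adjoints, which are again
    of this form, so [T] commutes with all generators. *)
Lemma vN_enveloping_commutes (T : operator K) :
  (forall x y, T * left_right K x y = left_right K x y * T) ->
  forall b : elt (vN_enveloping K), T * operator_of_elt b = operator_of_elt b * T.
Proof.
move=> hT b; apply/esym; apply: (eltP b) => U [[x [y ->]]|[x [y hU]]]; first exact: hT.
have -> : U = left_right K (star x) (star y).
  by rewrite -[U]adjointK hU adjoint_sandwich !adjoint_lact.
exact: hT.
Qed.

Lemma commutator_tensor_inclC q b : central q ->
  rho (commutator_tensor q) * b = b * rho (commutator_tensor q).
Proof.
move=> cq; apply: val_inj; rewrite commutator_tensor_incl.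
apply: (@vN_enveloping_commutes (left_right K q 1 - left_right K 1 q)) => x y.
rewrite mulrBl mulrBr /left_right !sandwichM lact1 !mul1r !mulr1 -!lactM.
by rewrite !cq.
Qed.

Hypothesis Z_diffuse : diffuse_center M.

Lemma betti1 : betti K 1 = 0%E.
Proof.
apply/eqP; rewrite eq_le; apply/andP; split; last first.
  (* The zero submodule, with [n = 0], keeps the supremum from being below 0. *)
  apply: ereal_sup_ubound; exists [set 0], 0; split=> //.
  exists 0%N, 0, \0; split=> //.
  - by split; rewrite ?mul0mx//; apply/matrixP => -[].
  - by move=> u v _ _ _; apply/rowP => -[].
  - by apply/seteqP; split=> [_ -> | _ [v _ <-]] //; exists 0; rewrite //= mul0mx.
  - by rewrite big_ord0.
apply: ge_ereal_sup => _ [W [d [[n [p [f [[pp pa] injf _ ->]]]] ->]]].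
rewrite lee_fin Re_sum big1// => i _.
apply: (commuting_hs_trace0 tau_tr Z_diffuse) => q cq.
have cq2 : central q by case: cq.
set z := commutator_tensor q.
(* The row lies in N^n p because [p *m p = p]. Its image in Tor_1 is killed by [rho z], and [f] is
   injective on N^n p. *)
have z0 : rho z *: row i p = 0.
  apply: injf.
  - by apply/mem_set; rewrite /= -scalemxAl -row_mul pp.
  - by apply/mem_set; rewrite /= mul0mx.
  rewrite linearZZ linear0; apply: Tor1_annihilator => [a|m|b].
  - exact: commutator_tensor_central.
  - exact: commutator_tensor_kills.
  - exact: commutator_tensor_inclC.
(* The diagonal entry at the trace vector: the Hilbert-Schmidt operator p_ii P_1 commutes with
   [q]. *)
have /(congr1 (fun T : elt (vN_enveloping K) => hs_op (T (rank_one_hat K)))) : rho z * p i i = 0.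
  by move/rowP/(_ i): z0; rewrite !mxE.
rewrite commutator_tensor_incl eltM eltB.
rewrite -[in RHS]/(0 : K) hs_opB hs_op0 !sandwichE !lact1 mul1r mulr1.
by move/eqP; rewrite subr_eq0 => /eqP.
Qed.

End BettiOne.

(** * The boundary map and its kernel *)

Section HilbertPower.
Variables (R : realType) (H : hilbert R) (n : nat).
Implicit Types (u v w : 'I_n -> H).

Definition pdot u v : R := \sum_i hrdot (u i) (v i).

Lemma pdotDl u v w : pdot (u + v) w = pdot u w + pdot v w.
Proof. by rewrite /pdot -big_split; apply: eq_bigr => i _; exact: hrdotDl. Qed.
Lemma pdotZl (a : R) u v : pdot (a%:C *: u) v = a * pdot u v.
Proof. by rewrite /pdot mulr_sumr; apply: eq_bigr => i _; exact: hrdotZl. Qed.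
Lemma pdotC u v : pdot u v = pdot v u.
Proof. by apply: eq_bigr => i _; exact: hrdotC. Qed.
Lemma pdot_ge0 u : 0 <= pdot u u.
Proof. by apply: sumr_ge0 => i _; exact: hrdot_ge0. Qed.
Lemma pdot_ge u i : hrdot (u i) (u i) <= pdot u u.
Proof.
rewrite /pdot (bigD1 i)//= lerDl; apply: sumr_ge0 => j _; exact: hrdot_ge0.
Qed.
Lemma pdot_eq0 u : pdot u u = 0 -> u = 0.
Proof.
move=> u0; apply/funext => i; apply: hrdot_eq0; apply/le_anti.
by rewrite hrdot_ge0 andbT -u0 pdot_ge.
Qed.

Lemma pdot_complete (s : nat -> 'I_n -> H) :
  (forall eps : R, 0 < eps -> exists N, forall i j, (N <= i)%N -> (N <= j)%N ->
     pdot (s i - s j) (s i - s j) < eps) ->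
  exists l, forall eps : R, 0 < eps -> exists N, forall i, (N <= i)%N ->
     pdot (s i - l) (s i - l) < eps.
Proof.
move=> hs.
have /choice[l hl] (k : 'I_n) : exists l, forall eps : R, 0 < eps ->
    exists N, forall i, (N <= i)%N -> hrdot (s i k - l) (s i k - l) < eps.
  apply: hrdot_complete => eps /hs[N hN]; exists N => i j hi hj.
  exact: le_lt_trans (pdot_ge (s i - s j) k) (hN _ _ hi hj).
exists l => eps e0.
(* Dividing by [n.+1] makes the final inequality strict and covers [n = 0]. *)
have d0 : 0 < eps / n.+1%:R by rewrite divr_gt0.
have /choice[N hN] k := hl k _ d0.
exists (\max_k N k) => i hi.
apply: le_lt_trans (_ : \sum_(k < n) eps / n.+1%:R < _).
  by apply: ler_sum => k _; apply/ltW/hN/(leq_trans (leq_bigmax k) hi).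
rewrite sumr_const card_ord -[_ *+ n]mulr_natr -mulrA -[ltRHS]mulr1 ltr_pM2l//.
by rewrite mulrC ltr_pdivrMr ?ltr0n// mul1r ltr_nat.
Qed.

Definition hilbert_pow : inner_space R :=
  InnerSpace pdotDl pdotZl pdotC pdot_ge0 pdot_eq0 pdot_complete.

End HilbertPower.

Section Derivation.
Variables (R : realType) (H : hilbert R) (M : vN_algebra H).
Variables (tau : elt M -> R[i]) (tau_tr : faithful_normal_tracial_state tau).
Variables (S : standard_form tau) (K : hs_space S).
Implicit Types (x y q : elt M) (k : K).
Local Notation e := (rank_one_hat K).
Local Notation I := (hilbert_inner K).

Lemma hrdot_unit : hrdot e e = 1.
Proof.
have := right_trace_pure K 1 1.
by rewrite (state1 tau_tr) mulr1 /right_trace right_rep1 /hrdot => ->.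
Qed.

(** Taken through [right_rep], so that products of these maps and their adjoints are images of
    tensors, to which [right_traceC] applies. *)
Definition hs_deriv x : operator K := right_rep K (commutator_tensor x).

Lemma hs_derivE x : hs_deriv x = sandwich K 1 (ract S x) - sandwich K (ract S x) 1.
Proof.
rewrite /hs_deriv /commutator_tensor -scaleN1r addrC right_rep_linear scaleN1r addrC.
by rewrite !right_rep_pure ract1.
Qed.

Lemma comm_sigmaE k x v : comm_sigma k x v = hs_op (hs_deriv x k) v.
Proof.
by rewrite hs_derivE opBE hs_opB opBE !sandwichE mul1r mulr1.
Qed.

Lemma adjoint_deriv x : adjoint (hs_deriv x) = hs_deriv (star x).
Proof.
apply/esym/adjoint_uniq => k l; rewrite !hs_derivE !opBE hdotBr.
rewrite -[sandwich K 1 _ k - _]addrC hdotDl -[- sandwich _ _ _ _]scaleN1r hdotZl mulN1r.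
rewrite addrC !adjointP !adjoint_sandwich !adjoint1 !adjoint_ract.
by [].
Qed.

Variables (n : nat) (X : 'I_n -> elt M).
Local Notation Kn := (hilbert_pow K n).

(** The map d of the overview; [cobdry] is its adjoint, with [star (X j)] in place of [X j]. *)
Definition bdry (T : Kn) : I := \sum_j hs_deriv (X j) (T j).
Definition cobdry (k : I) : Kn := fun j => hs_deriv (star (X j)) k.

Lemma bdryB T U : bdry (T - U) = bdry T - bdry U.
Proof.
rewrite /bdry -sumrB; apply: eq_bigr => j _; exact: operatorB.
Qed.
Lemma bdryZ (a : R) T : bdry (a%:C *: T) = a%:C *: bdry T.
Proof.
by rewrite /bdry scaler_sumr; apply: eq_bigr => j _; exact: operatorZ.
Qed.
Lemma cobdryB k l : cobdry (k - l) = cobdry k - cobdry l.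
Proof. by apply/funext => j; exact: operatorB. Qed.
Lemma cobdryZ (a : R) k : cobdry (a%:C *: k) = a%:C *: cobdry k.
Proof. by apply/funext => j; exact: operatorZ. Qed.
Lemma bdry_adj T k : rdot (bdry T) k = rdot T (cobdry k).
Proof.
rewrite /= /bdry /pdot /hrdot.
rewrite (big_morph (fun l => hdot l k) (fun l l' => hdotDl l l' k) (hdot0l k)) Re_sum.
by apply: eq_bigr => j _; rewrite adjointP adjoint_deriv.
Qed.
Lemma cobdry_adj (k : I) T : rdot (cobdry k) T = rdot k (bdry T).
Proof. by rewrite rdotC -bdry_adj rdotC. Qed.

Lemma cobdry_bound : exists2 C : R, 0 < C & forall k : I, nsq (cobdry k) <= C * nsq k.
Proof.
have /choice[c hc] (j : 'I_n) : exists c : R, 0 < c /\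
    forall k : K, hrdot (hs_deriv (star (X j)) k) (hs_deriv (star (X j)) k) <= c * hrdot k k.
  by have [c c0 hc] := operator_bound (hs_deriv (star (X j))); exists c.
(* The 1 keeps the constant positive when [n = 0]. *)
exists (1 + \sum_j c j) => [|k].
  by rewrite ltr_pwDl// sumr_ge0// => j _; exact/ltW/(hc j).1.
rewrite mulrDl mul1r mulr_suml; apply: le_trans (_ : \sum_j c j * nsq k <= _).
  by apply: ler_sum => j _; exact: (hc j).2.
by rewrite lerDr; exact: rdot_ge0.
Qed.

Definition laplacian : enveloping M :=
  \sum_j commutator_tensor (X j) * commutator_tensor (star (X j)).

Lemma right_rep_sum (s : seq 'I_n) (F : 'I_n -> enveloping M) k :
  right_rep K (\sum_(j <- s) F j) k = \sum_(j <- s) right_rep K (F j) k.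
Proof.
elim: s => [|j s IH]; last by rewrite !big_cons right_repD opDE IH.
by rewrite !big_nil right_rep0.
Qed.

Lemma right_rep_laplacian k : right_rep K laplacian k = bdry (cobdry k).
Proof.
by rewrite right_rep_sum; apply: eq_bigr => j _; rewrite right_repM.
Qed.

Variable C : R.
Hypotheses (C0 : 0 < C) (cobdryC : forall k : I, nsq (cobdry k) <= C * nsq k).
Local Notation damp1 := (damp (V := I) (W := Kn) cobdry bdry C).
Local Notation dampn := (damp (V := Kn) (W := I) bdry cobdry C).

(* With [L = laplacian], [1 - (1 - L / C)^m = damp_sum m * L / C]. *)
Fixpoint damp_sum m : enveloping M :=
  if m is m'.+1 then 1 + (damp_sum m' - (C^-1)%:C *: (laplacian * damp_sum m'))
  else 0.

Lemma right_rep_damp_sumS m k : right_rep K (damp_sum m.+1) k =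
  k + damp1 (right_rep K (damp_sum m) k).
Proof.
rewrite /= !right_repD right_repN right_repZ right_repM right_rep1.
by rewrite /damp -right_rep_laplacian.
Qed.

Lemma iter_damp1 m k : iter m damp1 k =
  k - (C^-1)%:C *: right_rep K (damp_sum m) (right_rep K laplacian k).
Proof.
have dB := @dampB _ I Kn cobdry bdry C cobdryB bdryB.
elim: m => [|m IH]; first by rewrite /= right_rep0 scaler0 subr0.
rewrite iterS IH dB right_rep_damp_sumS [in RHS]scalerDr [in RHS]opprD [in RHS]addrA.
congr (_ - _); first by rewrite right_rep_laplacian.
rewrite /damp scalerBr cobdryZ bdryZ.
by [].
Qed.

(** Putting [d^*] and [d] around a power of [d d^*] gives the next power of [d^* d], so the
    geometric sum formed on HS also serves on HS^n. *)
Lemma iter_dampn m T : iter m dampn T =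
  T - (C^-1)%:C *: cobdry (right_rep K (damp_sum m) (bdry T)).
Proof.
have dB := @dampB _ Kn I bdry cobdry C bdryB cobdryB.
elim: m => [|m IH].
  rewrite /= right_rep0 -[X in cobdry X]/(0 : K).
  have -> : cobdry 0 = 0 by rewrite -(subrr (0 : K)) cobdryB subrr.
  by rewrite scaler0 subr0.
rewrite iterS IH dB right_rep_damp_sumS.
have cD k l : cobdry (k + l) = cobdry k + cobdry l.
  by apply/funext => j; exact: operatorD.
rewrite cD [in RHS]scalerDr [in RHS]opprD [in RHS]addrA; congr (_ - _).
by rewrite /damp cobdryB cobdryZ bdryZ scalerBr cobdryZ.
Qed.

Lemma hrdot_hs_unit T i : rdot T (hs_unit K i : Kn) = hrdot (T i) e.
Proof.
rewrite /= /pdot (bigD1 i)//= /hs_unit eqxx big1 ?addr0// => j /negbTE ->.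
by rewrite /hrdot hdot0r.
Qed.

Lemma bdry_hs_unit i : bdry (hs_unit K i) = hs_deriv (X i) e.
Proof.
rewrite /bdry (bigD1 i)//= /hs_unit eqxx big1 ?addr0// => j /negbTE ->.
exact: operator0.
Qed.

(* By [damp_sum], both sides reduce to [Tr (cobdry g bdry) = Tr (g bdry cobdry)]. *)
Lemma trace_iter_damp m :
  \sum_i rdot (iter m dampn (hs_unit K i)) (hs_unit K i : Kn) =
  n%:R - 1 + hrdot (iter m damp1 e) e.
Proof.
rewrite iter_damp1 hrdotDl hrdotNl hrdotZl hrdot_unit addrA subrK.
under eq_bigr do rewrite iter_dampn bdry_hs_unit rdotDl rdotNl rdotZl !hrdot_hs_unit
  {1}/hs_unit eqxx hrdot_unit.
rewrite sumrB sumr_const card_ord -mulr_sumr; congr (_ - _ * _).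
rewrite -opME -right_repM /laplacian mulr_sumr right_rep_sum /hrdot.
rewrite (big_morph (fun l => hdot l e) (fun l l' => hdotDl l l' e) (hdot0l e)) Re_sum.
apply: eq_bigr => i _; congr complex.Re.
(* Grouped so that the trace property carries the factor of [star (X i)] to the end, next to that of
   [X i] as in [laplacian]. *)
rewrite -[LHS]/(hdot ((hs_deriv (star (X i)) * (right_rep K (damp_sum m) * hs_deriv (X i)) : operator K) e) e).
rewrite /hs_deriv -!right_repM -/(right_trace _ _) right_traceC//.
by rewrite -mulrA.
Qed.

End Derivation.

(** * Rank-nullity for the boundary map, in terms of traces *)

Section KernelDimension.
Variables (R : realType) (H : hilbert R) (M : vN_algebra H).
Variables (tau : elt M -> R[i]) (tau_tr : faithful_normal_tracial_state tau).
Variables (S : standard_form tau) (K : hs_space S).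
Implicit Types (x y q : elt M) (k : K).
Local Notation e := (rank_one_hat K).
Local Notation I := (hilbert_inner K).
Variables (n : nat) (X : 'I_n -> elt M).
Local Notation Kn := (hilbert_pow K n).

Lemma tends_cvg (V : inner_space R) (u : nat -> V) l w : tends u l ->
  (fun m => rdot (u m) w) @ \oo --> rdot l w.
Proof.
move=> /(tends_rdot w) h; apply/cvgrPdist_lt => eps /h[N hN].
by exists N => // m /= /hN; rewrite distrC.
Qed.

(** [p i] and [k0] are the projections of the unit vectors onto the two kernels, so the last clause
    counts dimensions. It is the limit of [trace_iter_damp] along even [m], where the difference of
    the two traces is constant. *)
Lemma bdry_kernel_dim : exists (p : 'I_n -> Kn) (k0 : I),
  [/\ forall i, bdry X (p i) = 0,
      forall i w, bdry X w = 0 -> rdot ((hs_unit K i : Kn) - p i) w = 0,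
      cobdry X k0 = 0, forall w : I, cobdry X w = 0 -> rdot (e - k0 : I) w = 0 &
      \sum_i rdot (p i) (hs_unit K i : Kn) = n%:R - 1 + hrdot k0 e].
Proof.
have [C C0 hC] := cobdry_bound K X.
have hC' : forall T : Kn, nsq (bdry X T : I) <= C * nsq T.
  apply: (@adjoint_bound _ Kn I (bdry X) (cobdry X) C) => // T k; exact: bdry_adj.
have [k0 [t0 b0 o0]] := @damp_limit _ I Kn (cobdry X) (bdry X) C
  (cobdryB X) (bdryB X) (cobdry_adj X) C0 hC' e.
have /choice[p hp] (i : 'I_n) := @damp_limit _ Kn I (bdry X) (cobdry X) C
  (bdryB X) (cobdryB X) (bdry_adj X) C0 hC (hs_unit K i).
exists p, k0; split=> //.
- by move=> i; have [] := hp i.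
- by move=> i; have [_ _ h] := hp i.
have c1 : (fun m => \sum_i rdot (iter m.*2 (damp (V := Kn) (W := I) (bdry X) (cobdry X) C)
    (hs_unit K i)) (hs_unit K i : Kn)) @ \oo --> \sum_i rdot (p i) (hs_unit K i : Kn).
  by apply: cvg_big => [|i _]; [exact: add_continuous|apply: tends_cvg; have [] := hp i].
have c2 := tends_cvg (w := (e : I)) t0.
have := cvgB c1 c2; set f := (X in X @ _ --> _).
have -> : f = cst (n%:R - 1).
  apply/funext => m.
  have h := trace_iter_damp tau_tr K X C m.*2.
  exact: (canLR (addrK _) h).
move=> /(_ _)/cvg_lim => /(_ (@Rhausdorff R)); rewrite lim_cst// => ->.
by rewrite subrK.
Qed.
End KernelDimension.

(** * Finite-rank operators *)

Section FiniteRank.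
Variables (R : realType) (H : hilbert R).
Implicit Types (T U : operator H).

Lemma finite_rank0 : finite_rank (0 : operator H).
Proof.
by exists 0%N, (fun=> 0) => x; exists (fun=> 0); rewrite big_ord0.
Qed.
Lemma finite_rankD T U : finite_rank T -> finite_rank U -> finite_rank (T + U).
Proof.
move=> [n [v hv]] [m [w hw]].
exists (n + m)%N, (fun i => match fintype.split i with inl j => v j | inr j => w j end) => x.
have [c hc] := hv x; have [d hd] := hw x.
exists (fun i => match fintype.split i with inl j => c j | inr j => d j end).
rewrite opDE hc hd big_split_ord /=; congr (_ + _); apply: eq_bigr => i _.
- by rewrite (unsplitK (inl i)).
- by rewrite (unsplitK (inr i)).
Qed.
Lemma finite_rankM T U (V : operator H) : finite_rank U -> finite_rank (T * U * V).
Proof.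
move=> [n [v hv]]; exists n, (fun i => T (v i)) => x.
have [c hc] := hv (V x); exists c.
by rewrite !opME hc operator_sum; apply: eq_bigr => i _; rewrite operatorZ.
Qed.
Lemma finite_rankZ a T : finite_rank T -> finite_rank (a *: T).
Proof.
move=> [n [v hv]]; exists n, v => x; have [c hc] := hv x.
exists (fun i => a * c i); rewrite opZE hc scaler_sumr.
by apply: eq_bigr => i _; rewrite scalerA.
Qed.
Lemma finite_rank1 (x y : H) : finite_rank (rank1 x y).
Proof.
by exists 1%N, (fun=> x) => v; exists (fun=> hdot v y); rewrite big_ord1.
Qed.
End FiniteRank.

Section FiniteRankDense.
Variables (R : realType) (H : hilbert R) (K : hs_space H).
Implicit Types (k l : K).

Definition fr k := finite_rank (hs_op k).

Lemma fr0 : fr 0. Proof. by rewrite /fr hs_op0; exact: finite_rank0. Qed.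
Lemma frD k l : fr k -> fr l -> fr (k + l).
Proof. by rewrite /fr hs_opD; exact: finite_rankD. Qed.
Lemma frZ a k : fr k -> fr (a *: k).
Proof. by rewrite /fr hs_opZ; exact: finite_rankZ. Qed.
Lemma frB k l : fr k -> fr l -> fr (k - l).
Proof. by move=> fk fl; rewrite -scaleN1r; apply: frD => //; exact: frZ. Qed.
Lemma fr_sum (J : Type) (s : seq J) (F : J -> K) :
  (forall j, fr (F j)) -> fr (\sum_(j <- s) F j).
Proof.
move=> hF; elim: s => [|j s IH]; first by rewrite big_nil; exact: fr0.
by rewrite big_cons; exact: frD.
Qed.
Lemma fr_sandwich S T k : fr k -> fr (sandwich K S T k).
Proof. by rewrite /fr sandwichE; exact: finite_rankM. Qed.

Lemma hrdotD_le k l : hrdot (k + l) (k + l) <= 2 * hrdot k k + 2 * hrdot l l.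
Proof.
have := hrdot_ge0 (k - l); rewrite !hrdotE (hrdotC l k); lra.
Qed.
Lemma hrdotZ_sq a k : hrdot (a *: k) (a *: k) = complex.Re `|a| ^+ 2 * hrdot k k.
Proof.
rewrite -[hrdot (a *: k) _]sqr_sqrtr ?hrdot_ge0//.
rewrite -[hrdot k k]sqr_sqrtr ?hrdot_ge0// -exprMn.
by congr (_ ^+ 2); exact: nrmZ.
Qed.

(** The difference between [k] and its projection to the closure of the finite-rank operators is
    orthogonal to every rank-one operator, hence zero. *)
Lemma fr_dense k (eps : R) : 0 < eps -> exists2 a, fr a & hrdot (k - a) (k - a) < eps.
Proof.
move: eps; pose E := [set l : K | forall eps : R, 0 < eps ->
  exists2 a, fr a & @nrm _ (hilbert_inner K) (a - l) < eps].
have sE : real_subspace (E : set (hilbert_inner K)).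
  split=> [eps e0|a x y Ex Ey eps e0].
    by exists 0; [exact: fr0|rewrite subrr /nrm /nsq rdot0r sqrtr0].
  have n0 : 0 < complex.Re `|a%:C| + 1 by rewrite ltr_wpDl// Re_ge0.
  have [|u fu hu] := Ex (eps / 2 / (complex.Re `|a%:C| + 1)); first by rewrite !divr_gt0.
  have [|v fv hv] := Ey (eps / 2); first by rewrite divr_gt0.
  exists (a%:C *: u + v); first by apply: frD => //; exact: frZ.
  rewrite opprD addrACA -scalerBr; apply: le_lt_trans (@nrmD _ (hilbert_inner K) _ _) _.
  have : @nrm _ (hilbert_inner K) (a%:C *: (u - x)) <= eps / 2.
    rewrite nrmZ; move: hu; rewrite ltr_pdivlMr// => /ltW; apply: le_trans.
    by rewrite mulrC ler_wpM2l ?nrm_ge0//; lra.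
  lra.
have cE : nrm_closed (E : set (hilbert_inner K)).
  move=> l hl eps e0.
  have [|x Ex hx] := hl (eps / 2); first by rewrite divr_gt0.
  have [|a fa ha] := Ex (eps / 2); first by rewrite divr_gt0.
  exists a => //; apply: le_lt_trans (@nrmB _ (hilbert_inner K) _ x _) _; lra.
have [u Eu hu] := projection_exists (k : hilbert_inner K) sE cE.
have -> : k = u; last first.
  move=> eps e0; have [|a fa ha] := Eu (Num.sqrt eps); first by rewrite sqrtr_gt0.
  exists a => //; move: ha.
  rewrite -nrmN opprB /nrm ltr_sqrt//.
apply: hdot_rank1_eq => x y; apply: hdotE_hrdot => a; rewrite hs_rank1Z.
apply/eqP; rewrite -subr_eq0 -hrdotNl -hrdotDl; apply/eqP; apply: hu => eps e0.
exists (hs_rank1 K (a *: x) y); last by rewrite subrr /nrm /nsq rdot0r sqrtr0.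
by rewrite /fr hs_op_rank1; exact: finite_rank1.
Qed.
End FiniteRankDense.

(** * Cocycles and dimensions *)

Section Cocycles.
Variables (R : realType) (H : hilbert R) (M : vN_algebra H).
Variables (tau : elt M -> R[i]) (tau_tr : faithful_normal_tracial_state tau).
Variables (S : standard_form tau) (K : hs_space S).
Implicit Types (x y q : elt M) (k : K).
Local Notation e := (rank_one_hat K).
Local Notation I := (hilbert_inner K).

Lemma cocyclesE n m (X : 'I_n -> elt M) (Y : 'I_m -> elt M) T U :
  cocycles X Y (T, U) <-> [/\ forall j, fr (T j), forall j, fr (U j) &
    bdry X T + bdry Y U = 0 :> K].
Proof.
have cE p (Z : 'I_p -> elt M) (W : 'I_p -> K) v :
    \sum_j comm_sigma (W j) (Z j) v = hs_op (bdry Z W) v.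
  by rewrite hs_op_sum op_sumE; apply: eq_bigr => j _; rewrite comm_sigmaE.
split=> [[hT hU hc]|[hT hU hc]]; split=> //.
- apply: hs_op_eq; apply: operator_eq => v.
  by rewrite hs_opD opDE -!cE hs_op0; exact: hc.
- by move=> v; rewrite !cE -opDE -hs_opD hc hs_op0.
Qed.

Section Closure.
Variables (n m : nat) (X : 'I_n -> elt M) (Y : 'I_m -> elt M).
Local Notation Kn := (hilbert_pow K n).

Definition kernel_closure : set ('I_n -> K) :=
  [set T | hs_closure (cocycles X Y) (T, fun=> 0)].

Lemma kernel_closureP T : kernel_closure T <-> forall eps : R, 0 < eps ->
  exists A B, [/\ cocycles X Y (A, B),
    forall j, hrdot (T j - A j) (T j - A j) < eps &
    forall j, hrdot (B j) (B j) < eps].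
Proof.
split=> [hT eps e0|hT eps e0].
  have se : 0 < Num.sqrt eps by rewrite sqrtr_gt0.
  have [|[A B] cAB /= [hA hB]] := hT (Num.sqrt eps)%:C; first by rewrite ltcR.
  exists A, B; split=> // j.
    by have := hA j; rewrite norm_lt// sqr_sqrtr// ltW.
  by have := hB j; rewrite sub0r normrN norm_lt// sqr_sqrtr// ltW.
have e0' := gt0_Re e0.
have [|A [B [cAB hA hB]]] := hT (complex.Re eps ^+ 2); first by rewrite exprn_gt0.
exists (A, B) => //=; rewrite (ge0_Re (ltW e0)); split=> j.
  by rewrite norm_lt.
by rewrite sub0r normrN norm_lt.
Qed.

Lemma bdryD p (Z : 'I_p -> elt M) T U : bdry (K := K) Z (T + U) = bdry Z T + bdry Z U.
Proof.
by rewrite /bdry -big_split; apply: eq_bigr => j _; exact: operatorD.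
Qed.
Lemma bdry0 p (Z : 'I_p -> elt M) : bdry (K := K) Z 0 = 0.
Proof. by have := bdryB (K := K) Z 0 0; rewrite !subrr. Qed.
Lemma bdryZc p (Z : 'I_p -> elt M) (a : R[i]) T : bdry (K := K) Z (a *: T) = a *: bdry Z T.
Proof.
by rewrite /bdry scaler_sumr; apply: eq_bigr => j _; exact: operatorZ.
Qed.
Lemma bdry_bound p (Z : 'I_p -> elt M) : exists2 C : R, 0 < C &
  forall T, hrdot (bdry (K := K) Z T) (bdry Z T) <= C * pdot T T.
Proof.
have [C C0 hC] := cobdry_bound K Z; exists C => // T.
by apply: (@adjoint_bound _ (hilbert_pow K p) I (bdry Z) (cobdry Z) C) => // U k; exact: bdry_adj.
Qed.

Lemma pdot_lt p (T : 'I_p -> K) (d : R) : 0 < d ->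
  (forall j, hrdot (T j) (T j) < d) -> pdot T T <= p%:R * d.
Proof.
move=> d0 hT; apply: le_trans (_ : \sum_(j < p) d <= _).
  by apply: ler_sum => j _; exact/ltW.
by rewrite sumr_const card_ord mulr_natl.
Qed.

(** Along approximating cocycles [bdry X A = - bdry Y B] tends to 0 with [B], while it tends to
    [bdry X T] by continuity. *)
Lemma kernel_closure_bdry T : kernel_closure T -> bdry X T = 0.
Proof.
move=> /kernel_closureP hT.
have [C C0 hC] := bdry_bound X; have [D D0 hD] := bdry_bound Y.
apply/hrdot_eq0/eqP; rewrite eq_le hrdot_ge0 andbT.
apply/ler_addgt0Pr => eps e0; rewrite add0r.
(* The first two terms collect the errors of the [n] and of the [m] coordinates, the 2 coming from
   [hrdotD_le]; the 1 makes [c] positive. *)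
pose c := 2 * C * n%:R + 2 * D * m%:R + 1.
have c0 : 0 < c by rewrite ltr_wpDl// addr_ge0// mulr_ge0// mulr_ge0// ltW.
have d0 : 0 < eps / c by rewrite divr_gt0.
have [A [B [/cocyclesE[_ _ cAB] hA hB]]] := hT _ d0.
have -> : bdry X T = bdry X (T - A) - bdry Y B.
  by rewrite bdryB -addrA -opprD cAB subr0.
apply: le_trans (hrdotD_le _ _) _.
have -> : hrdot (- bdry (K := K) Y B) (- bdry Y B) = hrdot (bdry (K := K) Y B) (bdry Y B).
  by rewrite hrdotNl hrdotNr opprK.
have h1 := le_trans (hC _) (ler_wpM2l (ltW C0) (pdot_lt d0 hA)).
have h2 := le_trans (hD _) (ler_wpM2l (ltW D0) (pdot_lt d0 hB)).
have -> : eps = c * (eps / c) by rewrite mulrCA mulfV ?mulr1// gt_eqF.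
rewrite /c; move: h1 h2 d0; set d := eps / c; move: d => d h1 h2 d0.
lra.
Qed.

Lemma kernel_closureD T U : kernel_closure T -> kernel_closure U -> kernel_closure (T + U).
Proof.
move=> /kernel_closureP hT /kernel_closureP hU; apply/kernel_closureP => eps e0.
have e4 : 0 < eps / 4 by rewrite divr_gt0.
have [A [B [/cocyclesE[fA fB cAB] hA hB]]] := hT _ e4.
have [A' [B' [/cocyclesE[fA' fB' cAB'] hA' hB']]] := hU _ e4.
exists (A + A'), (B + B'); split=> [|j|j].
- apply/cocyclesE; split=> [j|j|]; [exact: frD|exact: frD|].
  by rewrite !bdryD addrACA cAB cAB' addr0.
- have -> : (T + U) j - (A + A') j = (T j - A j) + (U j - A' j).
    by rewrite -[(T + U) j]/(T j + U j) -[(A + A') j]/(A j + A' j) opprD addrACA.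
  apply: le_lt_trans (hrdotD_le _ _) _; have := hA j; have := hA' j; lra.
- apply: le_lt_trans (hrdotD_le _ _) _; have := hB j; have := hB' j; lra.
Qed.

Lemma kernel_closureZ (a : R[i]) T : kernel_closure T -> kernel_closure (a *: T).
Proof.
move=> /kernel_closureP hT; apply/kernel_closureP => eps e0.
pose c := complex.Re `|a| ^+ 2 + 1.
have c0 : 0 < c by rewrite ltr_wpDl ?sqr_ge0.
have [|A [B [/cocyclesE[fA fB cAB] hA hB]]] := hT (eps / c); first exact: divr_gt0.
have small k : hrdot k k < eps / c -> hrdot (a *: k) (a *: k) < eps.
  rewrite ltr_pdivlMr// hrdotZ_sq; apply: le_lt_trans.
  by rewrite mulrC ler_wpM2l ?hrdot_ge0// lerDl.
exists (a *: A), (a *: B); split=> [|j|j].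
- apply/cocyclesE; split=> [j|j|]; [exact: frZ|exact: frZ|].
  by rewrite !bdryZc -scalerDr cAB scaler0.
- have -> : (a *: T) j - (a *: A) j = a *: (T j - A j) by rewrite scalerBr.
  exact/small.
- exact/small.
Qed.

Lemma kernel_closure_subspace : real_subspace (kernel_closure : set Kn).
Proof.
split=> [|a x y hx hy]; last by apply: kernel_closureD => //; exact: kernel_closureZ.
apply/kernel_closureP => eps e0; exists 0, 0; split=> [|j|j].
- by apply/cocyclesE; split=> [j|j|]; [exact: fr0|exact: fr0|];
    rewrite !bdry0 addr0.
- by rewrite subrr /hrdot hdot0l.
- by rewrite /hrdot hdot0l.
Qed.

Lemma kernel_closure_closed : nrm_closed (kernel_closure : set Kn).
Proof.
move=> l hl; apply/kernel_closureP => eps e0.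
have e4 : 0 < eps / 4 by rewrite divr_gt0.
have [|x /kernel_closureP hx lx] := hl (Num.sqrt (eps / 4)); first by rewrite sqrtr_gt0.
have [A [B [cAB hA hB]]] := hx _ e4.
exists A, B; split=> // j; last by apply: lt_trans (hB j) _; lra.
have -> : l j - A j = (l j - x j) + (x j - A j) by rewrite addrA subrK.
apply: le_lt_trans (hrdotD_le _ _) _.
have h : hrdot (l j - x j) (l j - x j) < eps / 4.
  apply: le_lt_trans (pdot_ge (l - x) j) _.
  by move: lx; rewrite -nrmN opprB /nrm ltr_sqrt.
have := hA j; lra.
Qed.
End Closure.

Section Dimension.
Variable n : nat.
Local Notation Kn := (hilbert_pow K n).
Local Notation u i := (hs_unit K i : Kn).

Lemma Re_hs_dot (T U : Kn) : complex.Re (hs_dot T U) = rdot T U.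
Proof. by rewrite /hs_dot Re_sum. Qed.

Lemma hs_dimE (E : set ('I_n -> K)) : hs_dim E = \sum_i rdot (hs_proj E (u i) : Kn) (u i).
Proof. by rewrite /hs_dim Re_sum; apply: eq_bigr => i _; exact: Re_hs_dot. Qed.

(** [p i] projects [u i] to the larger set. If [v] is the projection to [E], then
    [rdot (p i) v = nsq v], and Cauchy-Schwarz gives [nsq v <= nsq (p i)]. *)
Lemma hs_dim_le (E Z : set ('I_n -> K)) (p : 'I_n -> Kn) : E `<=` Z ->
  (forall i, Z (p i)) -> (forall i w, Z w -> rdot (u i - p i) w = 0) ->
  hs_dim E <= \sum_i rdot (p i) (u i).
Proof.
move=> EZ Zp hp; rewrite hs_dimE; apply: ler_sum => i _.
rewrite (@projection_nsq _ Kn _ _ _ (Zp i) (hp i)) /hs_proj.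
(* Here [E] is arbitrary: where no projection exists, [hs_proj] has its default value 0 and the term
   is 0. *)
case: xgetP => [v _ [Ev hv]|_]; last first.
  rewrite -[X in rdot X _]/(0 : Kn) rdot0l; exact: rdot_ge0.
have hv' w : E w -> rdot (u i - v) w = 0.
  by move=> Ew; rewrite -Re_hs_dot hv.
rewrite (@projection_nsq _ Kn _ _ _ Ev hv').
have v0 := rdot_ge0 (v : Kn).
have [->|vn] := eqVneq (nsq (v : Kn)) 0; first exact: rdot_ge0.
have vp : 0 < nsq (v : Kn) by rewrite lt_neqAle eq_sym vn.
have e1 : rdot (p i) v = nsq (v : Kn).
  have := hp i v (EZ _ Ev); rewrite rdotDl rdotNl -(@projection_nsq _ Kn _ _ _ Ev hv') (rdotC (u i)).
  lra.
have := rdot_CS (p i) (v : Kn); rewrite e1 expr2 ler_pM2r//.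
Qed.

Lemma hs_proj_spec (E : set ('I_n -> K)) T : real_subspace (E : set Kn) ->
  nrm_closed (E : set Kn) -> (forall (a : R[i]) v, E v -> E (a *: v)) ->
  E (hs_proj E T) /\ forall w, E w -> rdot (T - hs_proj E T : Kn) w = 0.
Proof.
move=> sE cE zE; have [v Ev hv] := projection_exists (T : Kn) sE cE.
rewrite /hs_proj; case: xgetP => [w _ [Ew hw]|/(_ v) h].
  by split=> // z Ez; rewrite -Re_hs_dot hw.
exfalso; apply: h; split=> // w Ew.
(* [hs_proj] asks for complex orthogonality; testing against ['i *: w] takes care of the imaginary
   part. *)
have hz : hs_dot (T - v) ('i *: w) = 'i^*%R * hs_dot (T - v) w.
  by rewrite /hs_dot mulr_sumr; apply: eq_bigr => j _; exact: hdotZr.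
have h1 : complex.Re (hs_dot (T - v) w) = 0 by rewrite Re_hs_dot hv.
have h2 : complex.Re (hs_dot (T - v) ('i *: w)) = 0.
  by rewrite Re_hs_dot hv//; exact: zE.
move: h2; rewrite hz; case: (hs_dot _ _) h1 => a b /= -> h2.
by congr Complex; move: h2; rewrite mul0r sub0r mulN1r opprK.
Qed.

(** The squared norm of the projection of a unit vector is 1 minus its squared distance to [E], and
    any [w i] in [E] bounds this distance. *)
Lemma hs_dim_ge (E : set ('I_n -> K)) (w : 'I_n -> Kn) : real_subspace (E : set Kn) ->
  nrm_closed (E : set Kn) -> (forall (a : R[i]) v, E v -> E (a *: v)) ->
  (forall i, E (w i)) -> n%:R - \sum_i nsq (u i - w i) <= hs_dim E.
Proof.
move=> sE cE zE Ew; rewrite hs_dimE.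
have -> : n%:R = \sum_(i < n) nsq (u i).
  transitivity (\sum_(i < n) (1 : R)); first by rewrite sumr_const card_ord.
  by apply: eq_bigr => i _; rewrite /nsq hrdot_hs_unit /hs_unit eqxx hrdot_unit.
rewrite -sumrB; apply: ler_sum => i _.
have [Ev hv] := hs_proj_spec (u i) sE cE zE; move: Ev hv; set v : Kn := hs_proj _ _.
move=> Ev hv; rewrite (@projection_nsq _ Kn _ _ _ Ev hv).
have Ed : E (v - w i).
  rewrite addrC -scaleN1r -(rmorphN1 (real_complex R)); exact: sE.2.
have := hv _ Ed; have := hv _ Ev; have := rdot_ge0 (v - w i).
rewrite /nsq !rdotE (rdotC (w i) (u i)) (rdotC (w i) v); lra.
Qed.
End Dimension.

End Cocycles.

(** * Lower and upper bounds for Delta(F : F') *)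

Section DeltaBounds.
Variables (R : realType) (H : hilbert R) (M : vN_algebra H).
Variables (tau : elt M -> R[i]) (tau_tr : faithful_normal_tracial_state tau).
Variables (S : standard_form tau) (K : hs_space S).
Implicit Types (x y q : elt M) (k : K).
Local Notation e := (rank_one_hat K).
Local Notation I := (hilbert_inner K).

Lemma hs_op_deriv x k : hs_op (hs_deriv K x k) = hs_op k * ract S x - ract S x * hs_op k.
Proof. by rewrite hs_derivE opBE hs_opB !sandwichE mul1r mulr1. Qed.

Lemma bdry_block n (X : 'I_n -> elt M) l (T : 'I_n -> K) :
  bdry X (fun j => block K l (T j)) = block K l (bdry X T).
Proof.
rewrite /bdry operator_sum; apply: eq_bigr => j _.
by rewrite -!opME /hs_deriv block_right_rep.
Qed.

Section Relative.
Variables (eps : R) (l : seq (elt M)).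
Hypothesis hl : cpartition tau eps 1 l.
Variables (n : nat) (X : 'I_n -> elt M).
Local Notation Kn := (hilbert_pow K n).
Local Notation u i := (hs_unit K i : Kn).

Lemma hrdot_block k k' : hrdot (block K l k) k' = hrdot k (block K l k').
Proof. by rewrite /hrdot adjointP (block_adj K hl). Qed.

Lemma Delta_rel_ge m (Y : 'I_m -> elt M) : (forall q, q \in l -> range X q) ->
  1 - eps <= Delta_rel K X Y.
Proof.
move=> lX; have [p [k0 [bp op b0 o0 hp]]] := bdry_kernel_dim tau_tr K X.
have d := hs_dim_le (E := kernel_closure (K := K) X Y) (Z := [set T | bdry X T = 0])
  (@kernel_closure_bdry _ _ _ _ _ _ _ _ X Y) bp op.
have k0fix : block K l k0 = k0.
  apply: (block_fix hl) => q ql; have [j _ jq] := lX q ql.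
  have cq := part_cproj hl ql.
  (* [q] is self-adjoint and equals [X j], so this is coordinate [j] of [cobdry X k0]. *)
  have : hs_deriv K q k0 = 0.
    by have /(congr1 (fun f => f j)) := b0; rewrite /cobdry jq cproj_sa.
  move=> /(congr1 (@hs_op _ _ _)); rewrite hs_op_deriv hs_op0 ract_central; last by case: cq.
  by move=> /eqP; rewrite subr_eq0 => /eqP ->.
have n0 : hrdot k0 e = hrdot k0 k0.
  exact: (@projection_nsq _ I [set k | cobdry X k = 0] e k0 b0 o0).
(* |k0|^2 = <k0, P_1> = <k0, E P_1>, so Cauchy-Schwarz gives |k0|^4 <= eps |k0|^2. *)
have k0eps : hrdot k0 e <= eps.
  have c := @rdot_CS _ I k0 (block K l e).
  have : hrdot k0 k0 ^+ 2 <= hrdot k0 k0 * eps.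
    rewrite -{1}n0 -{1}k0fix hrdot_block; apply: le_trans c _.
    by rewrite ler_wpM2l ?hrdot_ge0//; exact: block_small.
  rewrite n0; have [->|kn] := eqVneq (hrdot k0 k0) 0.
    by move=> _; apply: le_trans (block_small tau_tr K hl); exact: hrdot_ge0.
  by rewrite expr2 ler_pM2l// lt_neqAle eq_sym kn hrdot_ge0.
rewrite /Delta_rel; move: d; rewrite /kernel_closure hp; lra.
Qed.

Variable lam : R.
Hypothesis lam0 : lam != 0.
(* The factor [lam] serves to make this family disjoint from a given one. *)
Definition scaled_part (j : 'I_(size l)) : elt M := lam%:C *: tnth (in_tuple l) j.
Local Notation Y := scaled_part.

(** For central [q], [k q, q^sigma] = k q - q k q, and the sum over the partition is k - E k. So E k
    - k is always a boundary for [Y], with a preimage depending boundedly on [k]. *)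
Lemma bdry_scaled k :
  bdry Y (fun j => (- lam^-1)%:C *: sandwich K 1 (lact S (tnth (in_tuple l) j)) k) =
  block K l k - k.
Proof.
apply: hs_op_eq; rewrite hs_opB hs_op_block hs_op_sum.
have [_ _ s1] := hl.
have hk : hs_op k = \sum_(q <- l) hs_op k * lact S q.
  by rewrite -mulr_sumr -lact_sum s1 lact1 mulr1.
rewrite {2}hk -sumrB [RHS]big_tnth; apply: eq_bigr => j _.
have qc : cproj (tnth (in_tuple l) j) by apply: (part_cproj hl); exact: mem_tnth.
rewrite hs_op_deriv /scaled_part ractZ ract_central; last by case: qc.
rewrite hs_opZ sandwichE mul1r.
rewrite !(op_scaleAl, op_scaleAr) !scalerA -!rmorphM.
rewrite mulNr mulVf// mulrN mulfV// rmorphN1 !scaleN1r -mulrA -lactM cproj_idem//.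
by rewrite opprK addrC mulrA.
Qed.

Lemma kernel_closure_block T : bdry X T = 0 ->
  kernel_closure X Y (T - (fun j => block K l (T j)) : Kn).
Proof.
move=> bT; apply/kernel_closureP => eps' e0.
have [C C0 hC] := bdry_bound K X.
have [D D0 hD] := operator_bound (1 - block K l).
pose Q j : operator K := (- lam^-1)%:C *: sandwich K 1 (lact S (tnth (in_tuple l) j)).
have /choice[c hc] j : exists c : R, 0 < c /\ forall k, hrdot (Q j k) (Q j k) <= c * hrdot k k.
  by have [c c0 hc] := operator_bound (Q j); exists c.
(* The first term bounds the errors in the coordinates of [X], the second those in the coordinates
   of [Y]; the 1 makes both estimates strict. *)
pose t := n%:R * D + n%:R * C * \sum_j c j + 1.
have sc0 : 0 <= \sum_j c j by apply: sumr_ge0 => j _; exact/ltW/(hc j).1.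
have t0 : 0 < t by rewrite ltr_wpDl// addr_ge0 ?mulr_ge0// ltW.
have [d d0 et] : exists2 d, 0 < d & eps' = t * d.
  by exists (eps' / t); [rewrite divr_gt0|rewrite mulrCA mulfV ?mulr1// gt_eqF].
have /choice[A hA] (j : 'I_n) : exists a : K, fr a /\ hrdot (T j - a) (T j - a) < d.
  by have [a fa ha] := fr_dense (T j) d0; exists a.
have pA : pdot (T - A) (T - A) <= n%:R * d.
  by apply: pdot_lt => // j; exact: (hA j).2.
(* The boundary of A - E A is d A - E d A, and [bdry_scaled] at d A cancels it. *)
exists (A - (fun j => block K l (A j))), (fun j => Q j (bdry X A)).
have frA j : fr (A j) := (hA j).1.
split=> [|j|j].
- apply/cocyclesE; split=> [j|j|].
  + apply: frB => //; rewrite /block op_sumE; apply: fr_sum => q.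
    exact: fr_sandwich.
  + apply: frZ; apply: fr_sandwich; apply: fr_sum => i.
    by rewrite hs_derivE opBE; apply: frB; exact: fr_sandwich.
  + rewrite bdryB bdry_block bdry_scaled.
    by rewrite addrA subrK subrr.
- have -> : (T - (fun j => block K l (T j)) : Kn) j -
      (A - (fun j => block K l (A j)) : 'I_n -> K) j = (1 - block K l : operator K) (T j - A j).
    have -> : (1 - block K l : operator K) (T j - A j) = T j - A j - block K l (T j - A j) by [].
    rewrite operatorB -[LHS]/(T j - block K l (T j) - (A j - block K l (A j))) !opprB.
    by rewrite addrACA [RHS]addrACA [- A j + _]addrC.
  apply: le_lt_trans (hD _) _.
  have h0 : hrdot (T j - A j) (T j - A j) <= n%:R * d := le_trans (pdot_ge (T - A) j) pA.
  apply: le_lt_trans (ler_wpM2l (ltW D0) h0) _; rewrite [ltRHS]et.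
  have : 0 <= n%:R * C * (\sum_j c j) * d by rewrite !mulr_ge0// ltW.
  by rewrite /t; move: d0; lra.
(* As [bdry X T = 0], the added coordinates depend only on the error [T - A], so they are small. *)
- have -> : Q j (bdry X A) = - Q j (bdry X (T - A)).
    by rewrite bdryB bT (operatorB (Q j)) operator0 sub0r opprK.
  rewrite hrdotNl hrdotNr opprK; apply: le_lt_trans ((hc j).2 _) _.
  have cj0 := ltW (hc j).1.
  apply: le_lt_trans (ler_wpM2l cj0 (le_trans (hC _) (ler_wpM2l (ltW C0) pA))) _.
  have : c j * (C * (n%:R * d)) <= (\sum_j c j) * (C * (n%:R * d)).
    apply: ler_wpM2r; first by rewrite !mulr_ge0// ltW.
    rewrite (bigD1 j)//= lerDl; apply: sumr_ge0 => i _; exact/ltW/(hc i).1.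
  move=> h; apply: le_lt_trans h _; rewrite [ltRHS]et.
  have : 0 <= n%:R * D * d by rewrite !mulr_ge0// ltW.
  by rewrite /t; move: d0; lra.
Qed.

(** In [hs_dim_ge] take w_i = p_i - E p_i. Since E preserves ker d, E p_i is orthogonal to u_i -
    p_i, so |u_i - w_i|^2 = |u_i - p_i|^2 + |E p_i|^2. The first terms add up to at most 1 by
    rank-nullity, and each second term is at most [eps]. *)
Lemma Delta_rel_le : Delta_rel K X Y <= 1 + n%:R * eps.
Proof.
have [p [k0 [bp op b0 o0 hp]]] := bdry_kernel_dim tau_tr K X.
pose bl (T : Kn) : Kn := fun j => block K l (T j).
have blC T U : rdot (bl T) U = rdot T (bl U).
  by apply: eq_bigr => j _; exact: hrdot_block.
have blI T : bl (bl T) = bl T.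
  by apply/funext => j; rewrite /bl -opME (block_idem K hl).
have bbl T : bdry X T = 0 -> bdry X (bl T) = 0.
  by move=> bT; rewrite /bl bdry_block bT operator0.
have d := @hs_dim_ge _ _ _ _ tau_tr _ K n (kernel_closure X Y) (fun i => p i - bl (p i))
  (kernel_closure_subspace K X Y) (@kernel_closure_closed _ _ _ _ _ _ _ _ X Y)
  (@kernel_closureZ _ _ _ _ _ _ _ _ X Y) (fun i => kernel_closure_block (bp i)).
have k0pos : 0 <= hrdot k0 e.
  have -> : hrdot k0 e = hrdot k0 k0 := @projection_nsq _ I [set k | cobdry X k = 0] e k0 b0 o0.
  exact: hrdot_ge0.
have hi i : nsq (u i - (p i - bl (p i))) <= 1 - rdot (p i) (u i) + eps.
  have o1 := op i _ (bp i); have o2 := op i _ (bbl _ (bp i)).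
  have uu : rdot (u i) (u i) = 1 by rewrite hrdot_hs_unit /hs_unit eqxx hrdot_unit.
  have bb : rdot (bl (p i)) (bl (p i)) = rdot (p i) (bl (p i)) by rewrite blC blI.
  have bu : nsq (bl (u i)) <= eps.
    apply: le_trans (block_small tau_tr K hl); rewrite /nsq /= /pdot (bigD1 i)//=.
    rewrite /bl /hs_unit eqxx big1 ?addr0// => j /negbTE ->.
    by rewrite operator0 /hrdot hdot0l.
  (* E p_i has the same product with p_i as with u_i, so |E p_i|^2 = <E p_i, E u_i> and |E p_i| <=
     |E u_i|. *)
  have bs : nsq (bl (p i)) <= eps.
    apply: le_trans bu.
    have c := @rdot_CS _ Kn (bl (p i)) (bl (u i)).
    have e1 : rdot (bl (p i)) (bl (u i)) = nsq (bl (p i)).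
      rewrite -blC blI rdotC; apply/eqP; rewrite /nsq bb -subr_eq0 -rdotNl -rdotDl.
      by rewrite o2.
    move: c; rewrite e1; have [->|bn] := eqVneq (nsq (bl (p i))) 0.
      by move=> _; exact: rdot_ge0.
    by rewrite expr2 ler_pM2l// lt_neqAle eq_sym bn rdot_ge0.
  move: o1 o2 bs; rewrite /nsq !rdotE (rdotC (p i) (u i)) (rdotC (bl (p i)) (u i)).
  rewrite (rdotC (bl (p i)) (p i)) uu bb; lra.
have : \sum_i nsq (u i - (p i - bl (p i))) <= \sum_(i < n) (1 - rdot (p i) (u i) + eps).
  by apply: ler_sum => i _.
rewrite big_split sumrB /= hp !sumr_const !card_ord -[eps *+ n]mulr_natl.
rewrite /Delta_rel -/(kernel_closure X Y); move: d => /= d h.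
move: (n%:R * eps) h => a h; lra.
Qed.

End Relative.
End DeltaBounds.
Arguments scaled_part {R H M} l lam j.

(** * From the relative bounds to Delta *)

Section DeltaOne.
Variables (R : realType) (H : hilbert R) (M : vN_algebra H).
Variables (tau : elt M -> R[i]) (tau_tr : faithful_normal_tracial_state tau).
Variables (S : standard_form tau) (K : hs_space S).
Hypothesis Z_diffuse : diffuse_center M.
Implicit Types (x y q : elt M).

Lemma scaling_avoids (eps : R) (l : seq (elt M)) n (X : 'I_n -> elt M) :
  cpartition tau eps 1 l ->
  exists2 lam : R, lam != 0 & forall i j, X i <> scaled_part l lam j.
Proof.
move=> hl.
have t0 (j : 'I_(size l)) : 0 < tr tau (tnth (in_tuple l) j).
  have jl : tnth (in_tuple l) j \in l by exact: mem_tnth.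
  by apply: (tr_gt0 tau_tr (part_cproj hl jl)); exact/eqP/(part_neq0 hl).
pose r i (j : 'I_(size l)) := `|tr tau (X i)| / tr tau (tnth (in_tuple l) j).
have r0 i j : 0 <= r i j by rewrite divr_ge0// ltW.
have s0 : 0 <= \sum_i \sum_j r i j by do 2 (apply: sumr_ge0 => ? _).
have l0 : 0 < 1 + \sum_i \sum_j r i j by rewrite ltr_pwDl.
(* This exceeds every ratio [r i j], so the trace of a scaled member is larger than that of any
   [X i]. *)
exists (1 + \sum_i \sum_j r i j) => [|i j /(congr1 (tr tau))]; first by rewrite gt_eqF.
rewrite /scaled_part /tr (tauZ tau_tr) ReZ -/(tr tau _) -/(tr tau _) => h.
have : r i j <= \sum_i \sum_j r i j.
  rewrite (bigD1 i)//= (bigD1 j)//= -addrA lerDl addr_ge0//; apply: sumr_ge0 => ? _ //.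
  by apply: sumr_ge0 => ? _.
rewrite /r ler_pdivrMr// => h2; have := ler_norm (tr tau (X i)); have := t0 j.
move: h2; rewrite {2}h mulrDl mul1r; set a := \sum_i _.
by move: (a * _) => b h3 h4 h5; lra.
Qed.

Lemma scaled_part_inj (eps : R) (l : seq (elt M)) (lam : R) : cpartition tau eps 1 l ->
  lam != 0 -> injective (scaled_part l lam).
Proof.
move=> hl l0 i j /(congr1 (fun x => (lam^-1)%:C *: x)).
rewrite /scaled_part !scalerA -rmorphM mulVf// rmorph1 !scale1r !(tnth_nth 0) /=.
by move=> /eqP; rewrite nth_uniq ?(part_uniq hl)// => /eqP/val_inj.
Qed.

Lemma scaled_part_star (eps : R) (l : seq (elt M)) (lam : R) j : cpartition tau eps 1 l ->
  star (scaled_part l lam j) = scaled_part l lam j.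
Proof.
move=> hl; rewrite /scaled_part starZ cproj_sa; last exact/(part_cproj hl)/mem_tnth.
by congr (_ *: _); exact: conjc_real.
Qed.

(** In the lower bound F may be chosen, so it can absorb the partition; [undup] provides the
    injective listing. *)
Lemma generating_family (l : seq (elt M)) n0 (X0 : 'I_n0 -> elt M) : generates X0 ->
  (forall q, q \in l -> star q = q) ->
  exists n (X : 'I_n -> elt M),
    [/\ injective X, star_closed_family (range X), generates X &
        forall q, q \in l -> range X q].
Proof.
move=> gX0 hl.
pose s := undup (codom X0 ++ [seq star x | x <- codom X0] ++ l).
have rangeE x : range (tnth (in_tuple s)) x <-> x \in s.
  split=> [[j _ <-]|/(tnthP (in_tuple s))[j ->]]; [exact: mem_tnth|by exists j].
exists (size s), (tnth (in_tuple s)); split.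
- move=> i j; rewrite !(tnth_nth 0) /= => /eqP.
  by rewrite nth_uniq ?undup_uniq// => /eqP/val_inj.
- move=> x /rangeE; rewrite mem_undup !mem_cat => xs; apply/rangeE.
  rewrite mem_undup !mem_cat; case/or3P: xs => [xc|/mapP[y yc ->]|xl].
  + by rewrite map_f ?orbT.
  + by rewrite starK yc.
  + by rewrite hl// xl !orbT.
- move=> P hP; apply: gX0 => i.
  have /rangeE[j _ <-] : X0 i \in s by rewrite mem_undup mem_cat codom_f.
  exact: hP.
- by move=> q ql; apply/rangeE; rewrite mem_undup !mem_cat ql !orbT.
Qed.

Lemma Delta_le1 : (Delta K <= 1)%E.
Proof.
apply: ge_ereal_sup => _ [n [X [injX sX gX ->]]].
apply/lee_addgt0Pr => e e0.
(* The error in [Delta_rel_le] is [n] times the bound on the traces, and [n] is fixed with F before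
   the partition is chosen. *)
have d0 : 0 < e / n.+1%:R by rewrite divr_gt0.
have [l hl] := part_exists tau_tr Z_diffuse d0.
have [lam lam0 hlam] := scaling_avoids X hl.
apply: le_trans (_ : ((Delta_rel K X (scaled_part l lam))%:E <= _)%E).
  apply: ereal_inf_lbound; exists (size l), (scaled_part l lam); split=> //.
  - exact: scaled_part_inj hl lam0.
  - move=> x [xX|[j _ <-]]; first by left; exact: sX.
    by right; rewrite (scaled_part_star _ _ hl); exists j.
rewrite -EFinD lee_fin; apply: le_trans (Delta_rel_le tau_tr K hl X lam0) _.
rewrite lerD2l mulrCA ler_piMr// ?(ltW e0)//.
by rewrite ler_pdivrMr ?ltr0n// mul1r ler_nat.
Qed.

(** Once F contains the partition, [Delta_rel_ge] bounds Delta(F : F') for every F' alike, so the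
    bound passes to the infimum. *)
Lemma Delta_ge1 n0 (X0 : 'I_n0 -> elt M) : generates X0 -> (1 <= Delta K)%E.
Proof.
move=> gX0; apply/lee_addgt0Pr => e e0.
have [l hl] := part_exists tau_tr Z_diffuse e0.
have [|n [X [injX sX gX lX]]] := generating_family (l := l) gX0.
  by move=> q ql; exact/cproj_sa/(part_cproj hl).
have h : ((1 - e)%:E <= Delta K)%E.
  apply: le_trans (ereal_sup_ubound _); last by exists n, X; split=> //.
  apply: le_ereal_inf_tmp => _ [m [Y [_ _ _ ->]]].
  by rewrite lee_fin; exact: (Delta_rel_ge tau_tr K hl).
by have := leeD2r e%:E h; rewrite -EFinD subrK.
Qed.

End DeltaOne.

Theorem corollary3p5 (R : realType) (H : hilbert R) (M : vN_algebra H)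
  (tau : elt M -> R[i]) (tau_tr : faithful_normal_tracial_state tau)
  (S : standard_form tau) (K : hs_space S)
  (Z_diffuse : diffuse_center M) :
  betti K 1 = 0%E /\
  ((exists (n : nat) (X : 'I_n -> elt M), generates X) -> Delta K = 1%E).
Proof.
split=> [|[n [X gX]]]; first exact: betti1.
by apply/eqP; rewrite eq_le Delta_le1//= (Delta_ge1 tau_tr K Z_diffuse gX).
Qed.
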